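(* For all integers $n\ge 651$, $$10q(n+3)^2+6q(n+1)q(n+5)>15q(n+2)q(n+4)+q(n)q(n+6).$$
   Context: $q(n)$ denotes the number of partitions of $n$ into distinct parts. *)

(* Defs.v *)
From mathcomp Require Import all_boot.

Set Implicit Arguments.
Unset Strict Implicit.
Unset Printing Implicit Defensive.

(* A partition of n into distinct parts is identified with its set of parts: a
   finite set of positive integers with sum n.  Every part is at most n, so
   these are exactly the A : {set 'I_n.+1} below; q 0 = 1 (the empty set). *)
Definition q (n : nat) : nat :=
  #|[set A : {set 'I_n.+1} | (ord0 \notin A) && (\sum_(i in A) i == n)]|.

(* Main.v *)
From Stdlib Require Import Reals Lra Lia ZArith NArith List.
From Coquelicot Require Import Coquelicot.

(* Write [m = n + 3]. The quantity to be shown positive,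
   [10 q(m)^2 - 15 q(m-1) q(m+1) + 6 q(m-2) q(m+2) - q(m-3) q(m+3)], is half of
   [sum_j (-1)^j C(6, 3+j) q(m+j) q(m-j)].  Inserting Cauchy's formula for the
   coefficients turns it into a double integral of [F(t) F(s) exp (- i m (t + s))] against
   the nonnegative kernel [(2 sin ((t - s) / 2))^6], where [F] is the generating function
   [prod (1 + X^k) = exp (sum_(j, k odd) X^(jk) / j)] on a circle of radius [exp (- tau)].
   When [m] is the saddle point for [tau] the phase is cubic in [t] and [F] decays like a
   Gaussian, so positivity only needs a crude form of the saddle-point estimate: no
   asymptotic expansion of [q] and no cancellation is involved.  Expanding the kernel by
   [sin ((t - s) / 2) = sin (t/2) cos (s/2) - cos (t/2) sin (s/2)] reduces the double
   integral to products of the one-dimensional integrals [evenint] and [oddint] below.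
   The estimate works for [m >= 12000]; the remaining [n] are checked on a table of [q],
   computed from [1 + X/(1-X) (1 + X^2/(1-X^2) (1 + X^3/(1-X^3) (...)))]. *)

(** * Finite sums, and sums over the box of frequencies *)

Section Sums.
Local Open Scope R_scope.

(** Neither complex analysis nor infinite products are used. Once the logarithm of [F] is cut off to
    a finite box, Cauchy's formula is a real integral over half a circle. It is identified with the
    coefficient because it solves a first-order differential equation in the radius and obeys the
    recurrence given by the logarithmic derivative, which [q] obeys as well. Each estimate then
    carries a truncation error, made negligible by the cutoff [4 m^2].

    Positivity has room to spare: the product of the even integrals of orders four and two has
    weight 15, that of orders six and zero only weight 1, and the square of the odd integral of
    order three can be discarded. The integral of order six may even be bounded below by a negative
    quantity.

    The threshold 12000 is [33/40 * 120^2 + 120], the upper bound for the mean at [tau = 1/120].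
    From there on the end [tau / 2] of the central arc lies almost seven standard deviations from
    the saddle, so the outer arc and the cubic phase are both small perturbations. *)

Fixpoint rsum (n : nat) (f : nat -> R) : R :=
  match n with O => 0 | S p => rsum p f + f p end.

Lemma rsum_ext n f g : (forall i, (i < n)%nat -> f i = g i) -> rsum n f = rsum n g.
Proof.
induction n as [|n IH]; intros H; simpl; [reflexivity|].
rewrite IH, H; auto; intros; apply H; lia.
Qed.

Lemma rsum_plus n f g : rsum n (fun i => f i + g i) = rsum n f + rsum n g.
Proof. induction n as [|n IH]; simpl; [ring|]. rewrite IH; ring. Qed.

Lemma rsum_scal n c f : rsum n (fun i => c * f i) = c * rsum n f.
Proof. induction n as [|n IH]; simpl; [ring|]. rewrite IH; ring. Qed.

Lemma rsum_le n f g : (forall i, (i < n)%nat -> f i <= g i) -> rsum n f <= rsum n g.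
Proof.
induction n as [|n IH]; intros H; simpl; [lra|].
apply Rplus_le_compat; [apply IH; intros; apply H; lia | apply H; lia].
Qed.

Lemma rsum_zero n f : (forall i, (i < n)%nat -> f i = 0) -> rsum n f = 0.
Proof.
intros H; rewrite (rsum_ext n f (fun i => 0 * 0)).
- rewrite rsum_scal; ring.
- intros; rewrite H; auto; ring.
Qed.

Lemma rsum_nonneg n f : (forall i, (i < n)%nat -> 0 <= f i) -> 0 <= rsum n f.
Proof.
intros H; rewrite <- (rsum_zero n (fun _ => 0)) by auto.
apply rsum_le; exact H.
Qed.

Lemma rsum_le_range n N f :
  (n <= N)%nat -> (forall i, (i < N)%nat -> 0 <= f i) -> rsum n f <= rsum N f.
Proof.
induction 1 as [|N HN IH]; intros H; [lra|]; simpl.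
assert (0 <= f N) by (apply H; lia).
assert (rsum n f <= rsum N f) by (apply IH; intros; apply H; lia).
lra.
Qed.

Lemma rsum_swap n m (f : nat -> nat -> R) :
  rsum n (fun i => rsum m (fun j => f i j)) = rsum m (fun j => rsum n (fun i => f i j)).
Proof.
induction n as [|n IH]; simpl.
- symmetry; apply rsum_zero; auto.
- rewrite IH, rsum_plus; reflexivity.
Qed.

Lemma rsum_recl n f : rsum (S n) f = f O + rsum n (fun i => f (S i)).
Proof.
induction n as [|n IH]; [simpl; ring|].
change (rsum (S (S n)) f) with (rsum (S n) f + f (S n)).
rewrite IH; simpl; ring.
Qed.

Lemma is_derive_rsum n (f : nat -> R -> R) (df : nat -> R) (x : R) :
  (forall i, is_derive (f i) x (df i)) ->
  is_derive (fun y => rsum n (fun i => f i y)) x (rsum n df).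
Proof.
intros H; induction n as [|n IH]; simpl.
- apply (is_derive_const (V := R_NormedModule) 0 x).
- apply (is_derive_plus (V := R_NormedModule)); auto.
Qed.

Lemma continuity_2d_rsum n (f : nat -> R -> R -> R) x y :
  (forall i, continuity_2d_pt (f i) x y) ->
  continuity_2d_pt (fun u v => rsum n (fun i => f i u v)) x y.
Proof.
intros H; induction n as [|n IH]; simpl.
- apply continuity_2d_pt_const.
- apply continuity_2d_pt_plus; auto.
Qed.

(* The frequencies [j * k], [k] odd, are those occurring in
   [sum_j 1 / (2 j sinh (j t))], the logarithm of [prod_k (1 + exp (- k t))];
   the index set is cut off to a box so that every sum below is finite. *)
Definition box (B : nat) (f : nat -> nat -> R) : R :=
  rsum B (fun j => rsum B (fun i => f (S j) (2 * i + 1)%nat)).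

Lemma box_ext B f g : (forall j k, (1 <= j)%nat -> (1 <= k)%nat -> f j k = g j k) -> box B f = box B g.
Proof. intros H; apply rsum_ext; intros; apply rsum_ext; intros; apply H; lia. Qed.

Lemma box_plus B f g : box B (fun j k => f j k + g j k) = box B f + box B g.
Proof.
unfold box; rewrite <- rsum_plus; apply rsum_ext; intros; apply rsum_plus.
Qed.

Lemma box_scal B c f : box B (fun j k => c * f j k) = c * box B f.
Proof.
unfold box; rewrite <- rsum_scal; apply rsum_ext; intros; apply rsum_scal.
Qed.

Lemma box_le B f g : (forall j k, (1 <= j)%nat -> (1 <= k)%nat -> f j k <= g j k) -> box B f <= box B g.
Proof. intros H; apply rsum_le; intros; apply rsum_le; intros; apply H; lia. Qed.

Lemma box_nonneg B f : (forall j k, (1 <= j)%nat -> (1 <= k)%nat -> 0 <= f j k) -> 0 <= box B f.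
Proof. intros H; apply rsum_nonneg; intros; apply rsum_nonneg; intros; apply H; lia. Qed.

Lemma is_derive_box B (f : nat -> nat -> R -> R) (df : nat -> nat -> R) (x : R) :
  (forall j k, is_derive (f j k) x (df j k)) ->
  is_derive (fun y => box B (fun j k => f j k y)) x (box B df).
Proof.
intros H; unfold box.
apply (is_derive_rsum B (fun j y => rsum B (fun i => f (S j) (2 * i + 1)%nat y))).
intros j; apply (is_derive_rsum B (fun i y => f (S j) (2 * i + 1)%nat y)); auto.
Qed.

Lemma continuity_2d_box B (f : nat -> nat -> R -> R -> R) x y :
  (forall j k, continuity_2d_pt (f j k) x y) ->
  continuity_2d_pt (fun u v => box B (fun j k => f j k u v)) x y.
Proof.
intros H; unfold box.
apply (continuity_2d_rsum B (fun j u v => rsum B (fun i => f (S j) (2 * i + 1)%nat u v))).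
intros j; apply (continuity_2d_rsum B (fun i u v => f (S j) (2 * i + 1)%nat u v)); auto.
Qed.

End Sums.

(** * Fourier representation of the coefficients *)

Section Fourier.
Local Open Scope R_scope.

Variable B : nat.

(* [cosum x t + i sinsum x t] is the (truncated) logarithm of the generating
   function of [q] at [x exp (i t)]. *)
Definition cosum (x t : R) : R := box B (fun j k => x ^ (j * k) / INR j * cos (INR (j * k) * t)).
Definition sinsum (x t : R) : R := box B (fun j k => x ^ (j * k) / INR j * sin (INR (j * k) * t)).
Definition dcosum (x t : R) : R := box B (fun j k => INR k * x ^ (j * k) * cos (INR (j * k) * t)).
Definition dsinsum (x t : R) : R := box B (fun j k => INR k * x ^ (j * k) * sin (INR (j * k) * t)).

Lemma is_derive_cosum_t x t : is_derive (cosum x) t (- dsinsum x t).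
Proof.
unfold cosum, dsinsum.
replace (- box B (fun j k => INR k * x ^ (j * k) * sin (INR (j * k) * t)))
  with (box B (fun j k => x ^ (j * k) / INR j * (- (INR (j * k) * sin (INR (j * k) * t))))).
- apply (is_derive_box B (fun j k t => x ^ (j * k) / INR j * cos (INR (j * k) * t))).
  intros j k; auto_derive; [exact I|ring].
- transitivity ((-1) * box B (fun j k => INR k * x ^ (j * k) * sin (INR (j * k) * t))); [|ring].
  rewrite <- box_scal; apply box_ext; intros j k Hj Hk.
  rewrite mult_INR; field; apply not_0_INR; lia.
Qed.

Lemma is_derive_sinsum_t x t : is_derive (sinsum x) t (dcosum x t).
Proof.
unfold sinsum, dcosum.
replace (box B (fun j k => INR k * x ^ (j * k) * cos (INR (j * k) * t)))
  with (box B (fun j k => x ^ (j * k) / INR j * (INR (j * k) * cos (INR (j * k) * t)))).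
- apply (is_derive_box B (fun j k t => x ^ (j * k) / INR j * sin (INR (j * k) * t))).
  intros j k; auto_derive; [exact I|ring].
- apply box_ext; intros j k Hj Hk.
  rewrite mult_INR; field; apply not_0_INR; lia.
Qed.

(** The derivatives in [x], written with a lowered exponent instead of a division by [x], because
    the differential equation in the radius is integrated from [x = 0]. *)
Definition xcosum (x t : R) : R := box B (fun j k => INR k * x ^ pred (j * k) * cos (INR (j * k) * t)).
Definition xsinsum (x t : R) : R := box B (fun j k => INR k * x ^ pred (j * k) * sin (INR (j * k) * t)).

Lemma pow_pred_mul x j k : (1 <= j)%nat -> (1 <= k)%nat -> x * x ^ pred (j * k) = x ^ (j * k).
Proof.
intros Hj Hk; destruct (j * k)%nat as [|n] eqn:E; [nia|reflexivity].
Qed.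

Lemma xcosum_mul x t : x * xcosum x t = dcosum x t.
Proof.
unfold xcosum, dcosum; rewrite <- box_scal; apply box_ext; intros j k Hj Hk.
rewrite <- (pow_pred_mul x j k) by auto; ring.
Qed.

Lemma xsinsum_mul x t : x * xsinsum x t = dsinsum x t.
Proof.
unfold xsinsum, dsinsum; rewrite <- box_scal; apply box_ext; intros j k Hj Hk.
rewrite <- (pow_pred_mul x j k) by auto; ring.
Qed.

Lemma is_derive_cosum_x x t : is_derive (fun y => cosum y t) x (xcosum x t).
Proof.
unfold cosum, xcosum.
replace (box B (fun j k => INR k * x ^ pred (j * k) * cos (INR (j * k) * t)))
  with (box B (fun j k => INR (j * k) * x ^ pred (j * k) / INR j * cos (INR (j * k) * t))).
- apply (is_derive_box B (fun j k y => y ^ (j * k) / INR j * cos (INR (j * k) * t))).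
  intros j k; auto_derive; [exact I|unfold Rdiv; ring].
- apply box_ext; intros j k Hj Hk.
  rewrite mult_INR; field; apply not_0_INR; lia.
Qed.

Lemma is_derive_sinsum_x x t : is_derive (fun y => sinsum y t) x (xsinsum x t).
Proof.
unfold sinsum, xsinsum.
replace (box B (fun j k => INR k * x ^ pred (j * k) * sin (INR (j * k) * t)))
  with (box B (fun j k => INR (j * k) * x ^ pred (j * k) / INR j * sin (INR (j * k) * t))).
- apply (is_derive_box B (fun j k y => y ^ (j * k) / INR j * sin (INR (j * k) * t))).
  intros j k; auto_derive; [exact I|unfold Rdiv; ring].
- apply box_ext; intros j k Hj Hk.
  rewrite mult_INR; field; apply not_0_INR; lia.
Qed.

Lemma continuity_2d_trig (f : R -> R) (n p : nat) c x t :
  continuity f ->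
  continuity_2d_pt (fun u v => c * u ^ p * f (INR n * v)) x t.
Proof.
intros Hf; apply continuity_2d_pt_mult.
- apply (continuity_1d_2d_pt_comp (fun u => c * u ^ p) (fun u v => u)).
  + apply continuity_pt_filterlim, (ex_derive_continuous (fun u => c * u ^ p)); auto_derive; exact I.
  + apply continuity_2d_pt_id1.
- apply (continuity_1d_2d_pt_comp f (fun u v => INR n * v)); [apply Hf|].
  apply continuity_2d_pt_mult; [apply continuity_2d_pt_const|apply continuity_2d_pt_id2].
Qed.

Lemma continuity_2d_cosum x t : continuity_2d_pt cosum x t.
Proof.
apply (continuity_2d_box B (fun j k u v => u ^ (j * k) / INR j * cos (INR (j * k) * v))).
intros j k; apply continuity_2d_pt_ext with (fun u v => / INR j * u ^ (j * k) * cos (INR (j * k) * v)).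
- intros; unfold Rdiv; ring.
- apply continuity_2d_trig, continuity_cos.
Qed.

Lemma continuity_2d_sinsum x t : continuity_2d_pt sinsum x t.
Proof.
apply (continuity_2d_box B (fun j k u v => u ^ (j * k) / INR j * sin (INR (j * k) * v))).
intros j k; apply continuity_2d_pt_ext with (fun u v => / INR j * u ^ (j * k) * sin (INR (j * k) * v)).
- intros; unfold Rdiv; ring.
- apply continuity_2d_trig, continuity_sin.
Qed.

Lemma continuity_2d_xcosum x t : continuity_2d_pt xcosum x t.
Proof.
apply (continuity_2d_box B (fun j k u v => INR k * u ^ pred (j * k) * cos (INR (j * k) * v))).
intros j k; apply continuity_2d_trig, continuity_cos.
Qed.

Lemma continuity_2d_xsinsum x t : continuity_2d_pt xsinsum x t.
Proof.
apply (continuity_2d_box B (fun j k u v => INR k * u ^ pred (j * k) * sin (INR (j * k) * v))).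
intros j k; apply continuity_2d_trig, continuity_sin.
Qed.

Lemma continuity_exp : continuity exp.
Proof. apply derivable_continuous, derivable_exp. Qed.

(** For a natural number [m] this is [PI] times the coefficient of index [m] times [x^m]: by
    conjugation symmetry the real part of [F (x exp (i t)) exp (- i m t)] over half the circle
    suffices. The index is real because negative indices and shifts of [m] occur. *)
Definition coefint (m x : R) : R :=
  RInt (fun t => exp (cosum x t) * cos (sinsum x t - m * t)) 0 PI.

Lemma continuous_cosum x t : continuous (cosum x) t.
Proof.
apply (ex_derive_continuous (V := R_NormedModule)).
exists (- dsinsum x t); apply is_derive_cosum_t.
Qed.

Lemma continuous_sinsum x t : continuous (sinsum x) t.
Proof.
apply (ex_derive_continuous (V := R_NormedModule)).
exists (dcosum x t); apply is_derive_sinsum_t.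
Qed.

Lemma ex_derive_coefint_integrand m x t :
  ex_derive (fun t => exp (cosum x t) * cos (sinsum x t - m * t)) t.
Proof.
assert (ex_derive (cosum x) t) by (eexists; apply is_derive_cosum_t).
assert (ex_derive (sinsum x) t) by (eexists; apply is_derive_sinsum_t).
auto_derive; auto.
Qed.

Lemma ex_RInt_coefint m x a b :
  ex_RInt (fun t => exp (cosum x t) * cos (sinsum x t - m * t)) a b.
Proof.
apply (ex_RInt_continuous (V := R_CompleteNormedModule)); intros t _.
apply (ex_derive_continuous (V := R_NormedModule)), ex_derive_coefint_integrand.
Qed.

Definition dcoef (m x t : R) : R :=
  exp (cosum x t) * (xcosum x t * cos (sinsum x t - m * t) - xsinsum x t * sin (sinsum x t - m * t)).

Lemma is_derive_integrand_x m x t :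
  is_derive (fun x => exp (cosum x t) * cos (sinsum x t - m * t)) x (dcoef m x t).
Proof.
assert (Hc := is_derive_cosum_x x t); assert (Hs := is_derive_sinsum_x x t).
auto_derive.
- repeat split; [exists (xcosum x t); exact Hc|exists (xsinsum x t); exact Hs].
- replace (Derive (fun x0 => cosum x0 t) x) with (xcosum x t) by (symmetry; apply is_derive_unique; exact Hc).
  replace (Derive (fun x0 => sinsum x0 t) x) with (xsinsum x t) by (symmetry; apply is_derive_unique; exact Hs).
  unfold dcoef, Rminus; ring.
Qed.

Lemma is_derive_coefint m x : is_derive (coefint m) x (RInt (dcoef m x) 0 PI).
Proof.
replace (RInt (dcoef m x) 0 PI)
  with (RInt (fun t => Derive (fun u => exp (cosum u t) * cos (sinsum u t - m * t)) x) 0 PI).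
- apply (is_derive_RInt_param (fun x t => exp (cosum x t) * cos (sinsum x t - m * t)) 0 PI x).
  + exists (mkposreal 1 Rlt_0_1); intros y _ t _; eexists; apply is_derive_integrand_x.
  + intros t _; apply continuity_2d_pt_ext with (dcoef m).
    * intros u v; symmetry; apply is_derive_unique, is_derive_integrand_x.
    * assert (Ha : continuity_2d_pt (fun u v => sinsum u v - m * v) x t).
      { apply continuity_2d_pt_minus; [apply continuity_2d_sinsum|].
        apply continuity_2d_pt_mult; [apply continuity_2d_pt_const|apply continuity_2d_pt_id2]. }
      unfold dcoef; apply continuity_2d_pt_mult.
      { apply (continuity_1d_2d_pt_comp exp cosum); [apply continuity_exp|apply continuity_2d_cosum]. }
      apply continuity_2d_pt_minus; apply continuity_2d_pt_mult.
      { apply continuity_2d_xcosum. }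
      { apply (continuity_1d_2d_pt_comp cos _ _ _ (continuity_cos _) Ha). }
      { apply continuity_2d_xsinsum. }
      { apply (continuity_1d_2d_pt_comp sin _ _ _ (continuity_sin _) Ha). }
  + exists (mkposreal 1 Rlt_0_1); intros y _; apply ex_RInt_coefint.
- apply RInt_ext; intros t _; apply is_derive_unique, is_derive_integrand_x.
Qed.

Lemma sin_INR_PI n : sin (INR n * PI) = 0.
Proof.
induction n as [|n IH].
- simpl; rewrite Rmult_0_l; apply sin_0.
- rewrite S_INR, Rmult_plus_distr_r, Rmult_1_l, neg_sin, IH; ring.
Qed.

Lemma sin_IZR_PI z : sin (IZR z * PI) = 0.
Proof.
destruct (Z_le_gt_dec 0 z) as [H|H].
- rewrite <- (Z2Nat.id z H), <- INR_IZR_INZ; apply sin_INR_PI.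
- replace (IZR z * PI) with (- (IZR (- z) * PI)) by (rewrite opp_IZR; ring).
  rewrite sin_neg, <- (Z2Nat.id (- z)) by lia.
  rewrite <- INR_IZR_INZ, sin_INR_PI; ring.
Qed.

Lemma sinsum_0 x : sinsum x 0 = 0.
Proof.
unfold sinsum; rewrite (box_ext B _ (fun j k => 0 * 0)).
- rewrite box_scal; ring.
- intros; rewrite Rmult_0_r, sin_0; ring.
Qed.

Lemma sinsum_PI x : sinsum x PI = 0.
Proof.
unfold sinsum; rewrite (box_ext B _ (fun j k => 0 * 0)).
- rewrite box_scal; ring.
- intros; rewrite sin_INR_PI; ring.
Qed.

Lemma continuous_section (f : R -> R -> R) x t : continuity_2d_pt f x t -> continuous (f x) t.
Proof.
intros H; apply continuity_pt_filterlim; intros e He; destruct (H (mkposreal e He)) as [d Hd].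
exists d; split; [apply cond_pos|]; intros y [_ Hy]; apply (Hd x y); [|exact Hy].
rewrite Rminus_diag, Rabs_R0; apply cond_pos.
Qed.

Lemma continuous_dcosum x t : continuous (dcosum x) t.
Proof.
apply continuity_pt_filterlim.
apply (continuity_pt_ext (fun t => x * xcosum x t)); [intros; apply xcosum_mul|].
apply continuity_pt_mult; [apply continuity_pt_const; intros u v; reflexivity|].
apply continuity_pt_filterlim, (continuous_section xcosum), continuity_2d_xcosum.
Qed.

Lemma continuous_dsinsum x t : continuous (dsinsum x) t.
Proof.
apply continuity_pt_filterlim.
apply (continuity_pt_ext (fun t => x * xsinsum x t)); [intros; apply xsinsum_mul|].
apply continuity_pt_mult; [apply continuity_pt_const; intros u v; reflexivity|].
apply continuity_pt_filterlim, (continuous_section xsinsum), continuity_2d_xsinsum.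
Qed.

Lemma continuous_arg m x t : continuous (fun t => sinsum x t - m * t) t.
Proof.
apply (continuous_minus (sinsum x) (fun t => m * t)); [apply continuous_sinsum|].
apply (continuous_mult (fun _ => m) (fun t => t)); [apply continuous_const|apply continuous_id].
Qed.

(** The [t]-derivative of [exp (cosum x t) * sin (sinsum x t - z * t)] is integrated; the boundary
    terms vanish at [0] and [PI] because [z] is an integer. *)
Lemma RInt_boundary (z : Z) x :
  RInt (fun t => exp (cosum x t) * (dcosum x t * cos (sinsum x t - IZR z * t) - dsinsum x t * sin (sinsum x t - IZR z * t))) 0 PI
  = IZR z * coefint (IZR z) x.
Proof.
set (f := fun t => exp (cosum x t) * (dcosum x t * cos (sinsum x t - IZR z * t) - dsinsum x t * sin (sinsum x t - IZR z * t))).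
set (g := fun t => exp (cosum x t) * cos (sinsum x t - IZR z * t)).
assert (Hd : forall t, is_derive (fun t => exp (cosum x t) * sin (sinsum x t - IZR z * t)) t (f t - IZR z * g t)).
{ intros t; assert (Hc := is_derive_cosum_t x t); assert (Hs := is_derive_sinsum_t x t).
  auto_derive.
  - repeat split; [exists (- dsinsum x t); exact Hc|exists (dcosum x t); exact Hs].
  - replace (Derive (fun x0 => cosum x x0) t) with (- dsinsum x t) by (symmetry; apply is_derive_unique; exact Hc).
    replace (Derive (fun x0 => sinsum x x0) t) with (dcosum x t) by (symmetry; apply is_derive_unique; exact Hs).
    unfold f, g, Rminus; ring. }
assert (Hexp : forall t, continuous (fun t => exp (cosum x t)) t).
{ intros t; apply (continuous_comp (cosum x) exp); [apply continuous_cosum|].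
  apply continuity_pt_filterlim, continuity_exp. }
assert (Hcos : forall t, continuous (fun t => cos (sinsum x t - IZR z * t)) t).
{ intros t; apply (continuous_comp (fun t => sinsum x t - IZR z * t) cos); [apply continuous_arg|].
  apply continuity_pt_filterlim, continuity_cos. }
assert (Hsin : forall t, continuous (fun t => sin (sinsum x t - IZR z * t)) t).
{ intros t; apply (continuous_comp (fun t => sinsum x t - IZR z * t) sin); [apply continuous_arg|].
  apply continuity_pt_filterlim, continuity_sin. }
assert (Hg : forall t, continuous g t) by (intros t; apply (continuous_mult (fun t => exp (cosum x t))); auto).
assert (Hf : forall t, continuous f t).
{ intros t; apply (continuous_mult (fun t => exp (cosum x t))); [auto|].
  apply (continuous_minus (fun t => dcosum x t * cos (sinsum x t - IZR z * t)));
    [apply (continuous_mult (dcosum x))|apply (continuous_mult (dsinsum x))]; auto;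
    [apply continuous_dcosum|apply continuous_dsinsum]. }
assert (Hcg : forall t, continuous (fun t => IZR z * g t) t).
{ intros t; apply (continuous_mult (fun _ => IZR z) g); [apply continuous_const|apply Hg]. }
assert (HI := is_RInt_derive (fun t => exp (cosum x t) * sin (sinsum x t - IZR z * t)) (fun t => f t - IZR z * g t) 0 PI
  (fun t _ => Hd t) (fun t _ => continuous_minus f (fun t => IZR z * g t) t (Hf t) (Hcg t))).
apply is_RInt_unique in HI.
assert (E : RInt (fun t => f t - IZR z * g t) 0 PI = RInt f 0 PI - IZR z * RInt g 0 PI).
{ assert (ef : ex_RInt f 0 PI) by (apply (ex_RInt_continuous (V := R_CompleteNormedModule)); auto).
  assert (eg : ex_RInt g 0 PI) by (apply (ex_RInt_continuous (V := R_CompleteNormedModule)); auto).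
  rewrite (RInt_minus f (fun t => IZR z * g t)); auto.
  - rewrite (RInt_scal g); auto.
  - apply (ex_RInt_scal g); auto. }
rewrite E in HI; revert HI.
rewrite sinsum_0, sinsum_PI; unfold minus, plus, opp; simpl.
rewrite !Rminus_0_l, Rmult_0_r, Ropp_0, sin_0, sin_neg, sin_IZR_PI.
unfold coefint; fold g; lra.
Qed.

(** [F] depends on [x exp (i t)] only, so [x d/dx] and [d/dt] agree up to a factor [i], and the
    latter has just been integrated by parts. For [x > 0] the integral is therefore a multiple of
    [x^z]. *)
Lemma coefint_ode (z : Z) x : x * RInt (dcoef (IZR z) x) 0 PI = IZR z * coefint (IZR z) x.
Proof.
rewrite <- RInt_boundary.
assert (ex_RInt (dcoef (IZR z) x) 0 PI).
{ apply (ex_RInt_continuous (V := R_CompleteNormedModule)); intros t _.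
  assert (Hc : forall t, continuous (xcosum x) t) by (intros v; apply continuous_section, continuity_2d_xcosum).
  assert (Hs : forall t, continuous (xsinsum x) t) by (intros v; apply continuous_section, continuity_2d_xsinsum).
  unfold dcoef.
  apply (continuous_mult (fun t => exp (cosum x t))).
  - apply (continuous_comp (cosum x) exp); [apply continuous_cosum|].
    apply continuity_pt_filterlim, continuity_exp.
  - apply (continuous_minus (fun t => xcosum x t * cos (sinsum x t - IZR z * t)));
      [apply (continuous_mult (xcosum x))|apply (continuous_mult (xsinsum x))]; auto.
    + apply (continuous_comp (fun t => sinsum x t - IZR z * t) cos); [apply continuous_arg|].
      apply continuity_pt_filterlim, continuity_cos.
    + apply (continuous_comp (fun t => sinsum x t - IZR z * t) sin); [apply continuous_arg|].
      apply continuity_pt_filterlim, continuity_sin. }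
transitivity (RInt (fun t => scal x (dcoef (IZR z) x t)) 0 PI).
- symmetry; apply (RInt_scal (dcoef (IZR z) x)); auto.
- apply RInt_ext; intros t _; unfold scal; simpl; unfold mult; simpl; unfold dcoef.
  rewrite <- xcosum_mul, <- xsinsum_mul; ring.
Qed.

Lemma eq_of_null_derive (f : R -> R) (x : R) :
  0 < x -> (forall y, 0 < y -> is_derive f y 0) -> (forall y, ex_derive f y) -> f x = f 0.
Proof.
intros Hx H Hex; destruct (MVT_gen f 0 x (fun _ => 0)) as [c [_ Hc]].
- intros y; rewrite Rmin_left, Rmax_right by lra; intros Hy; apply H; lra.
- intros; apply continuity_pt_filterlim, (ex_derive_continuous (V := R_NormedModule)), Hex.
- lra.
Qed.

Lemma box_at_0 (f : nat -> nat -> R) : box B (fun j k => 0 ^ (j * k) * f j k) = 0.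
Proof.
rewrite (box_ext B _ (fun j k => 0 * 0)).
- rewrite box_scal; ring.
- intros j k Hj Hk; rewrite pow_i by nia; ring.
Qed.

(** The differential equation makes it constant in the radius, and at radius [0] the integrand is
    [1]. *)
Lemma coefint_0 x : 0 < x -> coefint 0 x = PI.
Proof.
intros Hx; rewrite (eq_of_null_derive (coefint 0) x Hx).
- unfold coefint; rewrite (RInt_ext _ (fun _ => 1)).
  + rewrite RInt_const; unfold scal; simpl; unfold mult; simpl; ring.
  + intros t _; unfold cosum, sinsum.
    rewrite (box_ext B (fun j k => 0 ^ (j * k) / INR j * cos (INR (j * k) * t))
      (fun j k => 0 ^ (j * k) * (/ INR j * cos (INR (j * k) * t)))) by (intros; unfold Rdiv; ring).
    rewrite (box_ext B (fun j k => 0 ^ (j * k) / INR j * sin (INR (j * k) * t))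
      (fun j k => 0 ^ (j * k) * (/ INR j * sin (INR (j * k) * t)))) by (intros; unfold Rdiv; ring).
    rewrite !box_at_0, exp_0, Rmult_0_l, Rminus_0_r, cos_0; apply Rmult_1_l.
- intros y Hy; assert (H := is_derive_coefint 0 y).
  replace 0 with (RInt (dcoef 0 y) 0 PI) at 2; [exact H|].
  assert (E := coefint_ode 0 y); simpl in E; nra.
- intros y; eexists; apply is_derive_coefint.
Qed.

(** [x^k * coefint (- k) x] has derivative zero for [x > 0] and vanishes at [0]: the series [F] has
    no negative powers. *)
Lemma coefint_neg (k : nat) x : (1 <= k)%nat -> 0 < x -> coefint (- INR k) x = 0.
Proof.
intros Hk Hx.
assert (Hz : - INR k = IZR (- Z.of_nat k)) by (rewrite opp_IZR, <- INR_IZR_INZ; reflexivity).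
assert (Hd : forall y, is_derive (fun y => y ^ k * coefint (- INR k) y) y
   (INR k * y ^ pred k * coefint (- INR k) y + y ^ k * RInt (dcoef (- INR k) y) 0 PI)).
{ intros y; assert (H := is_derive_coefint (- INR k) y).
  auto_derive; [repeat split; eexists; exact H|].
  replace (Derive (fun x0 => coefint (- INR k) x0) y) with (RInt (dcoef (- INR k) y) 0 PI)
    by (symmetry; apply is_derive_unique; exact H).
  ring. }
assert (E : x ^ k * coefint (- INR k) x = 0).
{ rewrite (eq_of_null_derive (fun y => y ^ k * coefint (- INR k) y) x Hx).
  - rewrite pow_i by lia; ring.
  - intros y Hy; replace 0 with (INR k * y ^ pred k * coefint (- INR k) y + y ^ k * RInt (dcoef (- INR k) y) 0 PI).
    + apply Hd.
    + assert (Ho := coefint_ode (- Z.of_nat k) y); rewrite <- Hz in Ho.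
      destruct k as [|k]; [lia|]; simpl pred; simpl pow.
      transitivity (y ^ k * (INR (S k) * coefint (- INR (S k)) y + y * RInt (dcoef (- INR (S k)) y) 0 PI)); [ring|].
      rewrite Ho; ring.
  - intros y; eexists; apply Hd. }
assert (x ^ k <> 0) by (apply pow_nonzero; lra).
apply Rmult_integral in E; tauto.
Qed.

Lemma is_RInt_rsum n (f : nat -> R -> R) (l : nat -> R) a b :
  (forall i, is_RInt (f i) a b (l i)) ->
  is_RInt (fun t => rsum n (fun i => f i t)) a b (rsum n l).
Proof.
intros H; induction n as [|n IH]; simpl.
- assert (H0 := is_RInt_const (V := R_NormedModule) a b 0).
  unfold scal in H0; simpl in H0; unfold mult in H0; simpl in H0.
  rewrite Rmult_0_r in H0; exact H0.
- apply (is_RInt_plus (V := R_NormedModule)); auto.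
Qed.

Lemma is_RInt_box (f : nat -> nat -> R -> R) (l : nat -> nat -> R) a b :
  (forall j k, is_RInt (f j k) a b (l j k)) ->
  is_RInt (fun t => box B (fun j k => f j k t)) a b (box B l).
Proof.
intros H; unfold box.
apply (is_RInt_rsum B (fun j t => rsum B (fun i => f (S j) (2 * i + 1)%nat t))).
intros j; apply (is_RInt_rsum B (fun i t => f (S j) (2 * i + 1)%nat t)); auto.
Qed.

(** Integral form of [x F' = (sum of k x^(j k)) F]: a factor [exp (i j k t)] lowers the index by
    [j k], possibly below zero. *)
Lemma coefint_rec (z : Z) x :
  IZR z * coefint (IZR z) x
  = box B (fun j k => INR k * x ^ (j * k) * coefint (IZR (z - Z.of_nat (j * k))) x).
Proof.
rewrite <- RInt_boundary; apply is_RInt_unique.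
apply is_RInt_ext with (fun t => box B (fun j k => INR k * x ^ (j * k) *
  (exp (cosum x t) * cos (sinsum x t - IZR (z - Z.of_nat (j * k)) * t)))).
- intros t _; unfold dcosum, dsinsum.
  match goal with |- ?l = ?r => change (@eq R l r) end; symmetry.
  transitivity (exp (cosum x t) * cos (sinsum x t - IZR z * t) * box B (fun j k => INR k * x ^ (j * k) * cos (INR (j * k) * t))
    + - (exp (cosum x t) * sin (sinsum x t - IZR z * t)) * box B (fun j k => INR k * x ^ (j * k) * sin (INR (j * k) * t))); [ring|].
  rewrite <- !box_scal, <- box_plus; apply box_ext; intros j k _ _.
  replace (sinsum x t - IZR (z - Z.of_nat (j * k)) * t) with ((sinsum x t - IZR z * t) + INR (j * k) * t)
    by (rewrite minus_IZR, <- INR_IZR_INZ; ring).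
  rewrite (cos_plus (sinsum x t - IZR z * t)); ring.
- apply (is_RInt_box (fun j k t => INR k * x ^ (j * k) *
    (exp (cosum x t) * cos (sinsum x t - IZR (z - Z.of_nat (j * k)) * t)))).
  intros j k; apply (is_RInt_scal (V := R_NormedModule)), (RInt_correct (V := R_CompleteNormedModule)), ex_RInt_coefint.
Qed.

(** Two solutions of one recurrence coincide. Where [j * k > n] the integral has a negative index
    and vanishes by [coefint_neg], matching the [0] in the recurrence of [u]. *)
Lemma coefint_eq (u : nat -> R) x :
  0 < x -> u O = 1 ->
  (forall n, (1 <= n <= B)%nat ->
     INR n * u n = box B (fun j k => if (j * k <=? n)%nat then INR k * u (n - j * k)%nat else 0)) ->
  forall n, (n <= B)%nat -> coefint (INR n) x = PI * (u n * x ^ n).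
Proof.
intros Hx Hu0 Hu n; induction n as [n IH] using lt_wf_ind; intros Hn.
destruct (Nat.eq_dec n 0) as [->|Hn0].
- simpl INR; rewrite coefint_0, Hu0 by exact Hx; simpl; ring.
- assert (Hn1 : INR n <> 0) by (apply not_0_INR; lia).
  apply (Rmult_eq_reg_l (INR n)); [|exact Hn1].
  transitivity (PI * x ^ n * (INR n * u n)); [|ring].
  rewrite Hu by lia.
  rewrite INR_IZR_INZ at 1 2; rewrite coefint_rec, <- box_scal; apply box_ext; intros j k Hj Hk.
  destruct (Nat.leb_spec (j * k) n) as [H|H].
  + rewrite <- Nat2Z.inj_sub by exact H; rewrite <- INR_IZR_INZ, IH; [|nia|nia].
    replace (x ^ n) with (x ^ (j * k) * x ^ (n - j * k)) by (rewrite <- pow_add; f_equal; lia).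
    ring.
  + replace (Z.of_nat n - Z.of_nat (j * k))%Z with (- Z.of_nat (j * k - n))%Z by lia.
    rewrite opp_IZR, <- INR_IZR_INZ, coefint_neg by (lia || exact Hx); ring.
Qed.

End Fourier.

(** * Moments of the truncated measure *)

Section Moments.
Local Open Scope R_scope.

(** The binomial coefficient [C (q + i, q)] as an iterated partial sum, that is, the coefficient of
    [y^i] in [1 / (1 - y)^(q+1)]. *)
Fixpoint pyr (q i : nat) : R :=
  match q with O => 1 | S q => rsum (S i) (pyr q) end.

Lemma pyr_nonneg q i : 0 <= pyr q i.
Proof.
revert i; induction q as [|q IH]; intros i; simpl; [lra|].
assert (0 <= rsum i (pyr q)) by (apply rsum_nonneg; auto).
specialize (IH i); lra.
Qed.

Lemma pyr_term_nonneg q y i : 0 <= y -> 0 <= pyr q i * y ^ i.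
Proof. intros Hy; apply Rmult_le_pos; [apply pyr_nonneg|apply pow_le; exact Hy]. Qed.

Lemma pyr_S q i : pyr (S q) (S i) = pyr (S q) i + pyr q (S i).
Proof. reflexivity. Qed.

Lemma pyr_S_0 q : pyr (S q) 0 = pyr q 0.
Proof. simpl; ring. Qed.

Lemma pyr1 i : pyr 1 i = INR i + 1.
Proof. induction i as [|i IH]; [simpl; ring|]. rewrite pyr_S, IH, S_INR; simpl; ring. Qed.

Lemma pyr2 i : pyr 2 i = (INR i + 1) * (INR i + 2) / 2.
Proof.
induction i as [|i IH]; [simpl; field|].
rewrite pyr_S, IH, pyr1, S_INR; field.
Qed.

Lemma pyr3 i : pyr 3 i = (INR i + 1) * (INR i + 2) * (INR i + 3) / 6.
Proof.
induction i as [|i IH]; [simpl; field|].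
rewrite pyr_S, IH, pyr2, S_INR; field.
Qed.

Lemma pyr4 i : pyr 4 i = (INR i + 1) * (INR i + 2) * (INR i + 3) * (INR i + 4) / 24.
Proof.
induction i as [|i IH]; [simpl; field|].
rewrite pyr_S, IH, pyr3, S_INR; field.
Qed.

Lemma pyr_sum_rec q n y :
  rsum (S n) (fun i => pyr (S q) i * y ^ i)
  = y * rsum n (fun i => pyr (S q) i * y ^ i) + rsum (S n) (fun i => pyr q i * y ^ i).
Proof.
rewrite !rsum_recl, pyr_S_0, <- rsum_scal.
rewrite (rsum_ext n (fun i => pyr (S q) (S i) * y ^ S i)
  (fun i => y * (pyr (S q) i * y ^ i) + pyr q (S i) * y ^ S i)).
- rewrite rsum_plus; ring.
- intros i _; rewrite pyr_S; simpl pow; ring.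
Qed.

(** Multiplication by [1 - y] lowers [q] by one, up to a nonnegative boundary term; hence induction
    on [q]. *)
Lemma pyr_sum_le q n y : 0 <= y < 1 -> rsum n (fun i => pyr q i * y ^ i) <= / (1 - y) ^ S q.
Proof.
intros Hy; revert n; induction q as [|q IH]; intros n.
- assert (E : (1 - y) * rsum n (fun i => pyr 0 i * y ^ i) = 1 - y ^ n).
  { induction n as [|n IHn]; [simpl; ring|]. cbn [rsum]; rewrite Rmult_plus_distr_l, IHn; simpl; ring. }
  assert (0 <= y ^ n) by (apply pow_le; lra).
  apply (Rmult_le_reg_l (1 - y)); [lra|]; rewrite E, pow_1, Rinv_r by lra; lra.
- assert (H := pyr_sum_rec q n y).
  assert (H2 := IH (S n)).
  assert (0 <= pyr (S q) n * y ^ n) by (apply pyr_term_nonneg; lra).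
  change (rsum (S n) (fun i => pyr (S q) i * y ^ i))
    with (rsum n (fun i => pyr (S q) i * y ^ i) + pyr (S q) n * y ^ n) in H.
  set (F := rsum n (fun i => pyr (S q) i * y ^ i)) in *.
  assert (0 < / (1 - y) ^ S q) by (apply Rinv_0_lt_compat, pow_lt; lra).
  replace (/ (1 - y) ^ S (S q)) with (/ (1 - y) * / (1 - y) ^ S q)
    by (rewrite <- Rinv_mult; reflexivity).
  apply (Rmult_le_reg_l (1 - y)); [lra|].
  rewrite <- Rmult_assoc, Rinv_r by lra; lra.
Qed.

(** Counterpart of [pyr_sum_le] for finite sums: raising [q] by one costs [L] further terms and a
    factor [1 - y^L]. It is iterated with [L = K] in [odd_sum2_ge]. *)
Lemma pyr_sum_ge q K L y : 0 <= y < 1 ->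
  rsum K (fun i => pyr q i * y ^ i) * (1 - y ^ L) / (1 - y)
  <= rsum (K + L) (fun i => pyr (S q) i * y ^ i).
Proof.
intros Hy.
assert (Hpos : forall q n, 0 <= rsum n (fun i => pyr q i * y ^ i)).
{ intros; apply rsum_nonneg; intros; apply pyr_term_nonneg; lra. }
induction L as [|L IH].
- simpl; rewrite Nat.add_0_r; unfold Rdiv; rewrite Rminus_diag, Rmult_0_r, Rmult_0_l; apply (Hpos (S q)).
- rewrite Nat.add_succ_r, pyr_sum_rec.
  assert (H : rsum K (fun i => pyr q i * y ^ i) <= rsum (S (K + L)) (fun i => pyr q i * y ^ i)).
  { apply rsum_le_range; [lia|]; intros; apply pyr_term_nonneg; lra. }
  assert (y * (rsum K (fun i => pyr q i * y ^ i) * (1 - y ^ L) / (1 - y))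
    <= y * rsum (K + L) (fun i => pyr (S q) i * y ^ i)) by (apply Rmult_le_compat_l; lra).
  replace (rsum K (fun i => pyr q i * y ^ i) * (1 - y ^ S L) / (1 - y))
    with (y * (rsum K (fun i => pyr q i * y ^ i) * (1 - y ^ L) / (1 - y)) + rsum K (fun i => pyr q i * y ^ i))
    by (simpl; field; lra).
  lra.
Qed.

Lemma rsum_shift_le n y c (f g : nat -> R) :
  0 <= y -> f O = 0 -> (forall i, f (S i) = y * g i) ->
  (forall i, 0 <= g i) -> (forall n, rsum n g <= c) -> rsum n f <= y * c.
Proof.
intros Hy H0 HS Hg Hc; destruct n as [|n].
- assert (H := Hc O); simpl in *; nra.
- rewrite rsum_recl, H0, (rsum_ext n _ (fun i => y * g i)) by auto.
  rewrite rsum_scal; assert (H := Hc n); nra.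
Qed.

Lemma le_of_derive (f g df dg : R -> R) (b : R) :
  f 0 = g 0 ->
  (forall x, 0 <= x <= b -> is_derive f x (df x)) ->
  (forall x, 0 <= x <= b -> is_derive g x (dg x)) ->
  (forall x, 0 <= x <= b -> df x <= dg x) ->
  forall x, 0 <= x <= b -> f x <= g x.
Proof.
intros H0 Hf Hg Hle x Hx.
destruct (MVT_gen (fun t => g t - f t) 0 x (fun t => dg t - df t)) as [c [Hc E]].
- rewrite Rmin_left, Rmax_right by lra; intros t Ht.
  apply (is_derive_minus (V := R_NormedModule) g f t (dg t) (df t)); [apply Hg|apply Hf]; lra.
- rewrite Rmin_left, Rmax_right by lra; intros t Ht.
  apply continuity_pt_filterlim, (ex_derive_continuous (V := R_NormedModule) (fun t => g t - f t) t).
  exists (dg t - df t); apply (is_derive_minus (V := R_NormedModule) g f t (dg t) (df t)); [apply Hg|apply Hf]; lra.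
- rewrite Rmin_left, Rmax_right in Hc by lra.
  assert (df c <= dg c) by (apply Hle; lra).
  assert (0 <= (dg c - df c) * (x - 0)) by (apply Rmult_le_pos; lra).
  lra.
Qed.

Lemma is_derive_sinh x : is_derive sinh x (cosh x).
Proof. unfold sinh, cosh; auto_derive; [exact I|field]. Qed.

Lemma is_derive_cosh x : is_derive cosh x (sinh x).
Proof. unfold sinh, cosh; auto_derive; [exact I|field]. Qed.

Lemma cosh_sqr x : cosh x * cosh x = 1 + sinh x * sinh x.
Proof.
assert (E : exp x * exp (- x) = 1) by (rewrite <- exp_plus, Rplus_opp_r; apply exp_0).
unfold cosh, sinh; nra.
Qed.

Lemma cosh_ge_1 x : 1 <= cosh x.
Proof.
assert (E : exp x * exp (- x) = 1) by (rewrite <- exp_plus, Rplus_opp_r; apply exp_0).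
assert (H := exp_pos x); assert (H' := exp_pos (- x)); unfold cosh.
assert (4 <= (exp x + exp (- x)) * (exp x + exp (- x))) by (assert (H2 := pow2_ge_0 (exp x - exp (- x))); nra).
nra.
Qed.

Lemma sinh_ge x : 0 <= x -> x <= sinh x.
Proof.
intros Hx; apply (le_of_derive (fun t => t) sinh (fun _ => 1) cosh x); try lra.
- rewrite sinh_0; reflexivity.
- intros; apply (is_derive_id (K := R_AbsRing)).
- intros; apply is_derive_sinh.
- intros; apply cosh_ge_1.
Qed.

Lemma cosh_ge_2 x : 0 <= x -> 1 + x ^ 2 / 2 <= cosh x.
Proof.
intros Hx; apply (le_of_derive (fun t => 1 + t ^ 2 / 2) cosh (fun t => t) sinh x); try lra.
- rewrite cosh_0; lra.
- intros; auto_derive; [exact I|field].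
- intros; apply is_derive_cosh.
- intros t Ht; apply sinh_ge; lra.
Qed.

Lemma sinh_ge_3 x : 0 <= x -> x + x ^ 3 / 6 <= sinh x.
Proof.
intros Hx; apply (le_of_derive (fun t => t + t ^ 3 / 6) sinh (fun t => 1 + t ^ 2 / 2) cosh x); try lra.
- rewrite sinh_0; lra.
- intros; auto_derive; [exact I|field].
- intros; apply is_derive_sinh.
- intros t Ht; apply cosh_ge_2; lra.
Qed.

Lemma cosh_ge_4 x : 0 <= x -> 1 + x ^ 2 / 2 + x ^ 4 / 24 <= cosh x.
Proof.
intros Hx; apply (le_of_derive (fun t => 1 + t ^ 2 / 2 + t ^ 4 / 24) cosh (fun t => t + t ^ 3 / 6) sinh x); try lra.
- rewrite cosh_0; lra.
- intros; auto_derive; [exact I|field].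
- intros; apply is_derive_cosh.
- intros t Ht; apply sinh_ge_3; lra.
Qed.

Lemma sinh_sqr_ge x : 0 <= x -> x ^ 2 + x ^ 4 / 3 <= sinh x ^ 2.
Proof.
intros Hx; assert (H := cosh_ge_4 (2 * x)); assert (H1 : 0 <= 2 * x) by lra; specialize (H H1).
assert (E : cosh (2 * x) = 1 + 2 * sinh x ^ 2).
{ unfold cosh, sinh.
  replace (- (2 * x)) with (- x + - x) by ring; replace (2 * x) with (x + x) by ring.
  assert (E : exp x * exp (- x) = 1) by (rewrite <- exp_plus, Rplus_opp_r; apply exp_0).
  rewrite !exp_plus; nra. }
rewrite E in H; nra.
Qed.

(* Lazarevic's inequality, from [sinh x ^ 2 >= x ^ 2 + x ^ 4 / 3]. *)
Lemma sinh_cube_ge x : 0 <= x -> x ^ 3 * cosh x <= sinh x ^ 3.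
Proof.
intros Hx; assert (H := sinh_sqr_ge x Hx); assert (Hs := sinh_ge x Hx).
assert (Hc := cosh_ge_1 x); assert (E := cosh_sqr x).
assert (Hx3 : 0 <= x ^ 3) by (apply pow_le; lra).
assert (Hs3 : 0 <= sinh x ^ 3) by (apply pow_le; lra).
apply Rsqr_incr_0; [|apply Rmult_le_pos; lra|exact Hs3].
unfold Rsqr; set (s := sinh x) in *; set (c := cosh x) in *.
replace (x ^ 3 * c * (x ^ 3 * c)) with (x ^ 6 * (c * c)) by ring; rewrite E.
destruct Hx as [Hx|<-]; [|simpl; nra].
set (w := x ^ 2) in *; set (v := s ^ 2) in *.
replace (x ^ 6 * (1 + s * s)) with (w ^ 3 * (1 + v)) by (unfold w, v; ring).
replace (s ^ 3 * s ^ 3) with (v ^ 3) by (unfold v; ring).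
replace (x ^ 4) with (w ^ 2) in H by (unfold w; ring).
assert (Hw : 0 < w) by (unfold w; nra).
(* In terms of the excess [d] over the known lower bound, [v^3 - w^3 (1 + v)] has nonnegative terms
   apart from [- w^3 d], which is absorbed by [2 w^3 d]. *)
set (d := v - w - w ^ 2 / 3).
assert (Hd : 0 <= d) by (unfold d; lra).
replace v with (w + w ^ 2 / 3 + d) by (unfold d; ring).
replace ((w + w ^ 2 / 3 + d) ^ 3) with (w ^ 3 * (1 + (w + w ^ 2 / 3 + d)) +
  (w ^ 6 / 27 + 3 * (w ^ 2 + 2 * w ^ 3 / 3 + w ^ 4 / 9) * d - w ^ 3 * d + 3 * (w + w ^ 2 / 3) * d ^ 2 + d ^ 3)) by field.
assert (0 <= w ^ 2 * d) by (apply Rmult_le_pos; [apply pow_le|]; lra).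
assert (0 <= w ^ 3 * d) by (apply Rmult_le_pos; [apply pow_le|]; lra).
assert (0 <= w ^ 4 * d) by (apply Rmult_le_pos; [apply pow_le|]; lra).
assert (0 <= w * d ^ 2) by (apply Rmult_le_pos; [|apply pow_le]; lra).
assert (0 <= w ^ 2 * d ^ 2) by (apply Rmult_le_pos; apply pow_le; lra).
assert (0 <= d ^ 3) by (apply pow_le; lra).
assert (0 <= w ^ 6) by (apply pow_le; lra).
nra.
Qed.

Lemma exp_le_mono a b : a <= b -> exp a <= exp b.
Proof. intros [H| ->]; [left; apply exp_increasing; exact H|lra]. Qed.

(** Five integrations starting from the crude [cosh <= 2] on [[0, 1]]; hence [1/60], twice the
    Taylor coefficient [1/120]. *)
Lemma sinh_le x : 0 <= x <= 1 -> sinh x <= x + x ^ 3 / 6 + x ^ 5 / 60.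
Proof.
assert (c2 : forall t, 0 <= t <= 1 -> cosh t <= 2).
{ intros t Ht; unfold cosh.
  assert (exp t <= exp 1) by (apply exp_le_mono; lra).
  assert (exp (- t) <= exp 0) by (apply exp_le_mono; lra).
  rewrite exp_0 in *; assert (He := exp_le_3); lra. }
assert (s1 : forall t, 0 <= t <= 1 -> sinh t <= 2 * t).
{ apply (le_of_derive sinh (fun t => 2 * t) cosh (fun _ => 2) 1).
  - rewrite sinh_0; lra.
  - intros; apply is_derive_sinh.
  - intros; auto_derive; [exact I|ring].
  - exact c2. }
assert (c3 : forall t, 0 <= t <= 1 -> cosh t <= 1 + t ^ 2).
{ apply (le_of_derive cosh (fun t => 1 + t ^ 2) sinh (fun t => 2 * t) 1).
  - rewrite cosh_0; lra.
  - intros; apply is_derive_cosh.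
  - intros; auto_derive; [exact I|ring].
  - exact s1. }
assert (s2 : forall t, 0 <= t <= 1 -> sinh t <= t + t ^ 3 / 3).
{ apply (le_of_derive sinh (fun t => t + t ^ 3 / 3) cosh (fun t => 1 + t ^ 2) 1).
  - rewrite sinh_0; lra.
  - intros; apply is_derive_sinh.
  - intros; auto_derive; [exact I|field].
  - exact c3. }
assert (c4 : forall t, 0 <= t <= 1 -> cosh t <= 1 + t ^ 2 / 2 + t ^ 4 / 12).
{ apply (le_of_derive cosh (fun t => 1 + t ^ 2 / 2 + t ^ 4 / 12) sinh (fun t => t + t ^ 3 / 3) 1).
  - rewrite cosh_0; lra.
  - intros; apply is_derive_cosh.
  - intros; auto_derive; [exact I|field].
  - exact s2. }
revert x; apply (le_of_derive sinh (fun t => t + t ^ 3 / 6 + t ^ 5 / 60) cosh (fun t => 1 + t ^ 2 / 2 + t ^ 4 / 12) 1).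
- rewrite sinh_0; lra.
- intros; apply is_derive_sinh.
- intros; auto_derive; [exact I|field].
- exact c4.
Qed.

Lemma exp_pow_INR y n : exp y ^ n = exp (INR n * y).
Proof.
induction n as [|n IH]; [simpl; rewrite Rmult_0_l, exp_0; reflexivity|].
rewrite S_INR, Rmult_plus_distr_r, Rmult_1_l, exp_plus, <- IH; simpl; ring.
Qed.

Lemma exp_neg_bounds u : 0 < u -> 0 < exp (- u) < 1.
Proof.
intros Hu; split; [apply exp_pos|]; rewrite <- exp_0; apply exp_increasing; lra.
Qed.

Lemma sinh_exp u : sinh u = (1 - exp (- u) ^ 2) / (2 * exp (- u)).
Proof.
unfold sinh; assert (H := exp_pos (- u)).
replace (exp u) with (/ exp (- u)) by (rewrite <- exp_Ropp, Ropp_involutive; reflexivity).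
field; lra.
Qed.

Lemma cosh_exp u : cosh u = (1 + exp (- u) ^ 2) / (2 * exp (- u)).
Proof.
unfold cosh; assert (H := exp_pos (- u)).
replace (exp u) with (/ exp (- u)) by (rewrite <- exp_Ropp, Ropp_involutive; reflexivity).
field; lra.
Qed.

Lemma pow_odd_split x i : x ^ (2 * i + 1) = x * (x ^ 2) ^ i.
Proof. rewrite pow_add, pow_mult, pow_1; ring. Qed.

Lemma INR_odd i : INR (2 * i + 1) = 2 * INR i + 1.
Proof. rewrite plus_INR, mult_INR; simpl; ring. Qed.

Lemma odd_sum1_le n u : 0 < u ->
  rsum n (fun i => INR (2 * i + 1) * exp (- u) ^ (2 * i + 1)) <= / (2 * u ^ 2) + exp (- u).
Proof.
intros Hu; assert (Hx := exp_neg_bounds u Hu); assert (Hs := sinh_ge u (Rlt_le _ _ Hu)).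
set (x := exp (- u)) in *.
assert (Hy : 0 <= x ^ 2 < 1) by nra.
apply Rle_trans with (x * ((1 + x ^ 2) / (1 - x ^ 2) ^ 2)).
- rewrite (rsum_ext n _ (fun i => x * (pyr 1 i * (x ^ 2) ^ i + INR i * (x ^ 2) ^ i))).
  + rewrite rsum_scal, rsum_plus; apply Rmult_le_compat_l; [lra|].
    assert (H := pyr_sum_le 1 n (x ^ 2) Hy).
    assert (H2 : rsum n (fun i => INR i * (x ^ 2) ^ i) <= x ^ 2 * / (1 - x ^ 2) ^ 2).
    { apply (rsum_shift_le n (x ^ 2) _ _ (fun i => pyr 1 i * (x ^ 2) ^ i)).
      - lra.
      - simpl; ring.
      - intros i; rewrite S_INR, pyr1; simpl; ring.
      - intros; apply pyr_term_nonneg; lra.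
      - intros; apply (pyr_sum_le 1); exact Hy. }
    unfold Rdiv; rewrite Rmult_plus_distr_r; lra.
  + intros i _; rewrite INR_odd, pow_odd_split, pyr1; ring.
- (* [cosh u / (2 sinh u ^ 2) = (1 / sinh u ^ 2 + 1 / (cosh u + 1)) / 2] *)
  assert (Es := sinh_exp u); fold x in Es.
  replace (x * ((1 + x ^ 2) / (1 - x ^ 2) ^ 2)) with (/ (2 * sinh u ^ 2) + x * / (1 + x) ^ 2).
  2:{ rewrite Es; field; split; [lra|nra]. }
  apply Rplus_le_compat.
  + apply Rinv_le_contravar; [nra|]; apply Rmult_le_compat_l; [lra|]; apply pow_incr; lra.
  + rewrite <- (Rmult_1_r x) at 3; apply Rmult_le_compat_l; [lra|].
    rewrite <- Rinv_1; apply Rinv_le_contravar; nra.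
Qed.

(** Subtracting the first moment turns the complete sum into [3 cosh u / sinh u ^ 4], with no
    lower-order term left, and [sinh_cube_ge] applies. *)
Lemma odd_sum3_le n u : 0 < u ->
  rsum n (fun i => (INR (2 * i + 1) ^ 3 - INR (2 * i + 1)) * exp (- u) ^ (2 * i + 1)) <= 3 / u ^ 4.
Proof.
intros Hu; assert (Hx := exp_neg_bounds u Hu); assert (Hs := sinh_ge u (Rlt_le _ _ Hu)).
assert (Hl := sinh_cube_ge u (Rlt_le _ _ Hu)).
assert (Es := sinh_exp u); assert (Ec := cosh_exp u).
set (x := exp (- u)) in *.
assert (Hy : 0 <= x ^ 2 < 1) by nra.
assert (Hn : forall i, 0 <= pyr 3 i * (x ^ 2) ^ i).
{ intros; apply pyr_term_nonneg; lra. }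
apply Rle_trans with (3 * cosh u / sinh u ^ 4).
- replace (3 * cosh u / sinh u ^ 4) with (24 * x * (x ^ 2 * / (1 - x ^ 2) ^ 4 + x ^ 2 * (x ^ 2 * / (1 - x ^ 2) ^ 4))).
  2:{ rewrite Es, Ec; field; split; [lra|nra]. }
  rewrite (rsum_ext n _ (fun i => 24 * x * (INR i * (INR i + 1) * (INR i + 2) / 6 * (x ^ 2) ^ i
    + (INR i - 1) * INR i * (INR i + 1) / 6 * (x ^ 2) ^ i))).
  + assert (H1 : forall n, rsum n (fun i => INR i * (INR i + 1) * (INR i + 2) / 6 * (x ^ 2) ^ i) <= x ^ 2 * / (1 - x ^ 2) ^ 4).
    { intros m; apply (rsum_shift_le m (x ^ 2) _ _ (fun i => pyr 3 i * (x ^ 2) ^ i)); [lra| | |exact Hn|].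
      - simpl; lra.
      - intros i; rewrite S_INR, pyr3; simpl; field.
      - intros; apply (pyr_sum_le 3); exact Hy. }
    rewrite rsum_scal, rsum_plus; apply Rmult_le_compat_l; [lra|].
    apply Rplus_le_compat; [apply H1|].
    apply (rsum_shift_le n (x ^ 2) _ _ (fun i => INR i * (INR i + 1) * (INR i + 2) / 6 * (x ^ 2) ^ i)); [lra| | | |exact H1].
    * simpl; lra.
    * intros i; rewrite S_INR; simpl; field.
    * intros i; assert (H := pos_INR i); apply Rmult_le_pos; [|apply pow_le; lra].
      apply Rmult_le_pos; [|lra]; repeat apply Rmult_le_pos; lra.
  + intros i _; rewrite INR_odd, pow_odd_split; field.
- assert (Hs3 : 0 < sinh u ^ 3) by (apply pow_lt; lra).
  assert (Hu3 : 0 < u ^ 3) by (apply pow_lt; lra).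
  apply Rmult_le_reg_r with (u ^ 4 * sinh u ^ 4); [apply Rmult_lt_0_compat; apply pow_lt; lra|].
  replace (3 * cosh u / sinh u ^ 4 * (u ^ 4 * sinh u ^ 4)) with (3 * u * (u ^ 3 * cosh u)) by (field; lra).
  replace (3 / u ^ 4 * (u ^ 4 * sinh u ^ 4)) with (3 * sinh u * sinh u ^ 3) by (field; lra).
  assert (u * (u ^ 3 * cosh u) <= sinh u * sinh u ^ 3).
  { apply Rmult_le_compat; try lra. apply Rmult_le_pos; [lra|]. assert (H := cosh_ge_1 u); lra. }
  lra.
Qed.

(** The polynomial [k^4 - 10 k^2 + 9 = (k^2 - 1) (k^2 - 9)] is [16 (i - 1) i (i + 1) (i + 2)] at
    [k = 2 i + 1], and its complete sum is [12 / sinh u ^ 5]. Leaving out the [9] only lowers the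
    left side. *)
Lemma odd_sum4_le n u : 0 < u ->
  rsum n (fun i => (INR (2 * i + 1) ^ 4 - 10 * INR (2 * i + 1) ^ 2) * exp (- u) ^ (2 * i + 1)) <= 12 / u ^ 5.
Proof.
intros Hu; assert (Hx := exp_neg_bounds u Hu); assert (Hs := sinh_ge u (Rlt_le _ _ Hu)).
assert (Es := sinh_exp u).
set (x := exp (- u)) in *.
assert (Hy : 0 <= x ^ 2 < 1) by nra.
assert (Hn : forall i, 0 <= pyr 4 i * (x ^ 2) ^ i).
{ intros; apply pyr_term_nonneg; lra. }
apply Rle_trans with (12 / sinh u ^ 5).
- replace (12 / sinh u ^ 5) with (384 * x * (x ^ 2 * (x ^ 2 * / (1 - x ^ 2) ^ 5))).
  2:{ rewrite Es; field; split; [lra|nra]. }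
  apply Rle_trans with (rsum n (fun i => 384 * x * ((INR i - 1) * INR i * (INR i + 1) * (INR i + 2) / 24 * (x ^ 2) ^ i))).
  + apply rsum_le; intros i _; rewrite INR_odd, pow_odd_split.
    assert (0 <= x * (x ^ 2) ^ i) by (apply Rmult_le_pos; [lra|apply pow_le; lra]).
    set (w := x * (x ^ 2) ^ i) in *.
    replace (384 * x * ((INR i - 1) * INR i * (INR i + 1) * (INR i + 2) / 24 * (x ^ 2) ^ i))
      with (16 * ((INR i - 1) * INR i * (INR i + 1) * (INR i + 2)) * w) by (unfold w; field).
    apply Rmult_le_compat_r; [assumption|]; lra.
  + rewrite rsum_scal; apply Rmult_le_compat_l; [lra|].
    assert (H1 : forall n, rsum n (fun i => INR i * (INR i + 1) * (INR i + 2) * (INR i + 3) / 24 * (x ^ 2) ^ i) <= x ^ 2 * / (1 - x ^ 2) ^ 5).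
    { intros m; apply (rsum_shift_le m (x ^ 2) _ _ (fun i => pyr 4 i * (x ^ 2) ^ i)); [lra| | |exact Hn|].
      - simpl; lra.
      - intros i; rewrite S_INR, pyr4; simpl; field.
      - intros; apply (pyr_sum_le 4); exact Hy. }
    apply (rsum_shift_le n (x ^ 2) _ _ (fun i => INR i * (INR i + 1) * (INR i + 2) * (INR i + 3) / 24 * (x ^ 2) ^ i)); [lra| | | |exact H1].
    * simpl; lra.
    * intros i; rewrite S_INR; simpl; field.
    * intros i; assert (H := pos_INR i); apply Rmult_le_pos; [|apply pow_le; lra].
      apply Rmult_le_pos; [|lra]; repeat apply Rmult_le_pos; lra.
- unfold Rdiv; apply Rmult_le_compat_l; [lra|].
  apply Rinv_le_contravar; [apply pow_lt; lra|apply pow_incr; lra].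
Qed.

(** With [w = v / 2] the complete sum is [cosh w / (4 sinh w ^ 3)], which [sinh_cube_ge] bounds by
    its leading term. *)
Lemma sum_sqr_le n v : 0 < v -> rsum n (fun j => INR (S j) ^ 2 * exp (- v) ^ S j) <= 2 / v ^ 3.
Proof.
intros Hv; assert (Hv2 : 0 < v / 2) by lra.
assert (Hx := exp_neg_bounds (v / 2) Hv2); assert (Hs := sinh_ge _ (Rlt_le _ _ Hv2)).
assert (Hl := sinh_cube_ge _ (Rlt_le _ _ Hv2)).
assert (Es := sinh_exp (v / 2)); assert (Ec := cosh_exp (v / 2)).
replace (exp (- v)) with (exp (- (v / 2)) ^ 2).
2:{ simpl; rewrite Rmult_1_r, <- exp_plus; f_equal; field. }
set (w := v / 2) in *; set (x := exp (- w)) in *.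
assert (Hy : 0 <= x ^ 2 < 1) by nra.
apply Rle_trans with (cosh w / (4 * sinh w ^ 3)).
- replace (cosh w / (4 * sinh w ^ 3)) with (x ^ 2 * (/ (1 - x ^ 2) ^ 3 + x ^ 2 * / (1 - x ^ 2) ^ 3)).
  2:{ rewrite Es, Ec; field; split; [lra|nra]. }
  rewrite (rsum_ext n _ (fun i => x ^ 2 * (pyr 2 i * (x ^ 2) ^ i + INR i * (INR i + 1) / 2 * (x ^ 2) ^ i))).
  + rewrite rsum_scal, rsum_plus; apply Rmult_le_compat_l; [lra|].
    apply Rplus_le_compat; [apply (pyr_sum_le 2); exact Hy|].
    apply (rsum_shift_le n (x ^ 2) _ _ (fun i => pyr 2 i * (x ^ 2) ^ i)); [lra| | | |].
    * simpl; lra.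
    * intros i; rewrite S_INR, pyr2; simpl; field.
    * intros; apply pyr_term_nonneg; lra.
    * intros; apply (pyr_sum_le 2); exact Hy.
  + intros i _; rewrite pyr2, S_INR; change ((x ^ 2) ^ S i) with (x ^ 2 * (x ^ 2) ^ i); field.
- assert (Hs3 : 0 < sinh w ^ 3) by (apply pow_lt; lra).
  assert (Hw3 : 0 < w ^ 3) by (apply pow_lt; lra).
  replace (2 / v ^ 3) with (/ (4 * w ^ 3)) by (unfold w; field; lra).
  apply Rmult_le_reg_r with (4 * w ^ 3 * sinh w ^ 3); [apply Rmult_lt_0_compat; lra|].
  replace (cosh w / (4 * sinh w ^ 3) * (4 * w ^ 3 * sinh w ^ 3)) with (w ^ 3 * cosh w) by (field; lra).
  replace (/ (4 * w ^ 3) * (4 * w ^ 3 * sinh w ^ 3)) with (sinh w ^ 3) by (field; lra).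
  exact Hl.
Qed.

(** With [w = v / 2] the complete sum is [(2 sinh w ^ 2 + 3) / (8 sinh w ^ 4)]. The constant [12] is
    twice the leading one; the sum only enters the lower-order term of [box_fourth_le]. *)
Lemma sum_cube_le n v : 0 < v -> rsum n (fun j => INR (S j) ^ 3 * exp (- v) ^ S j) <= 12 / v ^ 4.
Proof.
intros Hv; assert (Hv2 : 0 < v / 2) by lra.
assert (Hx := exp_neg_bounds (v / 2) Hv2); assert (Hs := sinh_ge _ (Rlt_le _ _ Hv2)).
assert (Hl := sinh_sqr_ge _ (Rlt_le _ _ Hv2)).
assert (Es := sinh_exp (v / 2)).
replace (exp (- v)) with (exp (- (v / 2)) ^ 2).
2:{ simpl; rewrite Rmult_1_r, <- exp_plus; f_equal; field. }
set (w := v / 2) in *; set (x := exp (- w)) in *.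
assert (Hy : 0 <= x ^ 2 < 1) by nra.
assert (Hp : forall i, 0 <= pyr 3 i * (x ^ 2) ^ i).
{ intros; apply pyr_term_nonneg; lra. }
apply Rle_trans with ((2 * sinh w ^ 2 + 3) / (8 * sinh w ^ 4)).
- replace ((2 * sinh w ^ 2 + 3) / (8 * sinh w ^ 4))
    with (x ^ 2 * (/ (1 - x ^ 2) ^ 4 + 4 * (x ^ 2 * / (1 - x ^ 2) ^ 4) + x ^ 2 * (x ^ 2 * / (1 - x ^ 2) ^ 4))).
  2:{ rewrite Es; field; split; [lra|nra]. }
  rewrite (rsum_ext n _ (fun i => x ^ 2 * (pyr 3 i * (x ^ 2) ^ i + 4 * (INR i * (INR i + 1) * (INR i + 2) / 6 * (x ^ 2) ^ i)
     + (INR i - 1) * INR i * (INR i + 1) / 6 * (x ^ 2) ^ i))).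
  + assert (H1 : forall n, rsum n (fun i => INR i * (INR i + 1) * (INR i + 2) / 6 * (x ^ 2) ^ i) <= x ^ 2 * / (1 - x ^ 2) ^ 4).
    { intros m; apply (rsum_shift_le m (x ^ 2) _ _ (fun i => pyr 3 i * (x ^ 2) ^ i)); [lra| | |exact Hp|].
      - simpl; lra.
      - intros i; rewrite S_INR, pyr3; simpl; field.
      - intros; apply (pyr_sum_le 3); exact Hy. }
    rewrite rsum_scal, !rsum_plus, rsum_scal; apply Rmult_le_compat_l; [lra|].
    apply Rplus_le_compat; [apply Rplus_le_compat|].
    * apply (pyr_sum_le 3); exact Hy.
    * apply Rmult_le_compat_l; [lra|apply H1].
    * apply (rsum_shift_le n (x ^ 2) _ _ (fun i => INR i * (INR i + 1) * (INR i + 2) / 6 * (x ^ 2) ^ i)); [lra| | | |exact H1].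
      -- simpl; lra.
      -- intros i; rewrite S_INR; simpl; field.
      -- intros i; assert (H := pos_INR i); apply Rmult_le_pos; [|apply pow_le; lra].
         apply Rmult_le_pos; [|lra]; repeat apply Rmult_le_pos; lra.
  + intros i _; rewrite pyr3, S_INR; change ((x ^ 2) ^ S i) with (x ^ 2 * (x ^ 2) ^ i); field.
- replace (12 / v ^ 4) with (6 / (8 * w ^ 4)) by (unfold w; field; lra).
  assert (0 < sinh w ^ 4) by (apply pow_lt; lra).
  assert (0 < w ^ 4) by (apply pow_lt; lra).
  apply Rmult_le_reg_r with (8 * w ^ 4 * sinh w ^ 4); [apply Rmult_lt_0_compat; lra|].
  replace ((2 * sinh w ^ 2 + 3) / (8 * sinh w ^ 4) * (8 * w ^ 4 * sinh w ^ 4)) with ((2 * sinh w ^ 2 + 3) * w ^ 4) by (field; lra).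
  replace (6 / (8 * w ^ 4) * (8 * w ^ 4 * sinh w ^ 4)) with (6 * sinh w ^ 4) by (field; lra).
  set (s := sinh w ^ 2) in *.
  replace (sinh w ^ 4) with (s ^ 2) by (unfold s; ring).
  assert (w ^ 2 <= s) by lra.
  assert (w ^ 4 <= 3 * s) by nra.
  assert (w ^ 4 <= s ^ 2) by (replace (w ^ 4) with ((w ^ 2) ^ 2) by ring; apply pow_incr; split; [apply pow2_ge_0|lra]).
  nra.
Qed.

(** [33 / 20] replaces [pi^2 / 6]: ten terms are evaluated and the remainder telescopes. *)
Lemma rsum_inv_sqr_le n : rsum n (fun j => / INR (S j) ^ 2) <= 33 / 20.
Proof.
assert (H : forall p, rsum (10 + p) (fun j => / INR (S j) ^ 2) <= 33 / 20 - / INR (10 + p)).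
{ induction p as [|p IH].
  - replace (10 + 0)%nat with 10%nat by lia; unfold rsum; rewrite !S_INR; change (INR 0) with 0; lra.
  - replace (10 + S p)%nat with (S (10 + p)) by lia.
    change (rsum (S (10 + p)) (fun j => / INR (S j) ^ 2))
      with (rsum (10 + p) (fun j => / INR (S j) ^ 2) + / INR (S (10 + p)) ^ 2).
    assert (Hp : 0 < INR (10 + p)) by (apply lt_0_INR; lia).
    rewrite S_INR; set (a := INR (10 + p)) in *.
    assert (/ (a + 1) ^ 2 <= / a - / (a + 1)).
    { replace (/ a - / (a + 1)) with (/ (a * (a + 1))) by (field; lra).
      apply Rinv_le_contravar; [apply Rmult_lt_0_compat; lra|nra]. }
    lra. }
apply Rle_trans with (rsum (10 + n) (fun j => / INR (S j) ^ 2)).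
- apply rsum_le_range; [lia|]; intros i _; left; apply Rinv_0_lt_compat, pow_lt, lt_0_INR; lia.
- specialize (H n); assert (0 < / INR (10 + n)) by (apply Rinv_0_lt_compat, lt_0_INR; lia); lra.
Qed.

(** [5 / 4] replaces [pi^2 / 8]; telescoping by [(2 a + 1)^2 >= 4 a (a + 1)]. *)
Lemma rsum_inv_odd_sqr_le n : rsum n (fun i => / INR (2 * i + 1) ^ 2) <= 5 / 4.
Proof.
assert (H : forall p, rsum (S p) (fun i => / INR (2 * i + 1) ^ 2) <= 5 / 4 - / (4 * INR (S p))).
{ induction p as [|p IH].
  - simpl; lra.
  - change (rsum (S (S p)) (fun i => / INR (2 * i + 1) ^ 2))
      with (rsum (S p) (fun i => / INR (2 * i + 1) ^ 2) + / INR (2 * S p + 1) ^ 2).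
    rewrite INR_odd, (S_INR (S p)).
    assert (Hp : 0 < INR (S p)) by (apply lt_0_INR; lia).
    set (a := INR (S p)) in *.
    assert (/ (2 * a + 1) ^ 2 <= / (4 * a) - / (4 * (a + 1))).
    { replace (/ (4 * a) - / (4 * (a + 1))) with (/ (4 * a * (a + 1))) by (field; lra).
      apply Rinv_le_contravar; [repeat apply Rmult_lt_0_compat; lra|nra]. }
    lra. }
destruct n as [|n]; [simpl; lra|].
specialize (H n); assert (0 < / (4 * INR (S n))) by (apply Rinv_0_lt_compat, Rmult_lt_0_compat; [lra|apply lt_0_INR; lia]); lra.
Qed.

(** The subtracted [1 / 1000] is a reserve for the errors made in [box_second_ge]. *)
Lemma rsum_inv_sqr_ge : 162 / 100 <= rsum 60 (fun j => / INR (S j) ^ 2) - / 1000.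
Proof.
assert (H : forall p, 155 / 100 - / 4000 + / 11 - / INR (11 + p) <= rsum (10 + p) (fun j => / INR (S j) ^ 2)).
{ induction p as [|p IH].
  - replace (10 + 0)%nat with 10%nat by lia; replace (11 + 0)%nat with 11%nat by lia.
    unfold rsum; rewrite !S_INR; change (INR 0) with 0; lra.
  - replace (10 + S p)%nat with (S (10 + p)) by lia; replace (11 + S p)%nat with (S (11 + p)) by lia.
    change (rsum (S (10 + p)) (fun j => / INR (S j) ^ 2))
      with (rsum (10 + p) (fun j => / INR (S j) ^ 2) + / INR (11 + p) ^ 2).
    assert (Hp : 0 < INR (11 + p)) by (apply lt_0_INR; lia).
    rewrite (S_INR (11 + p)); set (a := INR (11 + p)) in *.
    assert (/ a - / (a + 1) <= / a ^ 2).
    { replace (/ a - / (a + 1)) with (/ (a * (a + 1))) by (field; lra).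
      apply Rinv_le_contravar; [apply pow_lt; lra|nra]. }
    lra. }
specialize (H 50%nat); replace (11 + 50)%nat with 61%nat in H by lia.
replace (10 + 50)%nat with 60%nat in H by lia.
replace (INR 61) with 61 in H by (rewrite INR_IZR_INZ; reflexivity); lra.
Qed.

End Moments.

(** * Moments over the whole box *)

Section BoxMoments.
Local Open Scope R_scope.

(** The complete sum is [1 / (2 sinh u) + 1 / sinh u ^ 3]. Multiplied by [u^3] it has no [u^2] term,
    as the two contributions cancel, so the loss is only of order [u^4]. The cube of
    [1 - exp (- u)^(2 K)] comes from three truncated geometric sums of length [K]. *)
Lemma odd_sum2_ge n K u : 0 < u <= / 2 -> (3 * K + 1 <= n)%nat ->
  (1 - exp (- u) ^ (2 * K)) ^ 3 * (1 - 3 / 20 * u ^ 4) / u ^ 3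
  <= rsum n (fun i => INR (2 * i + 1) ^ 2 * exp (- u) ^ (2 * i + 1)).
Proof.
intros [Hu Hu1] Hn; assert (Hx := exp_neg_bounds u Hu); assert (Hs := sinh_ge u (Rlt_le _ _ Hu)).
assert (Hs2 := sinh_le u ltac:(lra)).
assert (Es := sinh_exp u); rewrite pow_mult.
set (x := exp (- u)) in *; set (y := x ^ 2) in *.
assert (Hy : 0 <= y < 1) by (unfold y; nra).
assert (HyK : 0 <= y ^ K <= 1) by (split; [apply pow_le; lra|rewrite <- (pow1 K); apply pow_incr; lra]).
assert (Hpp : forall q i, 0 <= pyr q i * y ^ i).
{ intros; apply pyr_term_nonneg; lra. }
set (e := 1 - y ^ K) in *.
assert (He : 0 <= e <= 1) by (unfold e; lra).
assert (F0 : e / (1 - y) <= rsum K (fun i => pyr 0 i * y ^ i)).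
{ right; assert (E : (1 - y) * rsum K (fun i => pyr 0 i * y ^ i) = e).
  { unfold e; clear; induction K as [|n IHn]; [simpl; ring|]. cbn [rsum]; rewrite Rmult_plus_distr_l, IHn; simpl; ring. }
  rewrite <- E; field; lra. }
assert (F1 : e ^ 2 / (1 - y) ^ 2 <= rsum (K + K) (fun i => pyr 1 i * y ^ i)).
{ apply Rle_trans with (2 := pyr_sum_ge 0 K K y Hy); fold e.
  replace (e ^ 2 / (1 - y) ^ 2) with (e / (1 - y) * (e / (1 - y))) by (field; lra).
  unfold Rdiv at 3; rewrite Rmult_assoc; apply Rmult_le_compat_r; [|exact F0].
  apply Rmult_le_pos; [lra|left; apply Rinv_0_lt_compat; lra]. }
assert (F2 : e ^ 3 / (1 - y) ^ 3 <= rsum (K + K + K) (fun i => pyr 2 i * y ^ i)).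
{ apply Rle_trans with (2 := pyr_sum_ge 1 (K + K) K y Hy); fold e.
  replace (e ^ 3 / (1 - y) ^ 3) with (e ^ 2 / (1 - y) ^ 2 * (e / (1 - y))) by (field; lra).
  unfold Rdiv at 3; rewrite Rmult_assoc; apply Rmult_le_compat_r; [|exact F1].
  apply Rmult_le_pos; [lra|left; apply Rinv_0_lt_compat; lra]. }
apply Rle_trans with (e ^ 3 * (/ (2 * sinh u) + / sinh u ^ 3)).
- unfold Rdiv; rewrite Rmult_assoc; apply Rmult_le_compat_l; [apply pow_le; lra|].
  set (s := sinh u) in *.
  assert (Hr : / u * (1 - u ^ 2 / 6 - u ^ 4 / 60) <= / s).
  { apply Rle_trans with (/ (u + u ^ 3 / 6 + u ^ 5 / 60)).
    - replace (u + u ^ 3 / 6 + u ^ 5 / 60) with (u * (1 + (u ^ 2 / 6 + u ^ 4 / 60))) by field.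
      assert (0 <= u ^ 2 / 6 + u ^ 4 / 60) by (assert (0 < u ^ 2) by (apply pow_lt; lra); assert (0 < u ^ 4) by (apply pow_lt; lra); lra).
      set (a := u ^ 2 / 6 + u ^ 4 / 60) in *.
      replace (1 - u ^ 2 / 6 - u ^ 4 / 60) with (1 - a) by (unfold a; ring).
      rewrite Rinv_mult; apply Rmult_le_compat_l; [left; apply Rinv_0_lt_compat; lra|].
      apply (Rmult_le_reg_r (1 + a)); [lra|]; rewrite Rinv_l by lra; nra.
    - apply Rinv_le_contravar; lra. }
  assert (Hu2 : 0 < u ^ 2 <= / 4) by nra.
  assert (Hiu : 0 < / u) by (apply Rinv_0_lt_compat; lra).
  set (b := 1 - u ^ 2 / 6 - u ^ 4 / 60) in *.
  assert (Hb : 0 < b <= 1) by (unfold b; replace (u ^ 4) with (u ^ 2 * u ^ 2) by ring; nra).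
  assert (Hib : 0 <= / u * b) by nra.
  assert (H3 : (/ u * b) ^ 3 <= / s ^ 3) by (rewrite <- pow_inv; apply pow_incr; lra).
  apply Rle_trans with (/ u * b / 2 + (/ u * b) ^ 3).
  2:{ rewrite Rinv_mult; lra. }
  replace (/ u * b / 2 + (/ u * b) ^ 3) with ((u ^ 2 * b / 2 + b ^ 3) * / u ^ 3) by (field; lra).
  apply Rmult_le_compat_r; [left; apply Rinv_0_lt_compat, pow_lt; lra|].
  assert (1 - 3 * (1 - b) <= b ^ 3).
  { replace (b ^ 3 ) with (1 - 3 * (1 - b) + (1 - b) ^ 2 * (2 + b)) by ring.
    assert (0 <= (1 - b) ^ 2 * (2 + b)) by (apply Rmult_le_pos; [apply pow2_ge_0|lra]); lra. }
  assert (Eb : b = 1 - u ^ 2 / 6 - u ^ 4 / 60) by reflexivity.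
  clearbody b; replace (u ^ 4) with (u ^ 2 * u ^ 2) in * by ring.
  set (v := u ^ 2) in *; set (p := b ^ 3) in *; clearbody p v.
  apply Rle_trans with (v * b / 2 + (1 - 3 * (1 - b))); [|lra].
  rewrite Eb.
  assert (0 <= v * v * (1 - 4 * v)) by (apply Rmult_le_pos; nra).
  nra.
- replace (e ^ 3 * (/ (2 * sinh u) + / sinh u ^ 3))
    with (x * (e ^ 3 / (1 - y)) + 8 * x * (y * (e ^ 3 / (1 - y) ^ 3))).
  2:{ rewrite Es; unfold y; field; split; [lra|unfold y in Hy; lra]. }
  apply Rle_trans with (x * rsum (K + K + K + 1) (fun i => pyr 0 i * y ^ i) + 8 * x * (y * rsum (K + K + K) (fun i => pyr 2 i * y ^ i))).
  + apply Rplus_le_compat.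
    * apply Rmult_le_compat_l; [lra|].
      apply Rle_trans with (e / (1 - y)).
      -- apply Rmult_le_compat_r; [left; apply Rinv_0_lt_compat; lra|].
         assert (e ^ 2 <= 1) by nra; simpl; nra.
      -- apply Rle_trans with (1 := F0); apply rsum_le_range; [lia|auto].
    * apply Rmult_le_compat_l; [lra|]; apply Rmult_le_compat_l; [lra|exact F2].
  + replace (K + K + K + 1)%nat with (S (K + K + K)) by lia.
    apply Rle_trans with (rsum (S (K + K + K)) (fun i => INR (2 * i + 1) ^ 2 * x ^ (2 * i + 1))).
    * rewrite <- !rsum_scal, !rsum_recl.
      apply Req_le.
      transitivity (x * (pyr 0 0 * y ^ 0) + rsum (K + K + K) (fun i => x * (pyr 0 (S i) * y ^ S i) + 8 * x * (y * (pyr 2 i * y ^ i)))).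
      { rewrite rsum_plus, (rsum_scal _ (8 * x)); ring. }
      f_equal; [simpl; ring|].
      apply rsum_ext; intros i _; rewrite INR_odd, pow_odd_split, pyr2, S_INR; fold y; simpl; field.
    * apply rsum_le_range; [lia|]; intros; apply Rmult_le_pos; [apply pow2_ge_0|apply pow_le; lra].
Qed.

Variables (B : nat) (tau : R).
Hypothesis tau_pos : 0 < tau.
Let x := exp (- tau).

Lemma exp_pow_mul (j : nat) : x ^ j = exp (- (INR j * tau)).
Proof.
unfold x; rewrite exp_pow_INR; f_equal; ring.
Qed.

Lemma INR_S_tau_pos j : 0 < INR (S j) * tau.
Proof. apply Rmult_lt_0_compat; [apply lt_0_INR; lia|exact tau_pos]. Qed.

Lemma rsum_pow_le n : rsum n (fun j => x ^ S j) <= / tau.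
Proof.
assert (Hx := exp_neg_bounds tau tau_pos); fold x in Hx.
rewrite (rsum_ext n _ (fun j => x * (pyr 0 j * x ^ j))) by (intros; simpl; ring).
rewrite rsum_scal; assert (H := pyr_sum_le 0 n x ltac:(lra)).
apply Rle_trans with (x * / (1 - x) ^ 1); [apply Rmult_le_compat_l; lra|].
assert (H1 : 1 + tau < exp tau) by (apply exp_ineq1; lra).
assert (E : x * exp tau = 1) by (unfold x; rewrite <- exp_plus, Rplus_opp_l; apply exp_0).
rewrite pow_1; apply (Rmult_le_reg_r (tau * (1 - x))); [apply Rmult_lt_0_compat; lra|].
replace (x * / (1 - x) * (tau * (1 - x))) with (x * tau) by (field; lra).
replace (/ tau * (tau * (1 - x))) with (1 - x) by (field; lra).
nra.
Qed.

(** [33 / 40] is a majorant of [pi^2 / 12], from [odd_sum1_le] summed over [j]; the corrections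
    [exp (- j tau)] of the rows form a geometric series. *)
Lemma box_mean_le : box B (fun j k => INR k * x ^ (j * k)) <= 33 / 40 / tau ^ 2 + / tau.
Proof.
unfold box.
apply Rle_trans with (rsum B (fun j => / (2 * tau ^ 2) * / INR (S j) ^ 2 + x ^ S j)).
- apply rsum_le; intros j _.
  rewrite (rsum_ext B _ (fun i => INR (2 * i + 1) * exp (- (INR (S j) * tau)) ^ (2 * i + 1))).
  + assert (H := odd_sum1_le B _ (INR_S_tau_pos j)).
    replace (/ (2 * tau ^ 2) * / INR (S j) ^ 2) with (/ (2 * (INR (S j) * tau) ^ 2)).
    2:{ field; split; [apply not_0_INR; lia|lra]. }
    rewrite exp_pow_mul; exact H.
  + intros i _; rewrite pow_mult, exp_pow_mul; reflexivity.
- rewrite rsum_plus, rsum_scal.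
  apply Rplus_le_compat; [|apply rsum_pow_le].
  assert (H := rsum_inv_sqr_le B).
  replace (33 / 40 / tau ^ 2) with (/ (2 * tau ^ 2) * (33 / 20)) by (field; lra).
  apply Rmult_le_compat_l; [|exact H].
  left; apply Rinv_0_lt_compat, Rmult_lt_0_compat; [lra|apply pow_lt; lra].
Qed.

(** [k^3] is split as [(k^3 - k) + k]. The first part is summed over [k] before [j], the second over
    [j] before [k]; in both cases a convergent sum of inverse squares remains. *)
Lemma box_third_le :
  box B (fun j k => INR j ^ 2 * INR k ^ 3 * x ^ (j * k)) <= (99 / 20 + 5 / 2 * tau) / tau ^ 4.
Proof.
rewrite (box_ext B _ (fun j k => INR j ^ 2 * (INR k ^ 3 - INR k) * x ^ (j * k) + INR j ^ 2 * INR k * x ^ (j * k)))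
  by (intros; ring).
rewrite box_plus.
replace ((99 / 20 + 5 / 2 * tau) / tau ^ 4) with (3 / tau ^ 4 * (33 / 20) + 2 / tau ^ 3 * (5 / 4)) by (field; lra).
apply Rplus_le_compat; unfold box.
- apply Rle_trans with (rsum B (fun j => 3 / tau ^ 4 * / INR (S j) ^ 2)).
  + apply rsum_le; intros j _.
    rewrite (rsum_ext B _ (fun i => INR (S j) ^ 2 * ((INR (2 * i + 1) ^ 3 - INR (2 * i + 1)) * exp (- (INR (S j) * tau)) ^ (2 * i + 1)))).
    * rewrite rsum_scal; assert (H := odd_sum3_le B _ (INR_S_tau_pos j)).
      assert (HS : 0 < INR (S j)) by (apply lt_0_INR; lia).
      replace (3 / tau ^ 4 * / INR (S j) ^ 2) with (INR (S j) ^ 2 * (3 / (INR (S j) * tau) ^ 4)) by (field; lra).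
      apply Rmult_le_compat_l; [apply pow2_ge_0|exact H].
    * intros i _; rewrite pow_mult, exp_pow_mul; ring.
  + rewrite rsum_scal; apply Rmult_le_compat_l; [|apply rsum_inv_sqr_le].
    apply Rmult_le_pos; [lra|left; apply Rinv_0_lt_compat, pow_lt; lra].
- rewrite rsum_swap.
  apply Rle_trans with (rsum B (fun i => 2 / tau ^ 3 * / INR (2 * i + 1) ^ 2)).
  + apply rsum_le; intros i _.
    rewrite (rsum_ext B _ (fun j => INR (2 * i + 1) * (INR (S j) ^ 2 * exp (- (INR (2 * i + 1) * tau)) ^ S j))).
    * assert (HS : 0 < INR (2 * i + 1)) by (apply lt_0_INR; lia).
      rewrite rsum_scal; assert (H := sum_sqr_le B (INR (2 * i + 1) * tau) ltac:(nra)).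
      replace (2 / tau ^ 3 * / INR (2 * i + 1) ^ 2) with (INR (2 * i + 1) * (2 / (INR (2 * i + 1) * tau) ^ 3)) by (field; lra).
      apply Rmult_le_compat_l; [lra|exact H].
    * intros j _; rewrite (Nat.mul_comm (S j)), pow_mult, exp_pow_mul; ring.
  + rewrite rsum_scal; apply Rmult_le_compat_l; [|apply rsum_inv_odd_sqr_le].
    apply Rmult_le_pos; [lra|left; apply Rinv_0_lt_compat, pow_lt; lra].
Qed.

(** As for the third moment, with [k^4] split as [(k^4 - 10 k^2) + 10 k^2] to fit [odd_sum4_le]. *)
Lemma box_fourth_le :
  box B (fun j k => INR j ^ 3 * INR k ^ 4 * x ^ (j * k)) <= (99 / 5 + 150 * tau) / tau ^ 5.
Proof.
rewrite (box_ext B _ (fun j k => INR j ^ 3 * (INR k ^ 4 - 10 * INR k ^ 2) * x ^ (j * k) + 10 * (INR j ^ 3 * INR k ^ 2 * x ^ (j * k))))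
  by (intros; ring).
rewrite box_plus, box_scal.
replace ((99 / 5 + 150 * tau) / tau ^ 5) with (12 / tau ^ 5 * (33 / 20) + 10 * (12 / tau ^ 4 * (5 / 4))) by (field; lra).
apply Rplus_le_compat; [|apply Rmult_le_compat_l; [lra|]]; unfold box.
- apply Rle_trans with (rsum B (fun j => 12 / tau ^ 5 * / INR (S j) ^ 2)).
  + apply rsum_le; intros j _.
    rewrite (rsum_ext B _ (fun i => INR (S j) ^ 3 * ((INR (2 * i + 1) ^ 4 - 10 * INR (2 * i + 1) ^ 2) * exp (- (INR (S j) * tau)) ^ (2 * i + 1)))).
    * rewrite rsum_scal; assert (H := odd_sum4_le B _ (INR_S_tau_pos j)).
      assert (HS : 0 < INR (S j)) by (apply lt_0_INR; lia).
      replace (12 / tau ^ 5 * / INR (S j) ^ 2) with (INR (S j) ^ 3 * (12 / (INR (S j) * tau) ^ 5)) by (field; lra).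
      apply Rmult_le_compat_l; [apply pow_le; lra|exact H].
    * intros i _; rewrite pow_mult, exp_pow_mul; ring.
  + rewrite rsum_scal; apply Rmult_le_compat_l; [|apply rsum_inv_sqr_le].
    apply Rmult_le_pos; [lra|left; apply Rinv_0_lt_compat, pow_lt; lra].
- rewrite rsum_swap.
  apply Rle_trans with (rsum B (fun i => 12 / tau ^ 4 * / INR (2 * i + 1) ^ 2)).
  + apply rsum_le; intros i _.
    rewrite (rsum_ext B _ (fun j => INR (2 * i + 1) ^ 2 * (INR (S j) ^ 3 * exp (- (INR (2 * i + 1) * tau)) ^ S j))).
    * assert (HS : 0 < INR (2 * i + 1)) by (apply lt_0_INR; lia).
      rewrite rsum_scal; assert (H := sum_cube_le B (INR (2 * i + 1) * tau) ltac:(nra)).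
      replace (12 / tau ^ 4 * / INR (2 * i + 1) ^ 2) with (INR (2 * i + 1) ^ 2 * (12 / (INR (2 * i + 1) * tau) ^ 4)) by (field; lra).
      apply Rmult_le_compat_l; [apply pow2_ge_0|exact H].
    * intros j _; rewrite (Nat.mul_comm (S j)), pow_mult, exp_pow_mul; ring.
  + rewrite rsum_scal; apply Rmult_le_compat_l; [|apply rsum_inv_odd_sqr_le].
    apply Rmult_le_pos; [lra|left; apply Rinv_0_lt_compat, pow_lt; lra].
Qed.

(** Only sixty rows are kept: with [tau <= 1/120] they have [j tau <= 1/2], as [odd_sum2_ge]
    requires. The condition on [x^K] makes the cutoff factor at least [(1 - 10^(-6))^3], and [540]
    is [3/20 * 60^2]. *)
Lemma box_second_ge K : tau <= / 120 -> (3 * K + 1 <= B)%nat -> (60 <= B)%nat -> x ^ K <= / 1000 ->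
  162 / 100 / tau ^ 3 <= box B (fun j k => INR j * INR k ^ 2 * x ^ (j * k)).
Proof.
intros Ht HK HB HxK; assert (Hx := exp_neg_bounds tau tau_pos); fold x in Hx.
assert (HxK0 : 0 <= x ^ K) by (apply pow_le; lra).
unfold box.
apply Rle_trans with (rsum 60 (fun j => rsum B (fun i => INR (S j) * INR (2 * i + 1) ^ 2 * x ^ (S j * (2 * i + 1))))).
2:{ apply rsum_le_range; [exact HB|]; intros j _; apply rsum_nonneg; intros i _.
    apply Rmult_le_pos; [|apply pow_le; lra].
    apply Rmult_le_pos; [apply pos_INR|apply pow2_ge_0]. }
apply Rle_trans with (rsum 60 (fun j => (1 - 3 / 1000000) / tau ^ 3 * (/ INR (S j) ^ 2 + (- (540 * tau ^ 4))))).
- rewrite rsum_scal, rsum_plus.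
  rewrite (rsum_ext 60 (fun _ => - (540 * tau ^ 4)) (fun _ => - (540 * tau ^ 4) * 1)) by (intros; ring).
  rewrite rsum_scal; assert (H := rsum_inv_sqr_ge).
  assert (E : rsum 60 (fun _ => 1) = 60) by (simpl; lra).
  rewrite E.
  replace (162 / 100 / tau ^ 3) with (/ tau ^ 3 * (162 / 100)) by (field; lra).
  replace ((1 - 3 / 1000000) / tau ^ 3 * (rsum 60 (fun i => / INR (S i) ^ 2) + - (540 * tau ^ 4) * 60))
    with (/ tau ^ 3 * ((1 - 3 / 1000000) * (rsum 60 (fun i => / INR (S i) ^ 2) - 32400 * tau ^ 4))) by (field; lra).
  apply Rmult_le_compat_l; [left; apply Rinv_0_lt_compat, pow_lt; lra|].
  assert (tau ^ 4 <= (/ 120) ^ 4) by (apply pow_incr; lra).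
  lra.
- apply rsum_le; intros j Hj.
  assert (HS : 1 <= INR (S j) <= 60).
  { split; [change 1 with (INR 1)|change 60 with (IZR (Z.of_nat 60)); rewrite <- INR_IZR_INZ]; apply le_INR; lia. }
  set (a := INR (S j)) in *.
  rewrite (rsum_ext B _ (fun i => a * (INR (2 * i + 1) ^ 2 * exp (- (a * tau)) ^ (2 * i + 1)))).
  2:{ intros i _; rewrite pow_mult, exp_pow_mul; fold a; ring. }
  rewrite rsum_scal.
  assert (Hu : 0 < a * tau <= / 2) by nra.
  apply Rle_trans with (2 := Rmult_le_compat_l a _ _ ltac:(lra) (odd_sum2_ge B K (a * tau) Hu HK)).
  set (z := exp (- (a * tau)) ^ (2 * K)).
  assert (Hz : 0 <= z <= / 1000000).
  { unfold z; split; [apply pow_le; left; apply exp_pos|].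
    unfold a; rewrite <- exp_pow_mul, <- pow_mult.
    replace (S j * (2 * K))%nat with (K + K + j * (2 * K))%nat by ring.
    rewrite !pow_add.
    assert (0 <= x ^ (j * (2 * K)) <= 1) by (split; [apply pow_le; lra|rewrite <- (pow1 (j * (2 * K))); apply pow_incr; lra]).
    assert (x ^ K * x ^ K <= / 1000 * / 1000) by (apply Rmult_le_compat; lra).
    assert (0 <= x ^ K * x ^ K) by (apply Rmult_le_pos; lra).
    nra. }
  assert (H3 : 1 - 3 / 1000000 <= (1 - z) ^ 3) by (simpl; nra).
  replace (a * ((1 - z) ^ 3 * (1 - 3 / 20 * (a * tau) ^ 4) / (a * tau) ^ 3))
    with ((1 - z) ^ 3 * (/ tau ^ 3 * (/ a ^ 2 - 3 / 20 * a ^ 2 * tau ^ 4))) by (field; lra).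
  replace ((1 - 3 / 1000000) / tau ^ 3 * (/ a ^ 2 + - (540 * tau ^ 4)))
    with ((1 - 3 / 1000000) * (/ tau ^ 3 * (/ a ^ 2 + - (540 * tau ^ 4)))) by (unfold Rdiv; ring).
  assert (Ha2 : / a ^ 2 + - (540 * tau ^ 4) <= / a ^ 2 - 3 / 20 * a ^ 2 * tau ^ 4).
  { assert (0 < tau ^ 4) by (apply pow_lt; lra).
    assert (a ^ 2 <= 3600) by nra. nra. }
  assert (Hpos : 0 <= / a ^ 2 - 3 / 20 * a ^ 2 * tau ^ 4).
  { assert (H : (a * tau) ^ 4 <= (/ 2) ^ 4) by (apply pow_incr; lra).
    replace (/ a ^ 2 - 3 / 20 * a ^ 2 * tau ^ 4) with (/ a ^ 2 * (1 - 3 / 20 * (a * tau) ^ 4)) by (field; lra).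
    apply Rmult_le_pos; [left; apply Rinv_0_lt_compat, pow_lt; lra|lra]. }
  assert (Hit : 0 < / tau ^ 3) by (apply Rinv_0_lt_compat, pow_lt; lra).
  apply Rle_trans with ((1 - 3 / 1000000) * (/ tau ^ 3 * (/ a ^ 2 - 3 / 20 * a ^ 2 * tau ^ 4))).
  + apply Rmult_le_compat_l; [lra|]; apply Rmult_le_compat_l; lra.
  + apply Rmult_le_compat_r; [apply Rmult_le_pos; lra|exact H3].
Qed.

End BoxMoments.

(** * Decay away from the saddle point *)

Section Trig.
Local Open Scope R_scope.

Lemma sin_le_id x : 0 <= x -> sin x <= x.
Proof.
intros Hx; apply (le_of_derive sin (fun t => t) cos (fun _ => 1) x); try lra.
- rewrite sin_0; reflexivity.
- intros; apply is_derive_sin.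
- intros; apply (is_derive_id (K := R_AbsRing)).
- intros t _; apply COS_bound.
Qed.

Lemma cos_ge_2_pos x : 0 <= x -> 1 - x ^ 2 / 2 <= cos x.
Proof.
intros Hx; apply (le_of_derive (fun t => 1 - t ^ 2 / 2) cos (fun t => - t) (fun t => - sin t) x); try lra.
- rewrite cos_0; lra.
- intros; auto_derive; [exact I|field].
- intros; apply is_derive_cos.
- intros t Ht; assert (H := sin_le_id t); lra.
Qed.

Lemma cos_ge_2 x : 1 - x ^ 2 / 2 <= cos x.
Proof.
destruct (Rle_or_lt 0 x) as [H|H]; [apply cos_ge_2_pos; exact H|].
rewrite <- cos_neg; replace (x ^ 2) with ((- x) ^ 2) by ring; apply cos_ge_2_pos; lra.
Qed.

Lemma sin_ge_3 x : 0 <= x -> x - x ^ 3 / 6 <= sin x.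
Proof.
intros Hx; apply (le_of_derive (fun t => t - t ^ 3 / 6) sin (fun t => 1 - t ^ 2 / 2) cos x); try lra.
- rewrite sin_0; lra.
- intros; auto_derive; [exact I|field].
- intros; apply is_derive_sin.
- intros t Ht; apply cos_ge_2.
Qed.

(** Real part of a geometric progression of ratio [x^2 exp (2 i s)], cleared of its denominator, the
    squared modulus of [1 - x^2 exp (2 i s)]. *)
Lemma odd_cos_sum x s n :
  (1 - 2 * x ^ 2 * cos (2 * s) + x ^ 4) * rsum n (fun i => x ^ (2 * i + 1) * cos (INR (2 * i + 1) * s))
  = x * (1 - x ^ 2) * cos s
    - x ^ (2 * n + 1) * (cos (INR (2 * n + 1) * s) - x ^ 2 * cos (INR (2 * n + 1) * s - 2 * s)).
Proof.
induction n as [|n IH].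
- simpl rsum; simpl INR; rewrite Rmult_0_r, !Rmult_1_l.
  replace (s - 2 * s) with (- s) by ring; rewrite cos_neg; simpl; ring.
- cbn [rsum]; rewrite Rmult_plus_distr_l, IH.
  replace (INR (2 * S n + 1) * s) with (INR (2 * n + 1) * s + 2 * s) by (rewrite !INR_odd, S_INR; ring).
  set (a := INR (2 * n + 1) * s).
  replace (a + 2 * s - 2 * s) with a by ring.
  replace (2 * S n + 1)%nat with (2 + (2 * n + 1))%nat by lia.
  rewrite (pow_add x 2 (2 * n + 1)), cos_plus, cos_minus; ring.
Qed.

(** The first term is the value of the complete series over odd frequencies; the second absorbs what
    the cutoff after [n] terms removes. *)
Lemma odd_one_minus_cos_ge u s n : 0 < u ->
  / 2 * (/ sinh u - sinh u * cos s / (sinh u ^ 2 + sin s ^ 2)) - exp (- u) ^ (2 * n) / (u ^ 2 * exp (- u))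
  <= rsum n (fun i => exp (- u) ^ (2 * i + 1) * (1 - cos (INR (2 * i + 1) * s))).
Proof.
intros Hu; assert (Hx := exp_neg_bounds u Hu); assert (Hs := sinh_ge u (Rlt_le _ _ Hu)).
assert (Es := sinh_exp u).
set (x := exp (- u)) in *; set (h := sinh u) in *.
assert (HI := odd_cos_sum x s n).
set (C := rsum n (fun i => x ^ (2 * i + 1) * cos (INR (2 * i + 1) * s))) in *.
assert (HG : (1 - x ^ 2) * rsum n (fun i => x ^ (2 * i + 1)) = x - x ^ (2 * n + 1)).
{ clear; induction n as [|n IH]; [simpl; ring|].
  cbn [rsum]; rewrite Rmult_plus_distr_l, IH.
  replace (2 * S n + 1)%nat with (2 + (2 * n + 1))%nat by lia; rewrite (pow_add x 2); ring. }
rewrite (rsum_ext n _ (fun i => x ^ (2 * i + 1) + -1 * (x ^ (2 * i + 1) * cos (INR (2 * i + 1) * s)))) by (intros; ring).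
rewrite rsum_plus, rsum_scal; fold C.
set (G := rsum n (fun i => x ^ (2 * i + 1))) in *.
assert (Hh : 1 - x ^ 2 = 2 * x * h) by (rewrite Es; field; lra).
assert (HW : 1 - 2 * x ^ 2 * cos (2 * s) + x ^ 4 = 4 * x ^ 2 * (h ^ 2 + sin s ^ 2)).
{ rewrite cos_2a_sin.
  transitivity ((1 - x ^ 2) ^ 2 + 4 * x ^ 2 * sin s ^ 2); [ring|rewrite Hh; ring]. }
rewrite HW, Hh in HI; rewrite Hh in HG.
assert (Hh2 : 0 < h ^ 2) by (apply pow_lt; lra).
assert (Hsin := pow2_ge_0 (sin s)).
set (q := h ^ 2 + sin s ^ 2) in *.
assert (Hq : h ^ 2 <= q) by (unfold q; lra).
set (p := x ^ (2 * n)) in *.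
assert (Hp : 0 <= p) by (apply pow_le; lra).
assert (Ep : x ^ (2 * n + 1) = p * x) by (unfold p; rewrite pow_add, pow_1; reflexivity).
rewrite Ep in HI, HG.
set (c1 := cos (INR (2 * n + 1) * s)) in *; set (c2 := cos (INR (2 * n + 1) * s - 2 * s)) in *.
assert (Hc1 : -1 <= c1 <= 1) by apply COS_bound.
assert (Hc2 : -1 <= c2 <= 1) by apply COS_bound.
assert (EG : G = / 2 * / h - p * / (2 * h)).
{ apply (Rmult_eq_reg_l (2 * x * h)); [|apply Rgt_not_eq; apply Rmult_lt_0_compat; lra]; rewrite HG; field; lra. }
assert (EC : C = / 2 * (h * cos s / q) - p * (c1 - x ^ 2 * c2) / (4 * x * q)).
{ apply (Rmult_eq_reg_l (4 * x ^ 2 * q)).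
  - rewrite HI; field; lra.
  - apply Rgt_not_eq, Rmult_lt_0_compat; [apply Rmult_lt_0_compat; [lra|apply pow_lt; lra]|lra]. }
rewrite EG, EC.
assert (Hu2 : 0 < u ^ 2) by (apply pow_lt; lra).
assert (Hhu : u ^ 2 <= h ^ 2) by (apply pow_incr; lra).
assert (B1 : p * / (2 * h) <= p / (u ^ 2 * x) * / 2).
{ replace (p / (u ^ 2 * x) * / 2) with (p * (/ (u ^ 2 * x) * / 2)) by (unfold Rdiv; ring).
  apply Rmult_le_compat_l; [exact Hp|]; rewrite <- Rinv_mult.
  apply Rinv_le_contravar; [apply Rmult_lt_0_compat; [apply Rmult_lt_0_compat|]; lra|].
  assert (x * u ^ 2 <= x * h ^ 2) by (apply Rmult_le_compat_l; lra).
  assert (2 * x * h <= 1) by nra.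
  assert (h * (2 * x * h) <= h * 1) by (apply Rmult_le_compat_l; lra).
  nra. }
assert (B2 : - (p * (c1 - x ^ 2 * c2) / (4 * x * q)) <= p / (u ^ 2 * x) * / 2).
{ apply Rle_trans with (p * 2 / (4 * x * q)).
  - replace (- (p * (c1 - x ^ 2 * c2) / (4 * x * q))) with (p * (x ^ 2 * c2 - c1) / (4 * x * q)) by (field; lra).
    apply Rmult_le_compat_r; [left; apply Rinv_0_lt_compat, Rmult_lt_0_compat; lra|].
    apply Rmult_le_compat_l; [exact Hp|]. nra.
  - replace (p * 2 / (4 * x * q)) with (p * / (q * x) * / 2) by (field; lra).
    apply Rmult_le_compat_r; [lra|]; apply Rmult_le_compat_l; [exact Hp|].
    apply Rinv_le_contravar; [apply Rmult_lt_0_compat; lra|]; apply Rmult_le_compat_r; lra. }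
lra.
Qed.

Lemma osc_ge_sin u s : 0 < u ->
  / (2 * sinh u) * (sin s ^ 2 / (sinh u ^ 2 + sin s ^ 2))
  <= / 2 * (/ sinh u - sinh u * cos s / (sinh u ^ 2 + sin s ^ 2)).
Proof.
intros Hu; assert (Hs := sinh_ge u (Rlt_le _ _ Hu)); set (h := sinh u) in *.
assert (0 < h ^ 2) by (apply pow_lt; lra).
assert (Hsin := pow2_ge_0 (sin s)).
assert (Hc := COS_bound s).
set (q := h ^ 2 + sin s ^ 2).
assert (Hq : 0 < q) by (unfold q; lra).
apply (Rmult_le_reg_r (2 * h * q)); [apply Rmult_lt_0_compat; lra|].
replace (/ (2 * h) * (sin s ^ 2 / q) * (2 * h * q)) with (sin s ^ 2) by (field; lra).
replace (/ 2 * (/ h - h * cos s / q) * (2 * h * q)) with (q - h ^ 2 * cos s) by (field; lra).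
unfold q; nra.
Qed.

Lemma osc_ge_neg u s : 0 < u -> cos s <= 0 ->
  / (2 * sinh u) <= / 2 * (/ sinh u - sinh u * cos s / (sinh u ^ 2 + sin s ^ 2)).
Proof.
intros Hu Hc; assert (Hs := sinh_ge u (Rlt_le _ _ Hu)); set (h := sinh u) in *.
assert (0 < h ^ 2) by (apply pow_lt; lra).
assert (Hsin := pow2_ge_0 (sin s)).
set (q := h ^ 2 + sin s ^ 2).
assert (Hq : 0 < q) by (unfold q; lra).
apply (Rmult_le_reg_r (2 * h * q)); [apply Rmult_lt_0_compat; lra|].
replace (/ (2 * h) * (2 * h * q)) with q by (field; lra).
replace (/ 2 * (/ h - h * cos s / q) * (2 * h * q)) with (q - h ^ 2 * cos s) by (field; lra).
nra.
Qed.

Lemma ratio_ge w a b : 0 <= w -> 0 < a -> w * a <= b -> w / (1 + w) <= b / (a + b).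
Proof.
intros Hw Ha Hb; assert (0 <= b) by nra.
apply (Rmult_le_reg_r ((1 + w) * (a + b))); [apply Rmult_lt_0_compat; lra|].
replace (w / (1 + w) * ((1 + w) * (a + b))) with (w * (a + b)) by (field; lra).
replace (b / (a + b) * ((1 + w) * (a + b))) with (b * (1 + w)) by (field; lra).
nra.
Qed.

End Trig.

(** * Loss of modulus on the outer arcs *)

Section Tails.
Local Open Scope R_scope.

Variables (B : nat) (tau : R).
Hypothesis tau_bounds : 0 < tau <= / 120.
Let x := exp (- tau).
Hypothesis B_big : x ^ B <= tau ^ 2 / 1000.
Hypothesis B_pos : (2 <= B)%nat.

(** Sum of [exp (- k u) (1 - cos (k s))] over all odd [k]. Without the cutoff, row [j] of
    [cosum x 0 - cosum x t] is [osc (j tau) (j t) / j]. *)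
Let osc (u s : R) : R := / 2 * (/ sinh u - sinh u * cos s / (sinh u ^ 2 + sin s ^ 2)).

Lemma x_bounds : 0 < x < 1.
Proof. apply exp_neg_bounds; lra. Qed.

Lemma cosum_diff t : cosum B x 0 - cosum B x t
  = box B (fun j k => x ^ (j * k) / INR j * (1 - cos (INR (j * k) * t))).
Proof.
unfold cosum.
transitivity (box B (fun j k => x ^ (j * k) / INR j * cos (INR (j * k) * 0)) + -1 * box B (fun j k => x ^ (j * k) / INR j * cos (INR (j * k) * t))); [ring|].
rewrite <- box_scal, <- box_plus; apply box_ext; intros j k _ _.
rewrite Rmult_0_r, cos_0; ring.
Qed.

(** All terms of the difference are nonnegative, so rows one and two give a lower bound. Their
    truncation errors are at most [1/200] and half of that. *)
Lemma cosum_diff_ge t : osc tau t + / 2 * osc (2 * tau) (2 * t) - / 100 <= cosum B x 0 - cosum B x t.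
Proof.
assert (Hx := x_bounds).
rewrite cosum_diff; unfold box.
assert (Hterm : forall j i : nat, 0 <= x ^ (S j * (2 * i + 1)) / INR (S j) * (1 - cos (INR (S j * (2 * i + 1)) * t))).
{ intros j i; assert (Hc := COS_bound (INR (S j * (2 * i + 1)) * t)).
  apply Rmult_le_pos; [|lra]; apply Rmult_le_pos; [apply pow_le; lra|].
  left; apply Rinv_0_lt_compat, lt_0_INR; lia. }
apply Rle_trans with (rsum 2 (fun j => rsum B (fun i => x ^ (S j * (2 * i + 1)) / INR (S j) * (1 - cos (INR (S j * (2 * i + 1)) * t))))).
2:{ apply rsum_le_range; [exact B_pos|]; intros; apply rsum_nonneg; intros; apply Hterm. }
assert (He : forall u, tau <= u -> exp (- u) = x ^ 1 \/ exp (- u) = x ^ 2 -> exp (- u) ^ (2 * B) / (u ^ 2 * exp (- u)) <= / 200).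
{ intros u Hu Hxu.
  assert (Hup : 0 < u ^ 2) by (apply pow_lt; lra).
  assert (Htp : 0 < tau ^ 2) by (apply pow_lt; lra).
  assert (Htu : tau ^ 2 <= u ^ 2) by (apply pow_incr; lra).
  assert (H1 : exp (- u) ^ (2 * B) / (u ^ 2 * exp (- u)) <= x ^ B * / tau ^ 2).
  { replace (2 * B)%nat with (S (2 * B - 1)) by lia; rewrite <- tech_pow_Rmult.
    assert (Hep := exp_pos (- u)).
    replace (exp (- u) * exp (- u) ^ (2 * B - 1) / (u ^ 2 * exp (- u))) with (exp (- u) ^ (2 * B - 1) * / u ^ 2) by (field; lra).
    apply Rmult_le_compat; [apply pow_le; lra|left; apply Rinv_0_lt_compat; lra| |apply Rinv_le_contravar; lra].
    assert (Hmon : forall p r, (r <= p)%nat -> x ^ p <= x ^ r).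
    { intros p r Hr; replace p with (r + (p - r))%nat by lia; rewrite pow_add.
      assert (0 <= x ^ (p - r) <= 1) by (split; [apply pow_le; lra|rewrite <- (pow1 (p - r)); apply pow_incr; lra]).
      assert (0 <= x ^ r) by (apply pow_le; lra); nra. }
    destruct Hxu as [E|E]; rewrite E, <- pow_mult; apply Hmon; lia. }
  apply Rle_trans with (1 := H1).
  apply (Rmult_le_reg_r (tau ^ 2)); [exact Htp|].
  rewrite Rmult_assoc, Rinv_l by lra; lra. }
assert (E1 : exp (- tau) = x ^ 1) by (rewrite pow_1; reflexivity).
assert (E2 : exp (- (2 * tau)) = x ^ 2).
{ unfold x; simpl; rewrite Rmult_1_r, <- exp_plus; f_equal; ring. }
assert (H1 := odd_one_minus_cos_ge tau t B ltac:(lra)).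
assert (H2 := odd_one_minus_cos_ge (2 * tau) (2 * t) B ltac:(lra)).
assert (He1 := He tau ltac:(lra) (or_introl E1)).
assert (He2 := He (2 * tau) ltac:(lra) (or_intror E2)).
cbn [rsum].
rewrite (rsum_ext B (fun i => x ^ (1 * (2 * i + 1)) / INR 1 * (1 - cos (INR (1 * (2 * i + 1)) * t)))
  (fun i => exp (- tau) ^ (2 * i + 1) * (1 - cos (INR (2 * i + 1) * t)))).
2:{ intros i _; rewrite Nat.mul_1_l; change (INR 1) with 1; unfold x; field. }
rewrite (rsum_ext B (fun i => x ^ (2 * (2 * i + 1)) / INR 2 * (1 - cos (INR (2 * (2 * i + 1)) * t)))
  (fun i => / 2 * (exp (- (2 * tau)) ^ (2 * i + 1) * (1 - cos (INR (2 * i + 1) * (2 * t)))))).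
2:{ intros i _; rewrite E2, pow_mult, (mult_INR 2); change (INR 2) with (1 + 1).
    replace ((1 + 1) * INR (2 * i + 1) * t) with (INR (2 * i + 1) * (2 * t)) by ring; field. }
rewrite rsum_scal; unfold osc; lra.
Qed.

Lemma sinh_small_le u : 0 < u <= / 60 -> sinh u <= u * (10001 / 10000).
Proof.
intros Hu; assert (H := sinh_le u ltac:(lra)).
assert (u ^ 2 <= (/ 60) ^ 2) by (apply pow_incr; lra).
assert (u ^ 4 <= (/ 60) ^ 4) by (apply pow_incr; lra).
replace (u + u ^ 3 / 6 + u ^ 5 / 60) with (u * (1 + u ^ 2 / 6 + u ^ 4 / 60)) in H by field.
apply Rle_trans with (1 := H); apply Rmult_le_compat_l; lra.
Qed.

Lemma osc_nonneg u s : 0 < u -> 0 <= osc u s.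
Proof.
intros Hu; apply Rle_trans with (2 := osc_ge_sin u s Hu).
assert (Hs := sinh_ge u (Rlt_le _ _ Hu)).
assert (0 < sinh u ^ 2) by (apply pow_lt; lra).
assert (Hsin := pow2_ge_0 (sin s)).
apply Rmult_le_pos; [left; apply Rinv_0_lt_compat; lra|].
apply Rmult_le_pos; [exact Hsin|left; apply Rinv_0_lt_compat; lra].
Qed.

Lemma osc_ge u s w : 0 < u <= / 60 -> 0 <= w -> w * sinh u ^ 2 <= sin s ^ 2 ->
  9999 / 10000 / (2 * u) * (w / (1 + w)) <= osc u s.
Proof.
intros Hu Hw H; apply Rle_trans with (2 := osc_ge_sin u s ltac:(lra)).
assert (Hs := sinh_ge u ltac:(lra)); assert (Hs2 := sinh_small_le u Hu).
assert (0 < sinh u ^ 2) by (apply pow_lt; lra).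
apply Rmult_le_compat.
- apply Rmult_le_pos; [lra|left; apply Rinv_0_lt_compat; lra].
- apply Rmult_le_pos; [lra|left; apply Rinv_0_lt_compat; lra].
- apply (Rmult_le_reg_r (2 * u * sinh u)); [apply Rmult_lt_0_compat; lra|].
  replace (9999 / 10000 / (2 * u) * (2 * u * sinh u)) with (9999 / 10000 * sinh u) by (field; lra).
  replace (/ (2 * sinh u) * (2 * u * sinh u)) with u by (field; lra).
  lra.
- apply ratio_ge; assumption.
Qed.

Lemma sin_sqr_small_ge s : 0 <= s <= / 15 -> 998 / 1000 * s ^ 2 <= sin s ^ 2.
Proof.
intros Hs; assert (H := sin_ge_3 s ltac:(lra)).
assert (H2 : s ^ 2 <= (/ 15) ^ 2) by (apply pow_incr; lra).
assert (H3 : 999 / 1000 * s <= sin s).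
{ apply Rle_trans with (2 := H); replace (s - s ^ 3 / 6) with ((1 - s ^ 2 / 6) * s) by field.
  apply Rmult_le_compat_r; lra. }
apply Rle_trans with ((999 / 1000 * s) ^ 2); [|apply pow_incr; lra].
assert (0 <= s ^ 2) by apply pow2_ge_0; nra.
Qed.

Lemma osc_small_ge u s : 0 < u <= / 60 -> 0 <= s <= / 15 ->
  997 / 1000 / (2 * u) * (s ^ 2 / (u ^ 2 + s ^ 2)) <= osc u s.
Proof.
intros Hu Hs; assert (Hsin := sin_sqr_small_ge s Hs).
assert (Hsh := sinh_small_le u Hu); assert (Hsh0 := sinh_ge u ltac:(lra)).
assert (Hu2 : 0 < u ^ 2) by (apply pow_lt; lra).
assert (Hs2 : 0 <= s ^ 2) by apply pow2_ge_0.
set (w := 9975 / 10000 * (s ^ 2 / u ^ 2)).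
assert (Hw : 0 <= w).
{ apply Rmult_le_pos; [lra|]; apply Rmult_le_pos; [exact Hs2|left; apply Rinv_0_lt_compat; lra]. }
apply Rle_trans with (9999 / 10000 / (2 * u) * (w / (1 + w))).
- replace (997 / 1000 / (2 * u) * (s ^ 2 / (u ^ 2 + s ^ 2))) with (/ (2 * u) * (997 / 1000 * (s ^ 2 / (u ^ 2 + s ^ 2)))) by (field; nra).
  replace (9999 / 10000 / (2 * u) * (w / (1 + w))) with (/ (2 * u) * (9999 / 10000 * (w / (1 + w)))) by (field; lra).
  apply Rmult_le_compat_l; [left; apply Rinv_0_lt_compat; lra|].
  replace (w / (1 + w)) with (9975 / 10000 * s ^ 2 / (u ^ 2 + 9975 / 10000 * s ^ 2)) by (unfold w; field; nra).
  apply Rle_trans with (9999 / 10000 * (9975 / 10000 * s ^ 2 / (u ^ 2 + s ^ 2))).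
  + replace (9999 / 10000 * (9975 / 10000 * s ^ 2 / (u ^ 2 + s ^ 2))) with (9999 / 10000 * (9975 / 10000) * (s ^ 2 / (u ^ 2 + s ^ 2))) by (field; lra).
    apply Rmult_le_compat_r; [|lra].
    apply Rmult_le_pos; [exact Hs2|left; apply Rinv_0_lt_compat; lra].
  + apply Rmult_le_compat_l; [lra|]; apply Rmult_le_compat_l; [lra|].
    apply Rinv_le_contravar; lra.
- apply osc_ge; [exact Hu|exact Hw|].
  assert (Hh : sinh u ^ 2 <= u ^ 2 * (10003 / 10000)).
  { apply Rle_trans with ((u * (10001 / 10000)) ^ 2); [apply pow_incr; lra|nra]. }
  apply Rle_trans with (2 := Hsin).
  apply Rle_trans with (w * (u ^ 2 * (10003 / 10000))); [apply Rmult_le_compat_l; assumption|].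
  replace (w * (u ^ 2 * (10003 / 10000))) with (9975 / 10000 * (10003 / 10000) * s ^ 2) by (unfold w; field; lra).
  apply Rmult_le_compat_r; lra.
Qed.

(** For small arguments both rows contain the same ratio [t^2 / (tau^2 + t^2)], with total weight
    [1/2 + 1/8] over [tau]. Lowering [5/8] to [62/100] pays for [sin], [sinh] and the truncation. *)
Lemma cosum_diff_ge_mid t : tau / 2 <= t <= 4 * tau ->
  62 / 100 / tau * (t ^ 2 / (tau ^ 2 + t ^ 2)) <= cosum B x 0 - cosum B x t.
Proof.
intros Ht; apply Rle_trans with (2 := cosum_diff_ge t).
assert (H1 := osc_small_ge tau t ltac:(lra) ltac:(lra)).
assert (H2 := osc_small_ge (2 * tau) (2 * t) ltac:(lra) ltac:(lra)).
assert (Hr : / 5 <= t ^ 2 / (tau ^ 2 + t ^ 2)).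
{ replace (/ 5) with ((/ 4) / (1 + / 4)) by field; apply ratio_ge; [lra|apply pow_lt; lra|].
  replace (/ 4 * tau ^ 2) with ((tau / 2) ^ 2) by field; apply pow_incr; lra. }
replace ((2 * t) ^ 2 / ((2 * tau) ^ 2 + (2 * t) ^ 2)) with (t ^ 2 / (tau ^ 2 + t ^ 2)) in H2.
2:{ assert (0 < tau ^ 2) by (apply pow_lt; lra); assert (0 <= t ^ 2) by apply pow2_ge_0; field; nra. }
set (r := t ^ 2 / (tau ^ 2 + t ^ 2)) in *.
assert (Hi : 120 <= / tau) by (rewrite <- (Rinv_inv 120); apply Rinv_le_contravar; lra).
replace (997 / 1000 / (2 * tau) * r) with (997 / 2000 * (/ tau * r)) in H1 by (field; lra).
replace (997 / 1000 / (2 * (2 * tau)) * r) with (997 / 4000 * (/ tau * r)) in H2 by (field; lra).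
replace (62 / 100 / tau * r) with (62 / 100 * (/ tau * r)) by (field; lra).
assert (24 <= / tau * r) by nra.
lra.
Qed.

(** Beyond [PI / 4] the first row alone is nearly [1 / (2 tau)], by [cos t <= 0] or by
    [sin t ^ 2 >= 1/2]. Closer in, the second row has to help. *)
Lemma cosum_diff_ge_far t : 4 * tau <= t <= PI -> 499 / 1000 / tau <= cosum B x 0 - cosum B x t.
Proof.
intros Ht; apply Rle_trans with (2 := cosum_diff_ge t).
assert (Hi : 120 <= / tau) by (rewrite <- (Rinv_inv 120); apply Rinv_le_contravar; lra).
assert (HPI := PI_RGT_0).
assert (Hsh := sinh_small_le tau ltac:(lra)); assert (Hsh0 := sinh_ge tau ltac:(lra)).
assert (Hsh2 := sinh_small_le (2 * tau) ltac:(lra)); assert (Hsh20 := sinh_ge (2 * tau) ltac:(lra)).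
assert (Hn := osc_nonneg (2 * tau) (2 * t) ltac:(lra)).
replace (499 / 1000 / tau) with (499 / 1000 * / tau) by (field; lra).
destruct (Rle_or_lt (PI / 2) t) as [H|H].
- assert (Hc : cos t <= 0) by (apply cos_le_0; lra).
  assert (Ho := osc_ge_neg tau t ltac:(lra) Hc); fold (osc tau t) in Ho.
  assert (9999 / 10000 * / 2 * / tau <= / (2 * sinh tau)).
  { rewrite Rinv_mult; apply (Rmult_le_reg_r (tau * sinh tau)); [apply Rmult_lt_0_compat; lra|].
    replace (9999 / 10000 * / 2 * / tau * (tau * sinh tau)) with (9999 / 20000 * sinh tau) by (field; lra).
    replace (/ 2 * / sinh tau * (tau * sinh tau)) with (tau / 2) by (field; lra). lra. }
  lra.
- destruct (Rle_or_lt (PI / 4) t) as [H4|H4].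
  + assert (Hsin : / 2 <= sin t ^ 2).
    { assert (sin (PI / 4) <= sin t) by (apply sin_incr_1; lra).
      rewrite sin_PI4 in H0.
      assert (H2 : (1 / sqrt 2) ^ 2 = / 2).
      { replace ((1 / sqrt 2) ^ 2) with (/ (sqrt 2 * sqrt 2)).
        - rewrite sqrt_sqrt by lra; reflexivity.
        - assert (0 < sqrt 2) by (apply sqrt_lt_R0; lra); field; lra. }
      rewrite <- H2; apply pow_incr; split; [|exact H0].
      apply Rmult_le_pos; [lra|left; apply Rinv_0_lt_compat, sqrt_lt_R0; lra]. }
    (* Since [sinh tau <= 1/119], the weight [5000] satisfies [5000 * sinh tau ^ 2 <= 1/2], and it
       makes [w / (1 + w)] almost [1]. *)
    assert (Ho := osc_ge tau t 5000 ltac:(lra) ltac:(lra)).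
    assert (Hs2 : sinh tau ^ 2 <= (/ 119) ^ 2) by (apply pow_incr; lra).
    specialize (Ho ltac:(lra)).
    replace (9999 / 10000 / (2 * tau) * (5000 / (1 + 5000))) with (9999 / 10000 * (5000 / 10002) * / tau) in Ho by (field; lra).
    lra.
  (* [15] is [4^2] less the losses of [sin] and [sinh]. The first row then gives only about [15/32]
     over [tau], short of [499/1000]; the second adds about [15/128]. *)
  + assert (Hsmall : forall a s, 0 < a <= / 60 -> 4 * a <= s <= PI / 2 -> 4 * a <= / 15 -> 15 * sinh a ^ 2 <= sin s ^ 2).
    { intros a s Ha Hs H15.
      assert (Hq := sin_sqr_small_ge (4 * a) ltac:(lra)).
      assert (Hss : sin (4 * a) <= sin s) by (apply sin_incr_1; lra).
      assert (H0 : 0 <= sin (4 * a)) by (apply sin_ge_0; lra).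
      assert (sin (4 * a) ^ 2 <= sin s ^ 2) by (apply pow_incr; lra).
      assert (Hsa := sinh_small_le a Ha); assert (Hsa0 := sinh_ge a ltac:(lra)).
      assert (sinh a ^ 2 <= (a * (10001 / 10000)) ^ 2) by (apply pow_incr; lra).
      assert (0 < a ^ 2) by (apply pow_lt; lra).
      nra. }
    assert (Ho1 := osc_ge tau t 15 ltac:(lra) ltac:(lra) (Hsmall tau t ltac:(lra) ltac:(lra) ltac:(lra))).
    assert (Ho2 := osc_ge (2 * tau) (2 * t) 15 ltac:(lra) ltac:(lra) (Hsmall (2 * tau) (2 * t) ltac:(lra) ltac:(lra) ltac:(lra))).
    replace (9999 / 10000 / (2 * tau) * (15 / (1 + 15))) with (9999 / 10000 * (15 / 32) * / tau) in Ho1 by (field; lra).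
    replace (9999 / 10000 / (2 * (2 * tau)) * (15 / (1 + 15))) with (9999 / 10000 * (15 / 64) * / tau) in Ho2 by (field; lra).
    lra.
Qed.

End Tails.

(** * The saddle-point estimate *)

Section Exponentials.
Local Open Scope R_scope.

Lemma exp_ge_2 y : 0 <= y -> 1 + y + y ^ 2 / 2 <= exp y.
Proof.
intros Hy; apply (le_of_derive (fun t => 1 + t + t ^ 2 / 2) exp (fun t => 1 + t) exp y); try lra.
- rewrite exp_0; lra.
- intros; auto_derive; [exact I|field].
- intros; apply is_derive_exp.
- intros t _; apply exp_ineq1_le.
Qed.

Lemma exp_1_ge : 271 / 100 <= exp 1.
Proof.
assert (H := exp_ge_2 (/ 16) ltac:(lra)).
replace (exp 1) with (exp (/ 16) ^ 16).
- apply Rle_trans with ((1 + / 16 + (/ 16) ^ 2 / 2) ^ 16); [lra|apply pow_incr; lra].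
- rewrite exp_pow_INR; f_equal; simpl; lra.
Qed.

Lemma exp_INR_ge n y : 0 <= y -> (271 / 100) ^ n * (1 + y + y ^ 2 / 2) <= exp (INR n + y).
Proof.
intros Hy; rewrite exp_plus.
assert (H := exp_ge_2 y Hy).
assert (E : exp (INR n) = exp 1 ^ n).
{ rewrite exp_pow_INR, Rmult_1_r; reflexivity. }
rewrite E; assert (H1 := exp_1_ge).
apply Rmult_le_compat; [apply pow_le; lra|assert (0 <= y ^ 2) by apply pow2_ge_0; lra|apply pow_incr; lra|exact H].
Qed.

(** With [z = z0 (1 + d)] the claim is [(1 + d)^p <= exp (p d) <= exp (c z0 d)]. *)
Lemma pow_exp_decr p c z0 z : 0 < z0 -> INR p <= c * z0 -> z0 <= z ->
  z ^ p * exp (- (c * z)) <= z0 ^ p * exp (- (c * z0)).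
Proof.
intros Hz0 Hp Hz.
set (d := z / z0 - 1).
assert (Hd : 0 <= d).
{ unfold d; assert (1 <= z / z0); [|lra].
  apply (Rmult_le_reg_r z0); [exact Hz0|].
  unfold Rdiv; rewrite Rmult_assoc, Rinv_l by lra; lra. }
assert (Ez : z = z0 * (1 + d)) by (unfold d; field; lra).
assert (H1 : (1 + d) ^ p <= exp (INR p * d)).
{ assert (E : exp (INR p * d) = exp d ^ p).
  { symmetry; apply exp_pow_INR. }
  rewrite E; apply pow_incr; split; [lra|].
  apply exp_ineq1_le. }
assert (H2 : exp (INR p * d) <= exp (c * z0 * d)).
{ apply exp_le_mono, Rmult_le_compat_r; assumption. }
rewrite Ez, Rpow_mult_distr.
replace (- (c * (z0 * (1 + d)))) with (- (c * z0) + - (c * z0 * d)) by ring.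
rewrite exp_plus.
assert (E0 : exp (c * z0 * d) * exp (- (c * z0 * d)) = 1) by (rewrite <- exp_plus, Rplus_opp_r; apply exp_0).
assert (P1 := exp_pos (- (c * z0))); assert (P2 := exp_pos (- (c * z0 * d))).
assert (P3 : 0 < z0 ^ p) by (apply pow_lt; lra).
replace (z0 ^ p * (1 + d) ^ p * (exp (- (c * z0)) * exp (- (c * z0 * d))))
  with (z0 ^ p * exp (- (c * z0)) * ((1 + d) ^ p * exp (- (c * z0 * d)))) by ring.
rewrite <- (Rmult_1_r (z0 ^ p * exp (- (c * z0)))) at 2.
apply Rmult_le_compat_l; [apply Rmult_le_pos; lra|].
apply Rle_trans with (exp (c * z0 * d) * exp (- (c * z0 * d))); [apply Rmult_le_compat_r; lra|lra].
Qed.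

End Exponentials.

(** * Central arc, outer arc and the positivity of the main combination *)

Section Saddle.
Local Open Scope R_scope.

Lemma RInt_Chasles_R (f : R -> R) a b c : ex_RInt f a b -> ex_RInt f b c -> RInt f a b + RInt f b c = RInt f a c.
Proof. apply (RInt_Chasles (V := R_CompleteNormedModule)). Qed.

Lemma RInt_opp_R (f : R -> R) a b : ex_RInt f a b -> RInt (fun t => - f t) a b = - RInt f a b.
Proof. apply (RInt_opp (V := R_CompleteNormedModule)). Qed.

Variables (B : nat) (tau : R) (m : nat) (K : nat).
Let x := exp (- tau).
Hypothesis tau_bounds : 0 < tau <= / 120.
Hypothesis B_big : x ^ B <= tau ^ 2 / 1000.
Hypothesis B_ge : (60 <= B)%nat.
Hypothesis K_le : (3 * K + 1 <= B)%nat.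
Hypothesis K_big : x ^ K <= / 1000.
Hypothesis mean_eq : box B (fun j k => INR k * x ^ (j * k)) = INR m.

(** [sig], [6 lam] and [kap] are the second, third and fourth cumulants of the tilted measure, whose
    mean [mean_eq] fixes at [m]. [rho] is the modulus of [F] relative to its value at [t = 0], [arg]
    the phase of the integrand, [T] the end of the central arc. *)
Let sig := box B (fun j k => INR j * INR k ^ 2 * x ^ (j * k)).
Let lam := box B (fun j k => INR j ^ 2 * INR k ^ 3 * x ^ (j * k)) / 6.
Let kap := box B (fun j k => INR j ^ 3 * INR k ^ 4 * x ^ (j * k)).
Let rho (t : R) := exp (cosum B x t - cosum B x 0).
Let arg (t : R) := sinsum B x t - INR m * t.
Let T := tau / 2.
Let M (k : nat) := RInt (fun t => rho t * t ^ k) 0 T.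

Let Hx : 0 < x < 1.
Proof. apply exp_neg_bounds; lra. Qed.

Lemma sig_ge : 162 / 100 / tau ^ 3 <= sig.
Proof. apply (box_second_ge B tau ltac:(lra) K); try assumption; lra. Qed.

Lemma lam_nonneg : 0 <= lam.
Proof.
unfold lam; apply Rmult_le_pos; [|lra]; apply box_nonneg; intros j k _ _.
apply Rmult_le_pos; [|apply pow_le; lra]; apply Rmult_le_pos; apply pow_le, pos_INR.
Qed.

Lemma lam_le : lam <= 829 / 1000 / tau ^ 4.
Proof.
assert (H := box_third_le B tau ltac:(lra)); fold x in H; unfold lam.
assert (Ht : 0 < / tau ^ 4) by (apply Rinv_0_lt_compat, pow_lt; lra).
apply (Rmult_le_reg_r 6); [lra|].
replace (box B (fun j k => INR j ^ 2 * INR k ^ 3 * x ^ (j * k)) / 6 * 6)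
  with (box B (fun j k => INR j ^ 2 * INR k ^ 3 * x ^ (j * k))) by field.
apply Rle_trans with (1 := H); unfold Rdiv; nra.
Qed.

(** [2105/100] is [99/5 + 150/120], the bound of [box_fourth_le] at the largest [tau]. *)
Lemma kap_le : kap <= 2105 / 100 / tau ^ 5.
Proof.
assert (H := box_fourth_le B tau ltac:(lra)); fold x in H.
assert (Ht : 0 < / tau ^ 5) by (apply Rinv_0_lt_compat, pow_lt; lra).
apply Rle_trans with (1 := H); unfold Rdiv; nra.
Qed.

(* [jk^2 <= k (g / tau + tau (jk)^2 / g) / 2] with [g = 61 / 25]. *)
Lemma sig_le : sig <= 204 / 100 / tau ^ 3.
Proof.
assert (H3 := box_third_le B tau ltac:(lra)); fold x in H3.
assert (H1 := box_mean_le B tau ltac:(lra)); fold x in H1.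
apply Rle_trans with (61 / 50 / tau * box B (fun j k => INR k * x ^ (j * k))
  + 25 / 122 * tau * box B (fun j k => INR j ^ 2 * INR k ^ 3 * x ^ (j * k))).
- rewrite <- !box_scal, <- box_plus; apply box_le; intros j k _ _.
  assert (Hp : 0 <= INR k * x ^ (j * k)) by (apply Rmult_le_pos; [apply pos_INR|apply pow_le; lra]).
  replace (INR j * INR k ^ 2 * x ^ (j * k)) with (INR k * x ^ (j * k) * (INR j * INR k)) by ring.
  replace (61 / 50 / tau * (INR k * x ^ (j * k)) + 25 / 122 * tau * (INR j ^ 2 * INR k ^ 3 * x ^ (j * k)))
    with (INR k * x ^ (j * k) * (61 / 50 / tau + 25 / 122 * tau * (INR j * INR k) ^ 2)) by (unfold Rdiv; ring).
  apply Rmult_le_compat_l; [exact Hp|].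
  set (v := INR j * INR k).
  replace (61 / 50 / tau + 25 / 122 * tau * v ^ 2) with (v + 61 / 50 / tau * (1 - 25 / 61 * (v * tau)) ^ 2) by (field; lra).
  assert (0 <= 61 / 50 / tau * (1 - 25 / 61 * (v * tau)) ^ 2); [|lra].
  apply Rmult_le_pos; [|apply pow2_ge_0].
  apply Rmult_le_pos; [lra|left; apply Rinv_0_lt_compat; lra].
- apply Rle_trans with (61 / 50 / tau * (33 / 40 / tau ^ 2 + / tau) + 25 / 122 * tau * ((99 / 20 + 5 / 2 * tau) / tau ^ 4)).
  + apply Rplus_le_compat; apply Rmult_le_compat_l; try assumption; [|lra].
    apply Rmult_le_pos; [lra|left; apply Rinv_0_lt_compat; lra].
  + replace (61 / 50 / tau * (33 / 40 / tau ^ 2 + / tau) + 25 / 122 * tau * ((99 / 20 + 5 / 2 * tau) / tau ^ 4))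
      with ((61 / 50 * (33 / 40 + tau) + 25 / 122 * (99 / 20 + 5 / 2 * tau)) / tau ^ 3) by (field; lra).
    apply Rmult_le_compat_r; [left; apply Rinv_0_lt_compat, pow_lt; lra|lra].
Qed.

Lemma ex_derive_rho t : ex_derive rho t.
Proof.
unfold rho; assert (ex_derive (cosum B x) t) by (eexists; apply is_derive_cosum_t).
auto_derive; auto.
Qed.

Lemma is_derive_rho t : is_derive rho t (- dsinsum B x t * rho t).
Proof.
unfold rho; assert (H := is_derive_cosum_t B x t).
auto_derive; [eexists; exact H|].
replace (Derive (fun x0 => cosum B x x0) t) with (- dsinsum B x t) by (symmetry; apply is_derive_unique; exact H).
unfold Rminus; ring.
Qed.

Lemma ex_derive_arg t : ex_derive arg t.
Proof.
unfold arg; assert (ex_derive (sinsum B x) t) by (eexists; apply is_derive_sinsum_t).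
auto_derive; auto.
Qed.

Lemma rho_pos t : 0 < rho t.
Proof. apply exp_pos. Qed.

Lemma dsinsum_le t : 0 <= t -> dsinsum B x t <= sig * t.
Proof.
intros Ht; rewrite Rmult_comm; unfold sig, dsinsum; rewrite <- box_scal; apply box_le; intros j k _ _.
assert (Hp : 0 <= INR k * x ^ (j * k)) by (apply Rmult_le_pos; [apply pos_INR|apply pow_le; lra]).
assert (H := sin_le_id (INR (j * k) * t) ltac:(apply Rmult_le_pos; [apply pos_INR|lra])).
apply Rle_trans with (INR k * x ^ (j * k) * (INR (j * k) * t)); [apply Rmult_le_compat_l; assumption|].
rewrite mult_INR; right; ring.
Qed.

Lemma dsinsum_ge t : 0 <= t -> sig * t - kap * t ^ 3 / 6 <= dsinsum B x t.
Proof.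
intros Ht.
replace (sig * t - kap * t ^ 3 / 6) with (t * sig + (- (t ^ 3 / 6)) * kap) by field.
unfold sig, kap, dsinsum; rewrite <- !box_scal, <- box_plus; apply box_le; intros j k _ _.
assert (Hp : 0 <= INR k * x ^ (j * k)) by (apply Rmult_le_pos; [apply pos_INR|apply pow_le; lra]).
assert (H := sin_ge_3 (INR (j * k) * t) ltac:(apply Rmult_le_pos; [apply pos_INR|lra])).
apply Rle_trans with (INR k * x ^ (j * k) * (INR (j * k) * t - (INR (j * k) * t) ^ 3 / 6)); [|apply Rmult_le_compat_l; assumption].
rewrite mult_INR; right; field.
Qed.

(** The saddle equation cancels the part of the phase linear in [t]; [y - y^3 / 6 <= sin y <= y] in
    each term bounds what is left. *)
Lemma arg_le t : 0 <= t -> Rabs (arg t) <= lam * t ^ 3.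
Proof.
intros Ht.
assert (E : arg t = box B (fun j k => x ^ (j * k) / INR j * (sin (INR (j * k) * t) - INR (j * k) * t))).
{ unfold arg; rewrite <- mean_eq; unfold sinsum.
  transitivity (box B (fun j k => x ^ (j * k) / INR j * sin (INR (j * k) * t)) + - t * box B (fun j k => INR k * x ^ (j * k))); [ring|].
  rewrite <- box_scal, <- box_plus; apply box_ext; intros j k Hj Hk.
  rewrite mult_INR; field; apply not_0_INR; lia. }
assert (Hc : forall j k, 0 <= x ^ (j * k) / INR j).
{ intros j k; destruct j as [|j].
  - simpl; unfold Rdiv; rewrite Rinv_0; lra.
  - apply Rmult_le_pos; [apply pow_le; lra|left; apply Rinv_0_lt_compat, lt_0_INR; lia]. }
assert (Hjk : forall j k, 0 <= INR (j * k) * t) by (intros; apply Rmult_le_pos; [apply pos_INR|lra]).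
apply Rabs_le; split; rewrite E.
- replace (- (lam * t ^ 3)) with (- (t ^ 3 / 6) * box B (fun j k => INR j ^ 2 * INR k ^ 3 * x ^ (j * k))) by (unfold lam; field).
  rewrite <- box_scal; apply box_le; intros j k Hj Hk.
  apply Rle_trans with (x ^ (j * k) / INR j * (- ((INR (j * k) * t) ^ 3 / 6))).
  + right; rewrite mult_INR; field; apply not_0_INR; lia.
  + apply Rmult_le_compat_l; [apply Hc|].
    assert (H := sin_ge_3 _ (Hjk j k)); lra.
- apply Rle_trans with 0.
  + rewrite <- (Rmult_0_l (box B (fun _ _ => 0))), <- box_scal; apply box_le; intros j k Hj Hk.
    assert (H := sin_le_id _ (Hjk j k)); assert (H2 := Hc j k).
    rewrite Rmult_0_l.
    assert (0 <= x ^ (j * k) / INR j * (INR (j * k) * t - sin (INR (j * k) * t))) by (apply Rmult_le_pos; lra).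
    lra.
  + apply Rmult_le_pos; [apply lam_nonneg|apply pow_le; lra].
Qed.

Lemma T_pos : 0 < T <= / 240.
Proof. unfold T; lra. Qed.

Lemma ex_RInt_rho_pow k a b : ex_RInt (fun t => rho t * t ^ k) a b.
Proof.
apply (ex_RInt_continuous (V := R_CompleteNormedModule)); intros t _.
apply (ex_derive_continuous (V := R_NormedModule)).
assert (H := ex_derive_rho t); auto_derive; auto.
Qed.

Lemma M_nonneg k : 0 <= M k.
Proof.
assert (HT := T_pos).
apply RInt_ge_0; [lra|apply ex_RInt_rho_pow|].
intros t Ht; apply Rmult_le_pos; [left; apply rho_pos|apply pow_le; lra].
Qed.

Lemma continuous_parts k a t :
  continuous (fun t => (t ^ (k + 1) + a * t ^ (k + 3)) * dsinsum B x t * rho t) t.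
Proof.
apply (continuous_mult (fun t => (t ^ (k + 1) + a * t ^ (k + 3)) * dsinsum B x t)).
- apply (continuous_mult (fun t => t ^ (k + 1) + a * t ^ (k + 3))); [|apply continuous_dsinsum].
  apply (ex_derive_continuous (V := R_NormedModule) (fun t => t ^ (k + 1) + a * t ^ (k + 3))); auto_derive; auto.
- apply (ex_derive_continuous (V := R_NormedModule)), ex_derive_rho.
Qed.

(** Integration by parts against [rho' = - dsinsum * rho]. The free coefficient [a] is [0] for the
    lower moment recursion; for the upper one it is tuned so that the extra term makes up for the
    amount by which [dsinsum] falls below [sig * t]. *)
Lemma M_parts k a :
  RInt (fun t => (t ^ (k + 1) + a * t ^ (k + 3)) * dsinsum B x t * rho t) 0 T
  = INR (k + 1) * M k + a * INR (k + 3) * M (k + 2) - (T ^ (k + 1) + a * T ^ (k + 3)) * rho T.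
Proof.
set (f := fun t => (t ^ (k + 1) + a * t ^ (k + 3)) * dsinsum B x t * rho t).
set (g := fun t => INR (k + 1) * (rho t * t ^ k) + a * INR (k + 3) * (rho t * t ^ (k + 2))).
assert (Hd : forall t, is_derive (fun t => - ((t ^ (k + 1) + a * t ^ (k + 3)) * rho t)) t (f t - g t)).
{ intros t; assert (H := is_derive_rho t).
  auto_derive; [eexists; exact H|].
  replace (Derive (fun x0 => rho x0) t) with (- dsinsum B x t * rho t) by (symmetry; apply is_derive_unique; exact H).
  unfold f, g; replace (pred (k + 1)) with k by lia; replace (pred (k + 3)) with (k + 2)%nat by lia; ring. }
assert (Hcf : forall t, continuous f t) by (intros t; apply continuous_parts).
assert (Hcg : forall t, continuous g t).
{ intros t; apply (ex_derive_continuous (V := R_NormedModule)); unfold g.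
  assert (H := ex_derive_rho t); auto_derive; auto. }
assert (HI := is_RInt_derive _ (fun t => f t - g t) 0 T (fun t _ => Hd t)
  (fun t _ => continuous_minus f g t (Hcf t) (Hcg t))).
apply is_RInt_unique in HI.
assert (ef : ex_RInt f 0 T) by (apply (ex_RInt_continuous (V := R_CompleteNormedModule)); auto).
assert (eg : ex_RInt g 0 T) by (apply (ex_RInt_continuous (V := R_CompleteNormedModule)); auto).
rewrite (RInt_minus f g) in HI by assumption.
assert (Eg : RInt g 0 T = INR (k + 1) * M k + a * INR (k + 3) * M (k + 2)).
{ apply is_RInt_unique; unfold g.
  apply (is_RInt_plus (V := R_NormedModule)); apply (is_RInt_scal (V := R_NormedModule));
    apply (RInt_correct (V := R_CompleteNormedModule)), ex_RInt_rho_pow. }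
rewrite Eg in HI; fold f; revert HI; unfold minus, plus, opp; simpl.
rewrite !(pow_ne_zero (k + 1)), !(pow_ne_zero (k + 3)) by lia.
lra.
Qed.

(** One half of the Gaussian recursion [sig * M (k + 2) = (k + 1) * M k], up to a relative error of
    order [1 / (sig tau^2)]. The boundary term at [T] has the favourable sign and is dropped. *)
Lemma M_upper k : sig * M (k + 2) * (1 - 475 / 100 * INR (k + 3) / (sig * tau ^ 2)) <= INR (k + 1) * M k.
Proof.
assert (HT := T_pos); assert (Hs := sig_ge); assert (Hk := kap_le).
assert (Ht3 : 0 < tau ^ 3) by (apply pow_lt; lra).
assert (Ht2 : 0 < tau ^ 2) by (apply pow_lt; lra).
assert (Hs0 : 0 < sig) by (apply Rlt_le_trans with (2 := Hs); apply Rmult_lt_0_compat; [lra|apply Rinv_0_lt_compat; lra]).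
set (a := 475 / 100 / tau ^ 2).
assert (Ha : 0 < a) by (apply Rmult_lt_0_compat; [lra|apply Rinv_0_lt_compat; lra]).
assert (HP := M_parts k a).
assert (Hb : 0 <= (T ^ (k + 1) + a * T ^ (k + 3)) * rho T).
{ apply Rmult_le_pos; [|left; apply rho_pos].
  apply Rplus_le_le_0_compat; [apply pow_le; lra|apply Rmult_le_pos; [lra|apply pow_le; lra]]. }
assert (HL : sig * M (k + 2) <= RInt (fun t => (t ^ (k + 1) + a * t ^ (k + 3)) * dsinsum B x t * rho t) 0 T).
{ unfold M; rewrite <- (RInt_scal (V := R_CompleteNormedModule) (fun t => rho t * t ^ (k + 2))) by apply ex_RInt_rho_pow.
  apply RInt_le; [lra|apply (ex_RInt_scal (V := R_NormedModule)), ex_RInt_rho_pow| |].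
  - apply (ex_RInt_continuous (V := R_CompleteNormedModule)); intros t _; apply continuous_parts.
  - intros t Ht; unfold scal; simpl; unfold mult; simpl.
    assert (Hr := rho_pos t).
    replace (sig * (rho t * t ^ (k + 2))) with (t ^ (k + 1) * rho t * (sig * t)).
    2:{ replace (k + 2)%nat with (S (k + 1)) by lia; rewrite <- tech_pow_Rmult; ring. }
    replace ((t ^ (k + 1) + a * t ^ (k + 3)) * dsinsum B x t * rho t)
      with (t ^ (k + 1) * rho t * ((1 + a * t ^ 2) * dsinsum B x t)).
    2:{ replace (k + 3)%nat with (2 + (k + 1))%nat by lia; rewrite (pow_add t 2); ring. }
    apply Rmult_le_compat_l; [apply Rmult_le_pos; [apply pow_le; lra|lra]|].
    assert (Hg := dsinsum_ge t ltac:(lra)).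
    assert (Ht22 : t ^ 2 <= tau ^ 2 / 4).
    { replace (tau ^ 2 / 4) with (T ^ 2) by (unfold T; field); apply pow_incr; lra. }
    assert (Ht20 : 0 <= t ^ 2) by apply pow2_ge_0.
    (* [kap <= 13 sig / tau^2] and [(1 + 4.75 u^2)(1 - 13/6 u^2) >= 1] for [u <= 1/2] *)
    assert (Hks : kap * tau ^ 2 <= 13 * sig).
    { apply Rle_trans with (2105 / 100 / tau ^ 5 * tau ^ 2); [apply Rmult_le_compat_r; lra|].
      replace (2105 / 100 / tau ^ 5 * tau ^ 2) with (2105 / 100 * / tau ^ 3) by (field; lra).
      unfold Rdiv in Hs; assert (0 < / tau ^ 3) by (apply Rinv_0_lt_compat; lra); lra. }
    set (v := t ^ 2 / tau ^ 2).
    assert (Hv : 0 <= v <= / 4).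
    { unfold v; split; [apply Rmult_le_pos; [lra|left; apply Rinv_0_lt_compat; lra]|].
      apply (Rmult_le_reg_r (tau ^ 2)); [lra|]; unfold Rdiv; rewrite Rmult_assoc, Rinv_l by lra; lra. }
    assert (Hd1 : sig * t * (1 - 13 / 6 * v) <= dsinsum B x t).
    { apply Rle_trans with (2 := Hg).
      replace (sig * t - kap * t ^ 3 / 6) with (t * (sig - kap * tau ^ 2 * v / 6)) by (unfold v; field; lra).
      replace (sig * t * (1 - 13 / 6 * v)) with (t * (sig - 13 * sig * v / 6)) by field.
      apply Rmult_le_compat_l; [lra|].
      assert (kap * tau ^ 2 * v <= 13 * sig * v) by (apply Rmult_le_compat_r; lra); lra. }
    replace (1 + a * t ^ 2) with (1 + 475 / 100 * v) by (unfold a, v; field; lra).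
    apply Rle_trans with ((1 + 475 / 100 * v) * (sig * t * (1 - 13 / 6 * v))).
    + replace ((1 + 475 / 100 * v) * (sig * t * (1 - 13 / 6 * v))) with (sig * t * ((1 + 475 / 100 * v) * (1 - 13 / 6 * v))) by ring.
      rewrite <- (Rmult_1_r (sig * t)) at 1; apply Rmult_le_compat_l; [apply Rmult_le_pos; lra|nra].
    + apply Rmult_le_compat_l; lra. }
assert (Ea : sig * M (k + 2) * (1 - 475 / 100 * INR (k + 3) / (sig * tau ^ 2)) = sig * M (k + 2) - a * INR (k + 3) * M (k + 2)).
{ unfold a; field; lra. }
rewrite Ea; lra.
Qed.

Lemma M_lower k : INR (k + 1) * M k - T ^ (k + 1) * rho T <= sig * M (k + 2).
Proof.
assert (HT := T_pos); assert (HP := M_parts k 0).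
assert (HL : RInt (fun t => (t ^ (k + 1) + 0 * t ^ (k + 3)) * dsinsum B x t * rho t) 0 T <= sig * M (k + 2)).
{ unfold M; rewrite <- (RInt_scal (V := R_CompleteNormedModule) (fun t => rho t * t ^ (k + 2))) by apply ex_RInt_rho_pow.
  apply RInt_le; [lra| |apply (ex_RInt_scal (V := R_NormedModule)), ex_RInt_rho_pow|].
  - apply (ex_RInt_continuous (V := R_CompleteNormedModule)); intros t _; apply continuous_parts.
  - intros t Ht; unfold scal; simpl; unfold mult; simpl.
    assert (Hr := rho_pos t).
    replace (sig * (rho t * t ^ (k + 2))) with (t ^ (k + 1) * rho t * (sig * t)).
    2:{ replace (k + 2)%nat with (S (k + 1)) by lia; rewrite <- tech_pow_Rmult; ring. }
    replace ((t ^ (k + 1) + 0 * t ^ (k + 3)) * dsinsum B x t * rho t)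
      with (t ^ (k + 1) * rho t * dsinsum B x t) by ring.
    apply Rmult_le_compat_l; [apply Rmult_le_pos; [apply pow_le; lra|lra]|].
    apply dsinsum_le; lra. }
rewrite HP in HL; lra.
Qed.

Lemma rho_ge t : 0 <= t -> exp (- (sig * t ^ 2 / 2)) <= rho t.
Proof.
intros Ht; unfold rho.
assert (H : cosum B x 0 - cosum B x t <= sig * t ^ 2 / 2).
{ apply (le_of_derive (fun t => cosum B x 0 - cosum B x t) (fun t => sig * t ^ 2 / 2) (dsinsum B x) (fun t => sig * t) t); try lra.
  - intros y Hy; assert (H := is_derive_cosum_t B x y).
    auto_derive; [eexists; exact H|].
    replace (Derive (fun x0 => cosum B x x0) y) with (- dsinsum B x y) by (symmetry; apply is_derive_unique; exact H).
    ring.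
  - intros y Hy; auto_derive; [exact I|field].
  - intros y Hy; apply dsinsum_le; lra. }
apply exp_le_mono; lra.
Qed.

Let tail (k : nat) := RInt (fun t => rho t * (2 * sin (t / 2)) ^ k) T PI.

Lemma ex_RInt_tail k a b : ex_RInt (fun t => rho t * (2 * sin (t / 2)) ^ k) a b.
Proof.
apply (ex_RInt_continuous (V := R_CompleteNormedModule)); intros t _.
apply (ex_derive_continuous (V := R_NormedModule)).
assert (H := ex_derive_rho t); auto_derive; auto.
Qed.

Lemma four_tau_le_PI : T <= 4 * tau <= PI.
Proof. assert (H := PI2_1); unfold T; lra. Qed.

Lemma two_sin_half_bounds t : 0 <= t <= PI -> 0 <= 2 * sin (t / 2) <= t.
Proof.
intros Ht; assert (H := sin_ge_0 (t / 2) ltac:(lra) ltac:(lra)).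
assert (H2 := sin_le_id (t / 2) ltac:(lra)); lra.
Qed.

(** Put [t = T (1 + v)] with [v <= 7]. At [v = 0] the ratio [t^2 / (tau^2 + t^2)] is [1/5], whence
    [124/1000 = 62/100 * 1/5]. Its growth, multiplied by [1 / tau >= 120], yields at least
    [15/2 * v] in the exponent: [6 v] pays for [(1 + v)^6] and [3/2 * v = 3 (t - T) / tau]
    remains. *)
Lemma rho_mid_le t : T <= t <= 4 * tau ->
  rho t * t ^ 6 <= T ^ 6 * exp (- (124 / 1000 * / tau)) * exp (- (3 * (t - T) / tau)).
Proof.
intros Ht; assert (HT := T_pos).
assert (H := cosum_diff_ge_mid B tau tau_bounds B_big ltac:(lia) t ltac:(unfold T in Ht; lra)); fold x in H.
set (v := 2 * (t - T) / tau).
assert (Ev : t = T * (1 + v)) by (unfold v, T; field; lra).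
assert (Hv : 0 <= v <= 7).
{ assert (Hit : 0 < / tau) by (apply Rinv_0_lt_compat; lra).
  unfold v; split.
  - apply Rmult_le_pos; lra.
  - apply (Rmult_le_reg_r tau); [lra|]; unfold Rdiv; rewrite Rmult_assoc, Rinv_l by lra; unfold T; lra. }
assert (Hz : 120 <= / tau) by (rewrite <- (Rinv_inv 120); apply Rinv_le_contravar; lra).
assert (Hr : t ^ 2 / (tau ^ 2 + t ^ 2) = / 5 + 4 * v * (v + 2) / (5 * (4 + (1 + v) ^ 2))).
{ rewrite Ev; unfold T; field; split; nra. }
assert (Hp : (1 + v) ^ 6 <= exp (6 * v)).
{ replace (exp (6 * v)) with (exp v ^ 6) by (rewrite exp_pow_INR; f_equal; simpl; ring).
  apply pow_incr; split; [lra|].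
  apply exp_ineq1_le. }
assert (Hexp : 6 * v + - (62 / 100 / tau * (t ^ 2 / (tau ^ 2 + t ^ 2))) <= - (124 / 1000 * / tau) + - (3 / 2 * v)).
{ rewrite Hr.
  assert (Hq : 15 / 2 * v <= 62 / 100 * 120 * (4 * v * (v + 2) / (5 * (4 + (1 + v) ^ 2)))).
  { apply (Rmult_le_reg_r (5 * (4 + (1 + v) ^ 2))); [nra|].
    replace (62 / 100 * 120 * (4 * v * (v + 2) / (5 * (4 + (1 + v) ^ 2))) * (5 * (4 + (1 + v) ^ 2)))
      with (v * (62 / 100 * 120 * 4 * (v + 2))) by (field; nra).
    replace (15 / 2 * v * (5 * (4 + (1 + v) ^ 2))) with (v * (75 / 2 * (4 + (1 + v) ^ 2))) by field.
    apply Rmult_le_compat_l; nra. }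
  assert (Hc : 0 <= 4 * v * (v + 2) / (5 * (4 + (1 + v) ^ 2))).
  { apply Rmult_le_pos; [nra|left; apply Rinv_0_lt_compat; nra]. }
  set (c := 4 * v * (v + 2) / (5 * (4 + (1 + v) ^ 2))) in *.
  unfold Rdiv at 1; nra. }
assert (Hrho : rho t <= exp (- (62 / 100 / tau * (t ^ 2 / (tau ^ 2 + t ^ 2))))).
{ apply exp_le_mono; lra. }
assert (HT6 : 0 < T ^ 6) by (apply pow_lt; lra).
replace (t ^ 6) with (T ^ 6 * (1 + v) ^ 6) by (rewrite Ev, Rpow_mult_distr; reflexivity).
replace (- (3 * (t - T) / tau)) with (- (3 / 2 * v)) by (unfold v; field; lra).
rewrite Rmult_assoc, <- exp_plus.
replace (rho t * (T ^ 6 * (1 + v) ^ 6)) with (T ^ 6 * ((1 + v) ^ 6 * rho t)) by ring.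
apply Rmult_le_compat_l; [lra|].
apply Rle_trans with (exp (6 * v) * exp (- (62 / 100 / tau * (t ^ 2 / (tau ^ 2 + t ^ 2))))).
- apply Rmult_le_compat; [apply pow_le; lra|left; apply rho_pos|exact Hp|exact Hrho].
- rewrite <- exp_plus; apply exp_le_mono, Hexp.
Qed.

(** Up to [4 tau] the exponential majorant of [rho_mid_le] is integrated explicitly; beyond, a
    constant bound is used, with [256 = 2^6 * 4] and [PI <= 4]. *)
Lemma tail6_le : tail 6 <= T ^ 6 * exp (- (124 / 1000 * / tau)) * (tau / 3) + 256 * exp (- (499 / 1000 * / tau)).
Proof.
assert (HT := T_pos); assert (H4 := four_tau_le_PI).
unfold tail; rewrite <- (RInt_Chasles_R _ T (4 * tau) PI) by apply ex_RInt_tail.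
apply Rplus_le_compat.
- set (c := T ^ 6 * exp (- (124 / 1000 * / tau))).
  assert (Hc : 0 < c) by (apply Rmult_lt_0_compat; [apply pow_lt; lra|apply exp_pos]).
  assert (HI : is_RInt (fun t => c * exp (- (3 * (t - T) / tau))) T (4 * tau)
    (minus (- (c * (tau / 3) * exp (- (3 * (4 * tau - T) / tau)))) (- (c * (tau / 3) * exp (- (3 * (T - T) / tau)))))).
  { apply (is_RInt_derive (fun t => - (c * (tau / 3) * exp (- (3 * (t - T) / tau)))) (fun t => c * exp (- (3 * (t - T) / tau)))).
    - intros t _; auto_derive; [exact I|unfold Rdiv, Rminus; field; lra].
    - intros t _; apply (ex_derive_continuous (V := R_NormedModule) (fun t => c * exp (- (3 * (t - T) / tau)))).
      auto_derive; exact I. }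
  apply Rle_trans with (RInt (fun t => c * exp (- (3 * (t - T) / tau))) T (4 * tau)).
  + apply RInt_le; [lra|apply ex_RInt_tail|eexists; exact HI|].
    intros t Ht; apply Rle_trans with (2 := rho_mid_le t ltac:(lra)).
    apply Rmult_le_compat_l; [left; apply rho_pos|].
    apply pow_incr, two_sin_half_bounds; lra.
  + rewrite (is_RInt_unique _ _ _ _ HI); unfold minus, plus, opp; simpl.
    replace (- (3 * (T - T) / tau)) with 0 by (field; lra); rewrite exp_0.
    assert (H0 := exp_pos (- (3 * (4 * tau - T) / tau))).
    assert (0 <= c * (tau / 3) * exp (- (3 * (4 * tau - T) / tau))) by (apply Rmult_le_pos; [apply Rmult_le_pos|]; lra).
    lra.
- apply Rle_trans with (RInt (fun _ => 64 * exp (- (499 / 1000 * / tau))) (4 * tau) PI).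
  + apply RInt_le; [lra|apply ex_RInt_tail|apply ex_RInt_const|].
    intros t Ht; rewrite (Rmult_comm 64).
    assert (H := cosum_diff_ge_far B tau tau_bounds B_big ltac:(lia) t ltac:(lra)); fold x in H.
    apply Rmult_le_compat; [left; apply rho_pos| | |].
    * apply pow_le, two_sin_half_bounds; lra.
    * apply exp_le_mono; unfold Rdiv in *; lra.
    * replace 64 with (2 ^ 6) by ring; apply pow_incr.
      assert (Hb := SIN_bound (t / 2)); assert (Hb2 := two_sin_half_bounds t ltac:(lra)); lra.
  + rewrite RInt_const; unfold scal; simpl; unfold mult; simpl.
    assert (HP := PI_4); assert (H0 := exp_pos (- (499 / 1000 * / tau))); nra.
Qed.

Lemma tail_nonneg k : 0 <= tail k.
Proof.
assert (HT := T_pos); assert (H4 := four_tau_le_PI).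
apply RInt_ge_0; [lra|apply ex_RInt_tail|].
intros t Ht; apply Rmult_le_pos; [left; apply rho_pos|apply pow_le, two_sin_half_bounds; lra].
Qed.

(** On the outer arc [2 sin (t / 2)] is at least nearly [T], so every lower tail is controlled by
    the sixth one. *)
Lemma tail_step k : 999 / 1000 * T * tail k <= tail (S k).
Proof.
assert (HT := T_pos); assert (H4 := four_tau_le_PI).
unfold tail; rewrite <- (RInt_scal (V := R_CompleteNormedModule) (fun t => rho t * (2 * sin (t / 2)) ^ k)) by apply ex_RInt_tail.
apply RInt_le; [lra|apply (ex_RInt_scal (V := R_NormedModule)), ex_RInt_tail|apply ex_RInt_tail|].
intros t Ht; unfold scal; simpl; unfold mult; simpl.
assert (H0 := two_sin_half_bounds t ltac:(lra)).
assert (Hs : 999 / 1000 * T <= 2 * sin (t / 2)).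
{ assert (sin (T / 2) <= sin (t / 2)) by (apply sin_incr_1; lra).
  assert (H3 := sin_ge_3 (T / 2) ltac:(lra)).
  assert ((T / 2) ^ 3 <= T / 2 * (/ 480) ^ 2).
  { replace ((T / 2) ^ 3) with (T / 2 * (T / 2) ^ 2) by ring.
    apply Rmult_le_compat_l; [lra|apply pow_incr; lra]. }
  lra. }
replace (rho t * (2 * sin (t / 2) * (2 * sin (t / 2)) ^ k)) with (2 * sin (t / 2) * (rho t * (2 * sin (t / 2)) ^ k)) by ring.
apply Rmult_le_compat_r; [|exact Hs].
apply Rmult_le_pos; [left; apply rho_pos|apply pow_le; lra].
Qed.

Let weight (k : nat) (t : R) := (2 * sin (t / 2)) ^ k * cos (t / 2) ^ (6 - k).

Lemma weight_bounds k t : (k <= 6)%nat -> 0 <= t <= T -> 9999 / 10000 * t ^ k <= weight k t <= t ^ k.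
Proof.
intros Hk Ht; assert (HT := T_pos); assert (H4 := four_tau_le_PI).
assert (H0 := two_sin_half_bounds t ltac:(lra)).
assert (Hc0 := cos_ge_2 (t / 2)); assert (Hc1 := COS_bound (t / 2)).
assert (Hs := sin_ge_3 (t / 2) ltac:(lra)).
assert (Ht2 : t ^ 2 <= (/ 240) ^ 2) by (apply pow_incr; lra).
set (e := 1 - / 400000).
assert (Hc : e <= cos (t / 2)) by (unfold e; replace ((t / 2) ^ 2) with (t ^ 2 / 4) in Hc0 by field; lra).
assert (Hs2 : t * e <= 2 * sin (t / 2)).
{ apply Rle_trans with (t * (1 - t ^ 2 / 24)).
  - apply Rmult_le_compat_l; [lra|unfold e; lra].
  - replace (t * (1 - t ^ 2 / 24)) with (2 * (t / 2 - (t / 2) ^ 3 / 6)) by field; lra. }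
assert (He : 0 < e < 1) by (unfold e; lra).
split; unfold weight.
- apply Rle_trans with ((t * e) ^ k * e ^ (6 - k)).
  + rewrite Rpow_mult_distr, Rmult_assoc, <- pow_add.
    replace (k + (6 - k))%nat with 6%nat by lia; rewrite Rmult_comm.
    apply Rmult_le_compat_l; [apply pow_le; lra|unfold e; lra].
  + apply Rmult_le_compat; [apply pow_le, Rmult_le_pos; lra|apply pow_le; lra|apply pow_incr|apply pow_incr; lra].
    split; [apply Rmult_le_pos; lra|exact Hs2].
- rewrite <- (Rmult_1_r (t ^ k)), <- (pow1 (6 - k)).
  apply Rmult_le_compat; [apply pow_le; lra|apply pow_le; lra|apply pow_incr; lra|apply pow_incr; lra].
Qed.

Lemma weight_abs_le k t : 0 <= t <= PI -> 0 <= weight k t <= (2 * sin (t / 2)) ^ k.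
Proof.
intros Ht; assert (H0 := two_sin_half_bounds t Ht).
assert (Hc0 : 0 <= cos (t / 2)) by (apply cos_ge_0; lra); assert (Hc1 := COS_bound (t / 2)).
assert (Hp : 0 <= (2 * sin (t / 2)) ^ k) by (apply pow_le; lra).
assert (Hq : 0 <= cos (t / 2) ^ (6 - k) <= 1).
{ split; [apply pow_le; lra|]; rewrite <- (pow1 (6 - k)); apply pow_incr; lra. }
unfold weight; nra.
Qed.

Definition evenint (k : nat) := RInt (fun t => rho t * cos (arg t) * weight k t) 0 PI.
Definition oddint (k : nat) := RInt (fun t => rho t * sin (arg t) * weight k t) 0 PI.

Lemma ex_RInt_evenint k a b : ex_RInt (fun t => rho t * cos (arg t) * weight k t) a b.
Proof.
apply (ex_RInt_continuous (V := R_CompleteNormedModule)); intros t _.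
apply (ex_derive_continuous (V := R_NormedModule)); unfold weight.
assert (H := ex_derive_rho t); assert (H2 := ex_derive_arg t); auto_derive; repeat split; auto.
Qed.

Lemma ex_RInt_oddint k a b : ex_RInt (fun t => rho t * sin (arg t) * weight k t) a b.
Proof.
apply (ex_RInt_continuous (V := R_CompleteNormedModule)); intros t _.
apply (ex_derive_continuous (V := R_NormedModule)); unfold weight.
assert (H := ex_derive_rho t); assert (H2 := ex_derive_arg t); auto_derive; repeat split; auto.
Qed.

Lemma arg_sqr_le t : 0 <= t -> arg t ^ 2 <= lam ^ 2 * t ^ 6.
Proof.
intros Ht; assert (H := arg_le t Ht).
replace (lam ^ 2 * t ^ 6) with ((lam * t ^ 3) ^ 2) by ring.
rewrite <- pow2_abs; apply pow_incr; split; [apply Rabs_pos|exact H].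
Qed.

(** On the central arc [cos (arg t) >= 1 - arg t ^ 2 / 2] and the phase is at most cubic, which
    produces the moment of order [k + 6]; on the outer arc only the absolute value of the integrand
    is used. *)
Lemma evenint_ge k : (k <= 6)%nat ->
  9999 / 10000 * M k - lam ^ 2 / 2 * M (k + 6) - tail k <= evenint k.
Proof.
intros Hk; assert (HT := T_pos); assert (H4 := four_tau_le_PI).
unfold evenint; rewrite <- (RInt_Chasles_R _ 0 T PI) by apply ex_RInt_evenint.
apply Rplus_le_compat.
- assert (HI : is_RInt (fun t => 9999 / 10000 * (rho t * t ^ k) - lam ^ 2 / 2 * (rho t * t ^ (k + 6))) 0 T
    (9999 / 10000 * M k - lam ^ 2 / 2 * M (k + 6))).
  { apply (is_RInt_minus (V := R_NormedModule)); apply (is_RInt_scal (V := R_NormedModule));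
      apply (RInt_correct (V := R_CompleteNormedModule)), ex_RInt_rho_pow. }
  rewrite <- (is_RInt_unique _ _ _ _ HI).
  apply RInt_le; [lra|eexists; exact HI|apply ex_RInt_evenint|].
  intros t Ht; assert (Hw := weight_bounds k t Hk ltac:(lra)).
  assert (Hr := rho_pos t); assert (Hc := cos_ge_2 (arg t)); assert (Ha := arg_sqr_le t ltac:(lra)).
  assert (Htk : 0 <= t ^ k) by (apply pow_le; lra).
  assert (Ht6 : 0 <= t ^ 6) by (apply pow_le; lra).
  replace (9999 / 10000 * (rho t * t ^ k) - lam ^ 2 / 2 * (rho t * t ^ (k + 6)))
    with (rho t * (9999 / 10000 * t ^ k - lam ^ 2 * t ^ 6 / 2 * t ^ k)) by (rewrite pow_add; field).
  rewrite Rmult_assoc; apply Rmult_le_compat_l; [lra|].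
  set (W := weight k t) in *.
  assert (HW : 0 <= W) by lra.
  assert (Hl : 0 <= lam ^ 2 * t ^ 6) by (apply Rmult_le_pos; [apply pow2_ge_0|lra]).
  apply Rle_trans with ((1 - lam ^ 2 * t ^ 6 / 2) * W).
  + assert (lam ^ 2 * t ^ 6 / 2 * W <= lam ^ 2 * t ^ 6 / 2 * t ^ k) by (apply Rmult_le_compat_l; lra).
    lra.
  + apply Rmult_le_compat_r; lra.
- unfold tail; rewrite <- RInt_opp_R by apply ex_RInt_tail.
  apply RInt_le; [lra|apply (ex_RInt_opp (V := R_NormedModule)), ex_RInt_tail|apply ex_RInt_evenint|].
  intros t Ht.
  assert (Hw := weight_abs_le k t ltac:(lra)); assert (Hc := COS_bound (arg t)); assert (Hr := rho_pos t).
  rewrite Rmult_assoc.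
  replace (- (rho t * (2 * sin (t / 2)) ^ k)) with (rho t * - (2 * sin (t / 2)) ^ k) by ring.
  apply Rmult_le_compat_l; [lra|nra].
Qed.

Lemma evenint0_le : evenint 0 <= M 0 + tail 0.
Proof.
assert (HT := T_pos); assert (H4 := four_tau_le_PI).
unfold evenint; rewrite <- (RInt_Chasles_R _ 0 T PI) by apply ex_RInt_evenint.
apply Rplus_le_compat.
- apply RInt_le; [lra|apply ex_RInt_evenint|apply ex_RInt_rho_pow|].
  intros t Ht; assert (Hw := weight_bounds 0 t ltac:(lia) ltac:(lra)).
  assert (Hr := rho_pos t); assert (Hc := COS_bound (arg t)).
  rewrite Rmult_assoc; apply Rmult_le_compat_l; [lra|].
  assert (0 <= t ^ 0) by (simpl; lra); nra.
- apply RInt_le; [lra|apply ex_RInt_evenint|apply ex_RInt_tail|].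
  intros t Ht.
  assert (Hw := weight_abs_le 0 t ltac:(lra)); assert (Hc := COS_bound (arg t)); assert (Hr := rho_pos t).
  rewrite Rmult_assoc; apply Rmult_le_compat_l; [lra|nra].
Qed.

Lemma sin_abs_le y : Rabs (sin y) <= Rabs y.
Proof.
destruct (Rle_or_lt 0 y) as [Hy|Hy].
- rewrite (Rabs_pos_eq y) by lra; apply Rabs_le; split; [|apply sin_le_id; lra].
  destruct (Rle_or_lt y PI) as [H|H]; [assert (H1 := sin_ge_0 y Hy H); lra|].
  assert (H1 := SIN_bound y); assert (H2 := PI2_1); lra.
- rewrite <- (Ropp_involutive y), sin_neg, Rabs_Ropp, (Rabs_Ropp (- y)).
  rewrite (Rabs_pos_eq (- y)) by lra; apply Rabs_le; split; [|apply sin_le_id; lra].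
  destruct (Rle_or_lt (- y) PI) as [H|H]; [assert (H1 := sin_ge_0 (- y) ltac:(lra) H); lra|].
  assert (H1 := SIN_bound (- y)); assert (H2 := PI2_1); lra.
Qed.

Lemma oddint_abs_le k : (k <= 6)%nat -> Rabs (oddint k) <= lam * M (k + 3) + tail k.
Proof.
intros Hk; assert (HT := T_pos); assert (H4 := four_tau_le_PI).
unfold oddint; rewrite <- (RInt_Chasles_R _ 0 T PI) by apply ex_RInt_oddint.
apply Rle_trans with (1 := Rabs_triang _ _).
assert (Hab : forall a b, ex_RInt (fun t => Rabs (rho t * sin (arg t) * weight k t)) a b).
{ intros a b; apply (ex_RInt_norm (fun t => rho t * sin (arg t) * weight k t)), ex_RInt_oddint. }
apply Rplus_le_compat.
- apply Rle_trans with (1 := abs_RInt_le _ 0 T ltac:(lra) (ex_RInt_oddint k 0 T)).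
  unfold M; rewrite <- (RInt_scal (V := R_CompleteNormedModule) (fun t => rho t * t ^ (k + 3))) by apply ex_RInt_rho_pow.
  apply RInt_le; [lra|apply Hab|apply (ex_RInt_scal (V := R_NormedModule)), ex_RInt_rho_pow|].
  intros t Ht; unfold scal; simpl; unfold mult; simpl.
  assert (Hw := weight_bounds k t Hk ltac:(lra)).
  assert (Hr := rho_pos t); assert (Ha := arg_le t ltac:(lra)); assert (Hs := sin_abs_le (arg t)).
  assert (Htk : 0 <= t ^ k) by (apply pow_le; lra).
  rewrite !Rabs_mult, (Rabs_pos_eq (rho t)), (Rabs_pos_eq (weight k t)) by lra.
  replace (lam * (rho t * t ^ (k + 3))) with (rho t * (lam * t ^ 3) * t ^ k) by (rewrite pow_add; ring).
  apply Rmult_le_compat; [apply Rmult_le_pos; [lra|apply Rabs_pos]|lra| |lra].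
  apply Rmult_le_compat_l; lra.
- apply Rle_trans with (1 := abs_RInt_le _ T PI ltac:(lra) (ex_RInt_oddint k T PI)).
  apply RInt_le; [lra|apply Hab|apply ex_RInt_tail|].
  intros t Ht.
  assert (Hw := weight_abs_le k t ltac:(lra)); assert (Hr := rho_pos t).
  assert (Hs : Rabs (sin (arg t)) <= 1) by (apply Rabs_le, SIN_bound).
  rewrite !Rabs_mult, (Rabs_pos_eq (rho t)), (Rabs_pos_eq (weight k t)) by lra.
  rewrite Rmult_assoc; apply Rmult_le_compat_l; [lra|].
  assert (H0 := Rabs_pos (sin (arg t))); nra.
Qed.

(** Rescaling by the standard deviation: [mm] and [rr] are moments and tails in the variable [w t],
    [y / 2 = w T] is the end of the central arc in standard deviations, and [l] is the cubic
    coefficient. In these units all remaining bounds are numerical. *)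
Let w := sqrt sig.
Let y := w * tau.
Let z := / tau.
Let mm (k : nat) := w ^ (k + 1) * M k.
Let rr (k : nat) := w ^ (k + 1) * tail k.
Let l := lam / w ^ 3.

Lemma z_ge : 120 <= z.
Proof. unfold z; rewrite <- (Rinv_inv 120); apply Rinv_le_contravar; lra. Qed.

Lemma sig_pos : 0 < sig.
Proof.
apply Rlt_le_trans with (2 := sig_ge).
apply Rmult_lt_0_compat; [lra|apply Rinv_0_lt_compat, pow_lt; lra].
Qed.

Lemma w_pos : 0 < w.
Proof. apply sqrt_lt_R0, sig_pos. Qed.

Lemma w_sqr : w ^ 2 = sig.
Proof. assert (H := sig_pos); unfold w; simpl; rewrite Rmult_1_r; apply sqrt_sqrt; lra. Qed.

Lemma y_sqr_bounds : 162 / 100 * z <= y ^ 2 <= 204 / 100 * z.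
Proof.
assert (H1 := sig_ge); assert (H2 := sig_le).
assert (Ht2 : 0 < tau ^ 2) by (apply pow_lt; lra).
replace (y ^ 2) with (sig * tau ^ 2) by (unfold y; rewrite <- w_sqr; ring).
unfold z; split.
- apply Rle_trans with (162 / 100 / tau ^ 3 * tau ^ 2); [right; field; lra|apply Rmult_le_compat_r; lra].
- apply Rle_trans with (204 / 100 / tau ^ 3 * tau ^ 2); [apply Rmult_le_compat_r; lra|right; field; lra].
Qed.

Lemma y_ge : 139 / 10 <= y.
Proof.
assert (Hw := w_pos); assert (H := y_sqr_bounds); assert (Hz := z_ge).
assert (0 < y) by (apply Rmult_lt_0_compat; lra).
apply Rsqr_incr_0_var; [unfold Rsqr; nra|lra].
Qed.

Lemma mm_nonneg k : 0 <= mm k.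
Proof. apply Rmult_le_pos; [apply pow_le; left; apply w_pos|apply M_nonneg]. Qed.

(** [24435 / 1000000] exceeds [4.75 / (1.62 * 120)], by the lower bound for [y^2]. *)
Lemma mm_upper k : mm (k + 2) * (1 - 24435 / 1000000 * INR (k + 3)) <= INR (k + 1) * mm k.
Proof.
assert (H := M_upper k); assert (Hw := w_pos); assert (Hy := y_sqr_bounds); assert (Hz := z_ge).
assert (Hs := sig_pos); assert (Ht2 : 0 < tau ^ 2) by (apply pow_lt; lra).
assert (Ey : sig * tau ^ 2 = y ^ 2) by (unfold y; rewrite <- w_sqr; ring).
rewrite Ey in H.
assert (Hc : 475 / 100 * INR (k + 3) / y ^ 2 <= 24435 / 1000000 * INR (k + 3)).
{ assert (Hk := pos_INR (k + 3)).
  apply (Rmult_le_reg_r (y ^ 2)); [lra|].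
  replace (475 / 100 * INR (k + 3) / y ^ 2 * y ^ 2) with (475 / 100 * INR (k + 3)) by (field; intro E; rewrite E in Hy; lra).
  nra. }
assert (Hwk : 0 < w ^ (k + 1)) by (apply pow_lt; exact Hw).
apply (Rmult_le_compat_l (w ^ (k + 1))) in H; [|lra].
replace (INR (k + 1) * mm k) with (w ^ (k + 1) * (INR (k + 1) * M k)) by (unfold mm; ring).
apply Rle_trans with (2 := H).
replace (mm (k + 2)) with (w ^ (k + 1) * (sig * M (k + 2))).
2:{ unfold mm; replace (k + 2 + 1)%nat with (2 + (k + 1))%nat by lia; rewrite (pow_add w 2), w_sqr; ring. }
rewrite Rmult_assoc; apply Rmult_le_compat_l; [lra|]; apply Rmult_le_compat_l; [|lra].
apply Rmult_le_pos; [lra|apply M_nonneg].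
Qed.

Lemma mm_lower k : INR (k + 1) * mm k - (y / 2) ^ (k + 1) * rho T <= mm (k + 2).
Proof.
assert (H := M_lower k); assert (Hw := w_pos).
assert (Hwk : 0 < w ^ (k + 1)) by (apply pow_lt; exact Hw).
apply (Rmult_le_compat_l (w ^ (k + 1))) in H; [|lra].
replace (mm (k + 2)) with (w ^ (k + 1) * (sig * M (k + 2))).
2:{ unfold mm; replace (k + 2 + 1)%nat with (2 + (k + 1))%nat by lia; rewrite (pow_add w 2), w_sqr; ring. }
apply Rle_trans with (2 := H); right.
replace (y / 2) with (w * T) by (unfold y, T; field).
rewrite Rpow_mult_distr; unfold mm; ring.
Qed.

(** The fourth power of [z] arises from [y^8], since [y^2] is at most [2.04 z]; the exponent at
    [z = 120] is [14.88]. *)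
Lemma exp_tail1 : z ^ 4 * exp (- (124 / 1000 * z)) <= 80.
Proof.
assert (H := pow_exp_decr 4 (124 / 1000) 120 z ltac:(lra) ltac:(simpl; lra) z_ge).
apply Rle_trans with (1 := H).
assert (He := exp_INR_ge 14 (88 / 100) ltac:(lra)).
rewrite exp_Ropp; replace (124 / 1000 * 120) with (INR 14 + 88 / 100) by (simpl; lra).
assert (Hp := exp_pos (INR 14 + 88 / 100)).
apply (Rmult_le_reg_r (exp (INR 14 + 88 / 100))); [exact Hp|].
rewrite Rmult_assoc, Rinv_l, Rmult_1_r by lra; lra.
Qed.

(** Of the eleven powers of [z], seven come from [w = y z] and four from the bound for [y^8]. *)
Lemma exp_tail2 : z ^ 11 * exp (- (499 / 1000 * z)) <= / 1000.
Proof.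
assert (H := pow_exp_decr 11 (499 / 1000) 120 z ltac:(lra) ltac:(simpl; lra) z_ge).
apply Rle_trans with (1 := H).
assert (He := exp_INR_ge 59 (88 / 100) ltac:(lra)).
rewrite exp_Ropp; replace (499 / 1000 * 120) with (INR 59 + 88 / 100) by (rewrite INR_IZR_INZ; simpl; lra).
assert (Hp := exp_pos (INR 59 + 88 / 100)).
apply (Rmult_le_reg_r (exp (INR 59 + 88 / 100))); [exact Hp|].
rewrite Rmult_assoc, Rinv_l, Rmult_1_r by lra; lra.
Qed.

Lemma y_pow8_exp : y ^ 8 * exp (- (124 / 1000 * z)) <= 1400.
Proof.
assert (Hy := y_sqr_bounds); assert (Hz := z_ge); assert (He := exp_tail1).
assert (Hp := exp_pos (- (124 / 1000 * z))).
assert (H8 : y ^ 8 <= (204 / 100 * z) ^ 4).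
{ replace (y ^ 8) with ((y ^ 2) ^ 4) by ring; apply pow_incr; split; [apply pow2_ge_0|lra]. }
apply Rle_trans with ((204 / 100 * z) ^ 4 * exp (- (124 / 1000 * z))); [apply Rmult_le_compat_r; lra|].
replace ((204 / 100 * z) ^ 4 * exp (- (124 / 1000 * z))) with ((204 / 100) ^ 4 * (z ^ 4 * exp (- (124 / 1000 * z)))) by ring.
lra.
Qed.

Lemma y_pow_exp k : (k <= 8)%nat -> (139 / 10) ^ (8 - k) * (y ^ k * exp (- (124 / 1000 * z))) <= 1400.
Proof.
intros Hk; assert (H := y_pow8_exp); assert (Hy := y_ge); assert (Hp := exp_pos (- (124 / 1000 * z))).
apply Rle_trans with (2 := H).
replace (y ^ 8) with (y ^ (8 - k) * y ^ k) by (rewrite <- pow_add; f_equal; lia).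
rewrite Rmult_assoc; apply Rmult_le_compat_r; [apply Rmult_le_pos; [apply pow_le|]; lra|].
apply pow_incr; lra.
Qed.

Lemma rho_T_le : rho T <= exp (- (124 / 1000 * z)).
Proof.
assert (HT := T_pos); assert (H4 := four_tau_le_PI).
assert (H := rho_mid_le T ltac:(lra)); fold z in H.
replace (- (3 * (T - T) / tau)) with 0 in H by (field; lra).
rewrite exp_0, Rmult_1_r, (Rmult_comm (T ^ 6)) in H.
apply (Rmult_le_reg_r (T ^ 6)); [apply pow_lt; lra|exact H].
Qed.

Lemma rr_nonneg k : 0 <= rr k.
Proof. apply Rmult_le_pos; [apply pow_le; left; apply w_pos|apply tail_nonneg]. Qed.

Lemma rr_step k : 69 / 10 * rr k <= rr (S k).
Proof.
assert (H := tail_step k); assert (Hw := w_pos); assert (Hy := y_ge).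
assert (Hwk : 0 < w ^ (S k + 1)) by (apply pow_lt; exact Hw).
apply (Rmult_le_compat_l (w ^ (S k + 1))) in H; [|lra].
apply Rle_trans with (2 := H).
replace (w ^ (S k + 1) * (999 / 1000 * T * tail k)) with (999 / 2000 * y * rr k).
2:{ unfold rr, y, T; simpl; field. }
apply Rmult_le_compat_r; [apply rr_nonneg|lra].
Qed.

(** The arc up to [4 tau] contributes at most [1400 / (13.9 * 192)], the rest at most
    [256 * 2.04^4 / (1000 * 13.9)]. *)
Lemma rr6_le : rr 6 <= 85 / 100.
Proof.
assert (H := tail6_le); assert (Hw := w_pos); assert (Hz := z_ge); assert (Hy := y_ge); fold z in H.
assert (Hy2 := y_sqr_bounds).
assert (Hw7 : 0 < w ^ 7) by (apply pow_lt; exact Hw).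
apply (Rmult_le_compat_l (w ^ 7)) in H; [|lra].
change (rr 6) with (w ^ 7 * tail 6); apply Rle_trans with (1 := H).
assert (Ew : w = y * z) by (unfold y, z; field; lra).
replace (w ^ 7 * (T ^ 6 * exp (- (124 / 1000 * z)) * (tau / 3) + 256 * exp (- (499 / 1000 * z))))
  with (y ^ 7 * exp (- (124 / 1000 * z)) / 192 + 256 * (y ^ 7 * (z ^ 7 * exp (- (499 / 1000 * z))))).
2:{ rewrite Rmult_plus_distr_l; f_equal; [unfold y, T; field|rewrite Ew; ring]. }
assert (H1 := y_pow_exp 7 ltac:(lia)); simpl (8 - 7)%nat in H1; rewrite pow_1 in H1.
assert (H8 : y ^ 8 <= (204 / 100) ^ 4 * z ^ 4).
{ replace (y ^ 8) with ((y ^ 2) ^ 4) by ring; rewrite <- Rpow_mult_distr.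
  apply pow_incr; split; [apply pow2_ge_0|lra]. }
assert (H7 : 139 / 10 * y ^ 7 <= y ^ 8).
{ change (y ^ 8) with (y * y ^ 7); apply Rmult_le_compat_r; [apply pow_le; lra|exact Hy]. }
assert (H2 := exp_tail2).
assert (Hp : 0 < z ^ 7 * exp (- (499 / 1000 * z))) by (apply Rmult_lt_0_compat; [apply pow_lt; lra|apply exp_pos]).
assert (139 / 10 * (y ^ 7 * (z ^ 7 * exp (- (499 / 1000 * z)))) <= (204 / 100) ^ 4 * / 1000).
{ apply Rle_trans with ((204 / 100) ^ 4 * z ^ 4 * (z ^ 7 * exp (- (499 / 1000 * z)))).
  - rewrite <- Rmult_assoc; apply Rmult_le_compat_r; lra.
  - replace ((204 / 100) ^ 4 * z ^ 4 * (z ^ 7 * exp (- (499 / 1000 * z)))) with ((204 / 100) ^ 4 * (z ^ 11 * exp (- (499 / 1000 * z)))) by ring.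
    apply Rmult_le_compat_l; lra. }
lra.
Qed.

(** An absolute lower bound, needed to compare the additive tail errors with the moments. Within one
    standard deviation [rho >= exp (- 1/2)], and [exp 1 <= 3] gives [57/100]. *)
Lemma mm0_ge : 57 / 100 <= mm 0.
Proof.
assert (Hw := w_pos); assert (Hy := y_ge); assert (HT := T_pos).
assert (Hiw : 0 < / w) by (apply Rinv_0_lt_compat; exact Hw).
assert (HwT : / w <= T).
{ apply (Rmult_le_reg_l w); [exact Hw|]; rewrite Rinv_r by lra; unfold T; fold y in Hy; unfold y in Hy; lra. }
assert (He : 57 / 100 <= exp (- / 2)).
{ assert (E : exp (- / 2) * exp (- / 2) * exp 1 = 1) by (rewrite <- !exp_plus; replace (- / 2 + - / 2 + 1) with 0 by lra; apply exp_0).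
  assert (H3 := exp_le_3); assert (Hp := exp_pos (- / 2)).
  apply Rsqr_incr_0_var; [|lra]; unfold Rsqr.
  assert (0 < exp (- / 2) * exp (- / 2)) by (apply Rmult_lt_0_compat; lra); nra. }
assert (HM : exp (- / 2) * / w <= M 0).
{ unfold M; rewrite <- (RInt_Chasles_R _ 0 (/ w) T) by apply ex_RInt_rho_pow.
  rewrite <- (Rplus_0_r (exp (- / 2) * / w)); apply Rplus_le_compat.
  - replace (exp (- / 2) * / w) with (RInt (fun _ => exp (- / 2)) 0 (/ w)).
    2:{ rewrite RInt_const; unfold scal; simpl; unfold mult; simpl; ring. }
    apply RInt_le; [lra|apply ex_RInt_const|apply ex_RInt_rho_pow|].
    intros t Ht; simpl; rewrite Rmult_1_r; apply Rle_trans with (2 := rho_ge t ltac:(lra)).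
    assert (sig * t ^ 2 <= 1).
    { rewrite <- w_sqr, <- Rpow_mult_distr, <- (pow1 2); apply pow_incr; split; [apply Rmult_le_pos; lra|].
      rewrite <- (Rinv_r w) by lra; apply Rmult_le_compat_l; lra. }
    apply exp_le_mono; lra.
  - apply RInt_ge_0; [lra|apply ex_RInt_rho_pow|].
    intros t Ht; simpl; rewrite Rmult_1_r; left; apply rho_pos. }
apply Rle_trans with (1 := He); unfold mm; simpl; rewrite Rmult_1_r.
replace (exp (- / 2)) with (w * (exp (- / 2) * / w)) by (field; lra).
apply Rmult_le_compat_l; lra.
Qed.

(** [l] is of order [sqrt tau]; the constant exceeds [0.829 / 1.62^(3/2) / sqrt 120]. Squaring both
    sides avoids the roots. *)
Lemma l_bounds : 0 <= l <= 3671 / 100000.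
Proof.
assert (Hw := w_pos); assert (Hs := sig_ge); assert (Hl := lam_le); assert (Hl0 := lam_nonneg).
assert (Hw3 : 0 < w ^ 3) by (apply pow_lt; exact Hw).
assert (H0 : 0 <= l) by (apply Rmult_le_pos; [exact Hl0|left; apply Rinv_0_lt_compat; exact Hw3]).
split; [exact H0|].
apply Rsqr_incr_0_var; [|lra].
replace (Rsqr l) with (lam ^ 2 / sig ^ 3) by (unfold Rsqr, l; rewrite <- w_sqr; field; lra).
assert (Ht4 : 0 < tau ^ 4) by (apply pow_lt; lra).
assert (Ht3 : 0 < tau ^ 3) by (apply pow_lt; lra).
assert (Hi3 : 0 < / tau ^ 3) by (apply Rinv_0_lt_compat; lra).
assert (H1 : lam ^ 2 <= (829 / 1000 / tau ^ 4) ^ 2) by (apply pow_incr; lra).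
assert (H2 : (162 / 100 / tau ^ 3) ^ 3 <= sig ^ 3) by (apply pow_incr; split; [unfold Rdiv; lra|exact Hs]).
assert (Hs3 : 0 < sig ^ 3) by (apply pow_lt, sig_pos).
apply (Rmult_le_reg_r (sig ^ 3)); [exact Hs3|].
replace (lam ^ 2 / sig ^ 3 * sig ^ 3) with (lam ^ 2) by (field; lra).
apply Rle_trans with (1 := H1).
apply Rle_trans with (Rsqr (3671 / 100000) * (162 / 100 / tau ^ 3) ^ 3).
- replace ((829 / 1000 / tau ^ 4) ^ 2) with ((829 / 1000) ^ 2 * tau * / tau ^ 9) by (field; lra).
  replace (Rsqr (3671 / 100000) * (162 / 100 / tau ^ 3) ^ 3) with (Rsqr (3671 / 100000) * (162 / 100) ^ 3 * / tau ^ 9) by (field; lra).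
  apply Rmult_le_compat_r; [left; apply Rinv_0_lt_compat, pow_lt; lra|unfold Rsqr; lra].
- apply Rmult_le_compat_l; [apply Rle_0_sqr|exact H2].
Qed.

Lemma evenint_scaled_ge k : (k <= 6)%nat ->
  9999 / 10000 * mm k - 6739 / 10000000 * mm (k + 6) - rr k <= w ^ (k + 1) * evenint k.
Proof.
intros Hk; assert (H := evenint_ge k Hk); assert (Hw := w_pos); assert (Hl := l_bounds).
assert (Hwk : 0 < w ^ (k + 1)) by (apply pow_lt; exact Hw).
apply (Rmult_le_compat_l (w ^ (k + 1))) in H; [|lra].
apply Rle_trans with (2 := H).
replace (w ^ (k + 1) * (9999 / 10000 * M k - lam ^ 2 / 2 * M (k + 6) - tail k))
  with (9999 / 10000 * mm k - l ^ 2 / 2 * mm (k + 6) - rr k).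
2:{ unfold mm, rr, l; replace (k + 6 + 1)%nat with (6 + (k + 1))%nat by lia; rewrite (pow_add w 6); field; lra. }
assert (Hm := mm_nonneg (k + 6)).
assert (l ^ 2 <= (3671 / 100000) ^ 2) by (apply pow_incr; lra).
nra.
Qed.

Lemma oddint_scaled_le k : (k <= 6)%nat ->
  Rabs (w ^ (k + 1) * oddint k) <= 3671 / 100000 * mm (k + 3) + rr k.
Proof.
intros Hk; assert (H := oddint_abs_le k Hk); assert (Hw := w_pos); assert (Hl := l_bounds).
assert (Hwk : 0 < w ^ (k + 1)) by (apply pow_lt; exact Hw).
rewrite Rabs_mult, (Rabs_pos_eq (w ^ (k + 1))) by lra.
apply (Rmult_le_compat_l (w ^ (k + 1))) in H; [|lra].
apply Rle_trans with (1 := H).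
replace (w ^ (k + 1) * (lam * M (k + 3) + tail k)) with (l * mm (k + 3) + rr k).
2:{ unfold mm, rr, l; replace (k + 3 + 1)%nat with (3 + (k + 1))%nat by lia; rewrite (pow_add w 3); field; lra. }
assert (Hm := mm_nonneg (k + 3)); nra.
Qed.

(** Each product has total weight [w^8] after scaling, so the claim becomes one about scaled
    moments, all compared with [mm 2] and [mm 4]. In units of [mm 4 * mm 2] the main product
    contributes [30 * 0.53 * 0.87], about [13.8], against losses [2 * 1.9 * 1.01] and
    [12 * 2.1 * 0.13], together about [7.1]. *)
Lemma sextic_pos :
  0 < 2 * (evenint 6 * evenint 0) + 30 * (evenint 4 * evenint 2) + 12 * (oddint 5 * oddint 1).
Proof.
assert (Hw := w_pos).
assert (A0 := mm_upper 0); assert (A2 := mm_upper 2); assert (A4 := mm_upper 4).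
assert (A6 := mm_upper 6); assert (A8 := mm_upper 8); assert (A10 := mm_upper 10).
assert (N0 := mm_nonneg 0); assert (N2 := mm_nonneg 2); assert (N4 := mm_nonneg 4); assert (N6 := mm_nonneg 6).
assert (N8 := mm_nonneg 8); assert (N10 := mm_nonneg 10); assert (N12 := mm_nonneg 12).
assert (L0 := mm_lower 0); assert (L2 := mm_lower 2).
assert (G0 := mm0_ge).
assert (R6 := rr6_le); assert (S0 := rr_step 0); assert (S1 := rr_step 1); assert (S2 := rr_step 2).
assert (S3 := rr_step 3); assert (S4 := rr_step 4); assert (S5 := rr_step 5).
assert (P0 := rr_nonneg 0); assert (P1 := rr_nonneg 1); assert (P2 := rr_nonneg 2).
assert (U6 := evenint_scaled_ge 6 ltac:(lia)); assert (U4 := evenint_scaled_ge 4 ltac:(lia)).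
assert (U2 := evenint_scaled_ge 2 ltac:(lia)); assert (U0 := evenint_scaled_ge 0 ltac:(lia)).
assert (V5 := oddint_scaled_le 5 ltac:(lia)); assert (V1 := oddint_scaled_le 1 ltac:(lia)).
assert (U0' : w * evenint 0 <= mm 0 + rr 0).
{ assert (H := evenint0_le); apply (Rmult_le_compat_l w) in H; [|lra].
  unfold mm, rr; simpl; rewrite Rmult_1_r; lra. }
assert (Y1 : (y / 2) ^ 1 * rho T <= / 1000).
{ assert (H := y_pow_exp 1 ltac:(lia)); assert (Hr := rho_T_le); assert (Hy := y_ge).
  simpl (8 - 1)%nat in H; rewrite !pow_1 in *.
  assert (y * rho T <= y * exp (- (124 / 1000 * z))) by (apply Rmult_le_compat_l; lra).
  lra. }
assert (Y3 : (y / 2) ^ 3 * rho T <= / 1000).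
{ assert (H := y_pow_exp 3 ltac:(lia)); assert (Hr := rho_T_le); assert (Hy := y_ge).
  simpl (8 - 3)%nat in H.
  assert (y ^ 3 * rho T <= y ^ 3 * exp (- (124 / 1000 * z))) by (apply Rmult_le_compat_l; [apply pow_le; lra|lra]).
  replace ((y / 2) ^ 3 * rho T) with (y ^ 3 * rho T / 8) by field.
  lra. }
simpl (0 + 1)%nat in *; simpl (0 + 2)%nat in *; simpl (0 + 3)%nat in *; simpl (0 + 6)%nat in *.
simpl (2 + 1)%nat in *; simpl (2 + 2)%nat in *; simpl (2 + 3)%nat in *; simpl (2 + 6)%nat in *.
simpl (4 + 1)%nat in *; simpl (4 + 2)%nat in *; simpl (4 + 3)%nat in *; simpl (4 + 6)%nat in *.
simpl (6 + 1)%nat in *; simpl (6 + 2)%nat in *; simpl (6 + 3)%nat in *; simpl (6 + 6)%nat in *.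
simpl (8 + 1)%nat in *; simpl (8 + 2)%nat in *; simpl (8 + 3)%nat in *.
simpl (10 + 1)%nat in *; simpl (10 + 2)%nat in *; simpl (10 + 3)%nat in *.
simpl (1 + 1)%nat in *; simpl (1 + 3)%nat in *; simpl (5 + 1)%nat in *; simpl (5 + 3)%nat in *.
repeat match goal with H : context [INR ?n] |- _ => rewrite (INR_IZR_INZ n) in H end.
simpl Z.of_nat in *.
rewrite (pow_1 w) in *.
clearbody mm rr.
set (u6 := w ^ 7 * evenint 6) in *; set (u4 := w ^ 5 * evenint 4) in *.
set (u2 := w ^ 3 * evenint 2) in *; set (u0 := w * evenint 0) in *.
set (v5 := w ^ 6 * oddint 5) in *; set (v1 := w ^ 2 * oddint 1) in *.
assert (E : w ^ 8 * (2 * (evenint 6 * evenint 0) + 30 * (evenint 4 * evenint 2) + 12 * (oddint 5 * oddint 1))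
  = 2 * (u6 * u0) + 30 * (u4 * u2) + 12 * (v5 * v1)) by (unfold u6, u4, u2, u0, v5, v1; ring).
assert (Hw8 : 0 < w ^ 8) by (apply pow_lt; exact Hw).
apply (Rmult_lt_reg_l (w ^ 8)); [exact Hw8|]; rewrite Rmult_0_r, E.
clearbody u6 u4 u2 u0 v5 v1.
(* From here the bounds on single integrals are linear in [mm] and [rr]. Moments above the fourth
   are reduced to [mm 4] by the upper recursion, and the tails are absorbed by the absolute lower
   bounds [B2] and [B4]. *)
assert (B2 : 568 / 1000 <= mm 2%nat) by lra.
assert (B4 : 17 / 10 <= mm 4%nat) by lra.
assert (B0 : mm 0%nat <= 1002 / 1000 * mm 2%nat) by lra.
assert (C4 : 53 / 100 * mm 4%nat <= u4) by lra.
assert (C2 : 87 / 100 * mm 2%nat <= u2) by lra.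
assert (C6 : - (19 / 10 * mm 4%nat) <= u6) by lra.
assert (C0 : 0 <= u0 <= 101 / 100 * mm 2%nat) by lra.
assert (C5 : Rabs v5 <= 21 / 10 * mm 4%nat) by lra.
assert (C1 : Rabs v1 <= 13 / 100 * mm 2%nat) by lra.
assert (C51 : - (21 / 10 * mm 4%nat * (13 / 100 * mm 2%nat)) <= v5 * v1).
{ assert (H : Rabs (v5 * v1) <= 21 / 10 * mm 4%nat * (13 / 100 * mm 2%nat)).
  { rewrite Rabs_mult; apply Rmult_le_compat; auto using Rabs_pos. }
  apply Rabs_le_between in H; lra. }
assert (C42 : 53 / 100 * mm 4%nat * (87 / 100 * mm 2%nat) <= u4 * u2) by (apply Rmult_le_compat; lra).
assert (C60 : - (19 / 10 * mm 4%nat * (101 / 100 * mm 2%nat)) <= u6 * u0).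
{ apply Rle_trans with (- (19 / 10 * mm 4%nat) * u0); [|apply Rmult_le_compat_r; lra].
  assert (19 / 10 * mm 4%nat * u0 <= 19 / 10 * mm 4%nat * (101 / 100 * mm 2%nat)) by (apply Rmult_le_compat_l; lra).
  lra. }
assert (0 < mm 4%nat * mm 2%nat) by (apply Rmult_lt_0_compat; lra).
lra.
Qed.

End Saddle.

(** * The inequality for large indices *)

Section LargeIndex.
Local Open Scope R_scope.

Lemma is_RInt_plus_R (f g : R -> R) a b p q :
  is_RInt f a b p -> is_RInt g a b q -> is_RInt (fun t => f t + g t) a b (p + q).
Proof. apply (is_RInt_plus (V := R_NormedModule)). Qed.

Lemma is_RInt_scal_R (f : R -> R) a b c p :
  is_RInt f a b p -> is_RInt (fun t => c * f t) a b (c * p).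
Proof. intros H; apply (is_RInt_scal (V := R_NormedModule) f a b c p H). Qed.

(** A shift of the index by [d] multiplies the integrand by a trigonometric polynomial, which the
    hypotheses write as a form of degree six in the half angle; the powers of two turn [s^k] into
    the weight [(2 s)^k]. *)
Lemma coefint_split B tau (m : nat) (d a0 a2 a4 a6 b1 b3 b5 : R) :
  (forall t c s, c = cos (t / 2) -> s = sin (t / 2) ->
     cos (d * t) = a0 * c ^ 6 + 4 * a2 * s ^ 2 * c ^ 4 + 16 * a4 * s ^ 4 * c ^ 2 + 64 * a6 * s ^ 6) ->
  (forall t c s, c = cos (t / 2) -> s = sin (t / 2) ->
     sin (d * t) = 2 * b1 * s * c ^ 5 + 8 * b3 * s ^ 3 * c ^ 3 + 32 * b5 * s ^ 5 * c) ->
  coefint B (INR m + d) (exp (- tau)) = exp (cosum B (exp (- tau)) 0) *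
    (a0 * evenint B tau m 0 + a2 * evenint B tau m 2 + a4 * evenint B tau m 4 + a6 * evenint B tau m 6
     + (b1 * oddint B tau m 1 + b3 * oddint B tau m 3 + b5 * oddint B tau m 5)).
Proof.
intros Hc Hs; unfold coefint; apply is_RInt_unique.
set (x := exp (- tau)).
apply is_RInt_ext with (fun t => exp (cosum B x 0) *
  (let W k := exp (cosum B x t - cosum B x 0) * cos (sinsum B x t - INR m * t) * ((2 * sin (t / 2)) ^ k * cos (t / 2) ^ (6 - k)) in
   let Z k := exp (cosum B x t - cosum B x 0) * sin (sinsum B x t - INR m * t) * ((2 * sin (t / 2)) ^ k * cos (t / 2) ^ (6 - k)) in
   a0 * W 0%nat + a2 * W 2%nat + a4 * W 4%nat + a6 * W 6%nat + (b1 * Z 1%nat + b3 * Z 3%nat + b5 * Z 5%nat))).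
- intros t _.
  match goal with |- ?p = ?q => change (@eq R p q) end.
  replace (sinsum B x t - (INR m + d) * t) with ((sinsum B x t - INR m * t) - d * t) by ring.
  rewrite (cos_minus (sinsum B x t - INR m * t) (d * t)), (Hc t _ _ eq_refl eq_refl), (Hs t _ _ eq_refl eq_refl).
  assert (E : exp (cosum B x t) = exp (cosum B x 0) * exp (cosum B x t - cosum B x 0))
    by (rewrite <- exp_plus; f_equal; ring).
  rewrite E; simpl; ring.
- assert (HU : forall k, is_RInt (fun t => exp (cosum B x t - cosum B x 0) * cos (sinsum B x t - INR m * t)
    * ((2 * sin (t / 2)) ^ k * cos (t / 2) ^ (6 - k))) 0 PI (evenint B tau m k)).
  { intros k; apply (RInt_correct (V := R_CompleteNormedModule)), (ex_RInt_evenint B tau m k). }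
  assert (HV : forall k, is_RInt (fun t => exp (cosum B x t - cosum B x 0) * sin (sinsum B x t - INR m * t)
    * ((2 * sin (t / 2)) ^ k * cos (t / 2) ^ (6 - k))) 0 PI (oddint B tau m k)).
  { intros k; apply (RInt_correct (V := R_CompleteNormedModule)), (ex_RInt_oddint B tau m k). }
  cbv zeta; apply is_RInt_scal_R, is_RInt_plus_R.
  + apply is_RInt_plus_R; [apply is_RInt_plus_R; [apply is_RInt_plus_R|]|]; apply is_RInt_scal_R, HU.
  + apply is_RInt_plus_R; [apply is_RInt_plus_R|]; apply is_RInt_scal_R, HV.
Qed.

Lemma cos_double_half t c s : c = cos (t / 2) -> s = sin (t / 2) ->
  cos t = c ^ 2 - s ^ 2 /\ sin t = 2 * s * c /\ c ^ 2 + s ^ 2 = 1.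
Proof.
intros -> ->; replace t with (2 * (t / 2)) at 1 4 by field.
rewrite cos_2a, sin_2a; split; [ring|split; [ring|]].
rewrite <- (sin2_cos2 (t / 2)); unfold Rsqr; ring.
Qed.

(** Up to sign the left side is the quadratic invariant of a binary sextic. Passing from
    [exp (i t / 2)], [exp (- i t / 2)] to cosine and sine is a linear substitution, so the pattern
    1, 6, 15, 10 reappears on the right. *)
Lemma coefint_splits B tau m :
  let I d := coefint B (INR m + d) (exp (- tau)) in
  let Z := exp (cosum B (exp (- tau)) 0) in
  let U := evenint B tau m in
  let V := oddint B tau m in
  10 * I 0 ^ 2 + 6 * (I (-2) * I 2) - 15 * (I (-1) * I 1) - I (-3) * I 3
  = Z ^ 2 * (U 6%nat * U 0%nat + 15 * (U 4%nat * U 2%nat) + 6 * (V 5%nat * V 1%nat) + 10 * V 3%nat ^ 2).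
Proof.
intros I Z U V.
assert (T3 : forall t c s, c = cos (t / 2) -> s = sin (t / 2) ->
  cos (2 * t) = (c ^ 2 - s ^ 2) ^ 2 - (2 * s * c) ^ 2 /\ sin (2 * t) = 2 * (2 * s * c) * (c ^ 2 - s ^ 2) /\
  cos (3 * t) = (c ^ 2 - s ^ 2) ^ 3 - 3 * (c ^ 2 - s ^ 2) * (2 * s * c) ^ 2 /\
  sin (3 * t) = 3 * (c ^ 2 - s ^ 2) ^ 2 * (2 * s * c) - (2 * s * c) ^ 3).
{ intros t c s Ec Es; destruct (cos_double_half t c s Ec Es) as [Hc [Hs _]].
  rewrite <- Hc, <- Hs, cos_2a, sin_2a.
  replace (3 * t) with (2 * t + t) by ring; rewrite cos_plus, sin_plus, cos_2a, sin_2a.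
  repeat split; ring. }
assert (H0 : I 0 = Z * (1 * U 0%nat + 3 / 4 * U 2%nat + 3 / 16 * U 4%nat + / 64 * U 6%nat + (0 * V 1%nat + 0 * V 3%nat + 0 * V 5%nat))).
{ apply (coefint_split B tau m 0 1 (3 / 4) (3 / 16) (/ 64) 0 0 0); intros t c s Ec Es; destruct (cos_double_half t c s Ec Es) as [_ [_ H1]].
  (* Here and below, powers of [c^2 + s^2 = 1] raise the expression to degree six. *)
  - rewrite Rmult_0_l, cos_0; transitivity ((c ^ 2 + s ^ 2) ^ 3); [rewrite H1; ring|field].
  - rewrite Rmult_0_l, sin_0; ring. }
assert (H1 : I 1 = Z * (1 * U 0%nat + / 4 * U 2%nat + - / 16 * U 4%nat + - / 64 * U 6%nat + (1 * V 1%nat + / 2 * V 3%nat + / 16 * V 5%nat))).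
{ apply (coefint_split B tau m 1 1 (/ 4) (- / 16) (- / 64) 1 (/ 2) (/ 16)); intros t c s Ec Es; destruct (cos_double_half t c s Ec Es) as [Hc [Hs H1]]; rewrite Rmult_1_l.
  - rewrite Hc; transitivity ((c ^ 2 - s ^ 2) * (c ^ 2 + s ^ 2) ^ 2); [rewrite H1; ring|field].
  - rewrite Hs; transitivity (2 * s * c * (c ^ 2 + s ^ 2) ^ 2); [rewrite H1; ring|field]. }
assert (H1' : I (-1) = Z * (1 * U 0%nat + / 4 * U 2%nat + - / 16 * U 4%nat + - / 64 * U 6%nat + (- 1 * V 1%nat + - / 2 * V 3%nat + - / 16 * V 5%nat))).
{ apply (coefint_split B tau m (-1) 1 (/ 4) (- / 16) (- / 64) (- 1) (- / 2) (- / 16)); intros t c s Ec Es; destruct (cos_double_half t c s Ec Es) as [Hc [Hs H2]].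
  - replace (-1 * t) with (- t) by ring; rewrite cos_neg, Hc.
    transitivity ((c ^ 2 - s ^ 2) * (c ^ 2 + s ^ 2) ^ 2); [rewrite H2; ring|field].
  - replace (-1 * t) with (- t) by ring; rewrite sin_neg, Hs.
    transitivity (- (2 * s * c * (c ^ 2 + s ^ 2) ^ 2)); [rewrite H2; ring|field]. }
assert (H2 : I 2 = Z * (1 * U 0%nat + - 5 / 4 * U 2%nat + - 5 / 16 * U 4%nat + / 64 * U 6%nat + (2 * V 1%nat + 0 * V 3%nat + - / 8 * V 5%nat))).
{ apply (coefint_split B tau m 2 1 (- 5 / 4) (- 5 / 16) (/ 64) 2 0 (- / 8)); intros t c s Ec Es; destruct (cos_double_half t c s Ec Es) as [_ [_ H2]];
    destruct (T3 t c s Ec Es) as [Hc [Hs _]].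
  - rewrite Hc; transitivity (((c ^ 2 - s ^ 2) ^ 2 - (2 * s * c) ^ 2) * (c ^ 2 + s ^ 2)); [rewrite H2; ring|field].
  - rewrite Hs; transitivity (2 * (2 * s * c) * (c ^ 2 - s ^ 2) * (c ^ 2 + s ^ 2)); [rewrite H2; ring|field]. }
assert (H2' : I (-2) = Z * (1 * U 0%nat + - 5 / 4 * U 2%nat + - 5 / 16 * U 4%nat + / 64 * U 6%nat + (- 2 * V 1%nat + 0 * V 3%nat + / 8 * V 5%nat))).
{ apply (coefint_split B tau m (-2) 1 (- 5 / 4) (- 5 / 16) (/ 64) (- 2) 0 (/ 8)); intros t c s Ec Es; destruct (cos_double_half t c s Ec Es) as [_ [_ H3]];
    destruct (T3 t c s Ec Es) as [Hc [Hs _]]; replace (-2 * t) with (- (2 * t)) by ring.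
  - rewrite cos_neg, Hc; transitivity (((c ^ 2 - s ^ 2) ^ 2 - (2 * s * c) ^ 2) * (c ^ 2 + s ^ 2)); [rewrite H3; ring|field].
  - rewrite sin_neg, Hs; transitivity (- (2 * (2 * s * c) * (c ^ 2 - s ^ 2) * (c ^ 2 + s ^ 2))); [rewrite H3; ring|field]. }
assert (H3 : I 3 = Z * (1 * U 0%nat + - 15 / 4 * U 2%nat + 15 / 16 * U 4%nat + - / 64 * U 6%nat + (3 * V 1%nat + - 5 / 2 * V 3%nat + 3 / 16 * V 5%nat))).
{ apply (coefint_split B tau m 3 1 (- 15 / 4) (15 / 16) (- / 64) 3 (- 5 / 2) (3 / 16)); intros t c s Ec Es; destruct (T3 t c s Ec Es) as [_ [_ [Hc Hs]]]; [rewrite Hc|rewrite Hs]; field. }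
assert (H3' : I (-3) = Z * (1 * U 0%nat + - 15 / 4 * U 2%nat + 15 / 16 * U 4%nat + - / 64 * U 6%nat + (- 3 * V 1%nat + 5 / 2 * V 3%nat + - 3 / 16 * V 5%nat))).
{ apply (coefint_split B tau m (-3) 1 (- 15 / 4) (15 / 16) (- / 64) (- 3) (5 / 2) (- 3 / 16)); intros t c s Ec Es; destruct (T3 t c s Ec Es) as [_ [_ [Hc Hs]]]; replace (-3 * t) with (- (3 * t)) by ring;
    [rewrite cos_neg, Hc|rewrite sin_neg, Hs]; field. }
rewrite H0, H1, H1', H2, H2', H3, H3'; field.
Qed.

Lemma box_first_row_ge B f :
  (1 <= B)%nat -> (forall j k, 0 <= f j k) -> rsum B (fun i => f 1%nat (2 * i + 1)%nat) <= box B f.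
Proof.
intros HB Hf; unfold box.
apply Rle_trans with (rsum 1 (fun j => rsum B (fun i => f (S j) (2 * i + 1)%nat))).
- right; symmetry; apply Rplus_0_l.
- apply rsum_le_range; [exact HB|]; intros; apply rsum_nonneg; auto.
Qed.

Lemma rsum_odd n : rsum n (fun i => INR (2 * i + 1)) = INR n ^ 2.
Proof.
induction n as [|n IH]; [simpl; ring|].
cbn [rsum]; rewrite IH, INR_odd, S_INR; ring.
Qed.

(* The saddle point: the mean of the truncated measure tilted by [x] is [m]. *)
Lemma exists_saddle (m : nat) : (12 * 1000 <= m)%nat ->
  exists tau, 1 <= 4 * INR m * tau /\ tau <= / 120 /\
    box (4 * m * m) (fun j k => INR k * exp (- tau) ^ (j * k)) = INR m.
Proof.
(* With this cutoff, [4 m tau >= 1] gives [B tau >= m] and hence [x^B <= exp (- m)]. *)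
intros Hm; set (B := (4 * m * m)%nat).
assert (HBm : (m <= B)%nat) by (unfold B; nia).
assert (Hm1 : 12000 <= INR m).
{ apply le_INR in Hm; rewrite mult_INR, !INR_IZR_INZ in Hm; simpl in Hm; rewrite INR_IZR_INZ; lra. }
set (f := fun x => box B (fun j k => INR k * x ^ (j * k))).
assert (Hcont : continuity f).
{ intros x; apply continuity_pt_filterlim.
  apply (ex_derive_continuous (V := R_NormedModule)).
  exists (box B (fun j k => INR k * (INR (j * k) * x ^ pred (j * k)))).
  apply (is_derive_box B (fun j k x => INR k * x ^ (j * k))).
  intros j k; auto_derive; [exact I|ring]. }
assert (Hnn : forall x, 0 <= x -> forall j k : nat, 0 <= INR k * x ^ (j * k)).
{ intros x Hx j k; apply Rmult_le_pos; [apply pos_INR|apply pow_le; exact Hx]. }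
assert (Hrow : forall x, 0 <= x -> rsum m (fun i => INR (2 * i + 1) * x ^ (2 * i + 1)) <= f x).
{ intros x Hx; apply Rle_trans with (rsum B (fun i => INR (2 * i + 1) * x ^ (2 * i + 1))).
  - apply rsum_le_range; [exact HBm|]; intros i _; apply Rmult_le_pos; [apply pos_INR|apply pow_le; exact Hx].
  - apply Rle_trans with (2 := box_first_row_ge B (fun j k => INR k * x ^ (j * k)) ltac:(lia) (Hnn x Hx)).
    right; apply rsum_ext; intros i _; rewrite Nat.mul_1_l; reflexivity. }
assert (f0 : f 0 = 0).
{ transitivity (box B (fun j k => 0 ^ (j * k) * INR k)); [apply box_ext; intros; ring|apply box_at_0]. }
assert (f1 : INR m < f 1).
{ assert (H := Hrow 1 ltac:(lra)).
  rewrite (rsum_ext m _ (fun i => INR (2 * i + 1))) in H by (intros; rewrite pow1; ring).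
  rewrite rsum_odd in H; nra. }
destruct (IVT_gen f 0 1 (INR m) Hcont) as [x [Hx E]].
{ rewrite Rmin_left, Rmax_right; lra. }
rewrite Rmin_left, Rmax_right in Hx by lra.
assert (Hx0 : 0 < x) by (destruct Hx as [[H| <-] _]; [exact H|lra]).
assert (Hx1 : x < 1) by (destruct Hx as [_ [H| ->]]; [exact H|lra]).
set (tau := - ln x).
assert (Ht : 0 < tau) by (unfold tau; assert (H := ln_increasing x 1 Hx0 Hx1); rewrite ln_1 in H; lra).
assert (Ext : exp (- tau) = x) by (unfold tau; rewrite Ropp_involutive; apply exp_ln; exact Hx0).
exists tau; rewrite Ext; split; [|split; [|exact E]].
(* Otherwise the first [m] terms of the first row keep at least half of their value at [x = 1], so
   the mean is at least [m^2 / 2]. *)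
- destruct (Rle_or_lt 1 (4 * INR m * tau)) as [H|H]; [exact H|exfalso].
  assert (Hr := Hrow x ltac:(lra)); rewrite E in Hr.
  assert (Hlow : / 2 * INR m ^ 2 <= rsum m (fun i => INR (2 * i + 1) * x ^ (2 * i + 1))).
  { rewrite <- rsum_odd, <- rsum_scal; apply rsum_le; intros i Hi.
    rewrite Rmult_comm; apply Rmult_le_compat_l; [apply pos_INR|].
    rewrite <- Ext, exp_pow_INR.
    assert (INR (2 * i + 1) <= 2 * INR m) by (replace 2 with (INR 2) by (simpl; ring); rewrite <- mult_INR; apply le_INR; lia).
    assert (INR (2 * i + 1) * tau <= / 2) by nra.
    assert (He : 1 + INR (2 * i + 1) * - tau <= exp (INR (2 * i + 1) * - tau)) by apply exp_ineq1_le.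
    lra. }
  nra.
(* [12000 = 33/40 * 120^2 + 120], so [box_mean_le] would give a mean below [12000]. *)
- destruct (Rle_or_lt tau (/ 120)) as [H|H]; [exact H|exfalso].
  assert (Hmean := box_mean_le B tau Ht); rewrite Ext in Hmean; fold (f x) in Hmean; rewrite E in Hmean.
  assert (Hi : / tau < 120) by (rewrite <- (Rinv_inv 120); apply Rinv_lt_contravar; nra).
  assert (Hi0 : 0 < / tau) by (apply Rinv_0_lt_compat; exact Ht).
  replace (33 / 40 / tau ^ 2) with (33 / 40 * (/ tau * / tau)) in Hmean by (field; lra).
  nra.
Qed.

(** The recurrence is required for every cutoff [B] because the box depends on [n] through the
    saddle point. *)
Lemma sextic_ineq_of_recurrence (u : nat -> R) :
  u O = 1 ->
  (forall B n, (1 <= n <= B)%nat ->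
     INR n * u n = box B (fun j k => if (j * k <=? n)%nat then INR k * u (n - j * k)%nat else 0)) ->
  forall n, (12 * 1000 <= n + 3)%nat ->
  15 * (u (n + 2)%nat * u (n + 4)%nat) + u n * u (n + 6)%nat
    < 10 * u (n + 3)%nat ^ 2 + 6 * (u (n + 1)%nat * u (n + 5)%nat).
Proof.
intros Hu0 Hu n Hn; set (m := (n + 3)%nat).
destruct (exists_saddle m ltac:(unfold m; lia)) as [tau [Hlow [Hup Hmean]]].
set (B := (4 * m * m)%nat) in *.
assert (Hm1 : 12000 <= INR m).
{ fold m in Hn; apply le_INR in Hn; rewrite mult_INR, !INR_IZR_INZ in Hn; simpl in Hn; rewrite INR_IZR_INZ; lra. }
assert (Ht : 0 < tau) by nra.
set (x := exp (- tau)) in *.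
assert (Hx0 : 0 < x) by apply exp_pos.
assert (HB : x ^ B <= tau ^ 2 / 1000).
{ assert (EB : x ^ B = / exp (4 * INR m * INR m * tau)).
  { unfold x; rewrite exp_pow_INR, <- exp_Ropp; f_equal; unfold B; rewrite !mult_INR; simpl; ring. }
  assert (H1 : INR m <= 4 * INR m * INR m * tau) by nra.
  assert (H2 : (INR m ^ 2 / 8) ^ 2 <= exp (4 * INR m * INR m * tau)).
  { apply Rle_trans with (exp (INR m)).
    - replace (exp (INR m)) with (exp (INR m / 2) ^ 2) by (rewrite exp_pow_INR; f_equal; simpl; field).
      apply pow_incr; split; [assert (0 <= INR m ^ 2) by apply pow2_ge_0; lra|].
      assert (H := exp_ge_2 (INR m / 2) ltac:(lra)); nra.
    - apply exp_le_mono, H1. }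
  rewrite EB.
  assert (Ht2 : (/ (4 * INR m)) ^ 2 <= tau ^ 2).
  { apply pow_incr; split; [left; apply Rinv_0_lt_compat; lra|].
    apply (Rmult_le_reg_l (4 * INR m)); [lra|]; rewrite Rinv_r by lra; lra. }
  apply Rle_trans with (/ (INR m ^ 2 / 8) ^ 2).
  - apply Rinv_le_contravar; [apply pow_lt; nra|exact H2].
  - apply Rle_trans with ((/ (4 * INR m)) ^ 2 / 1000); [|lra].
    replace ((/ (4 * INR m)) ^ 2 / 1000) with (/ (16000 * INR m ^ 2)) by (field; lra).
    apply Rinv_le_contravar; [apply Rmult_lt_0_compat; [lra|apply pow_lt; lra]|].
    assert (12000 * 12000 <= INR m ^ 2) by nra.
    nra. }
(* [K = m^2] satisfies [3 K + 1 <= 4 m^2 = B], and [m^2 tau >= m / 4] is large enough. *)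
assert (HK : x ^ (m * m) <= / 1000).
{ unfold x; rewrite exp_pow_INR, mult_INR.
  assert (H1 : INR m / 4 <= INR m * INR m * tau) by nra.
  assert (H2 : 1 + INR m * INR m * tau <= exp (INR m * INR m * tau)) by apply exp_ineq1_le.
  replace (INR m * INR m * - tau) with (- (INR m * INR m * tau)) by ring.
  rewrite exp_Ropp; apply Rinv_le_contravar; lra. }
assert (Hpos := sextic_pos B tau m (m * m) (conj Ht Hup) HB ltac:(unfold B, m; nia) ltac:(unfold B, m; nia) HK Hmean).
assert (Hsplit := coefint_splits B tau m); cbv beta zeta in Hsplit; fold x in Hsplit.
assert (Hco := coefint_eq B u x Hx0 Hu0 (Hu B)).
assert (HBn : (n + 6 <= B)%nat) by (unfold B, m; nia).
assert (Em : INR m = INR n + 3) by (unfold m; rewrite plus_INR; simpl; ring).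
replace (INR m + 0) with (INR (n + 3)) in Hsplit by (rewrite plus_INR, Em; simpl; ring).
replace (INR m + -1) with (INR (n + 2)) in Hsplit by (rewrite plus_INR, Em; simpl; ring).
replace (INR m + 1) with (INR (n + 4)) in Hsplit by (rewrite plus_INR, Em; simpl; ring).
replace (INR m + -2) with (INR (n + 1)) in Hsplit by (rewrite plus_INR, Em; simpl; ring).
replace (INR m + 2) with (INR (n + 5)) in Hsplit by (rewrite plus_INR, Em; simpl; ring).
replace (INR m + -3) with (INR n) in Hsplit by (rewrite Em; ring).
replace (INR m + 3) with (INR (n + 6)) in Hsplit by (rewrite plus_INR, Em; simpl; ring).
rewrite !Hco in Hsplit by lia.
assert (HZ : 0 < exp (cosum B x 0) ^ 2) by (apply pow_lt, exp_pos).
(* The one term not covered by [sextic_pos] is a square. *)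
assert (Hsq := pow2_ge_0 (oddint B tau m 3)).
set (S := evenint B tau m 6 * evenint B tau m 0 + 15 * (evenint B tau m 4 * evenint B tau m 2)
  + 6 * (oddint B tau m 5 * oddint B tau m 1) + 10 * oddint B tau m 3 ^ 2) in *.
assert (HS : 0 < S) by (unfold S; lra).
assert (HP : 0 < (PI * x ^ (n + 3)) ^ 2) by (apply pow_lt, Rmult_lt_0_compat; [apply PI_RGT_0|apply pow_lt; exact Hx0]).
(* The indices in each product add up to [2 m], so a common power of the radius factors out. *)
assert (Ex : forall a b, (a + b = 2 * n + 6)%nat -> x ^ a * x ^ b = x ^ (n + 3) * x ^ (n + 3)).
{ intros a b Hab; rewrite <- !pow_add; f_equal; lia. }
change (u m) with (u (n + 3)%nat).
apply Rminus_gt_0_lt, (Rmult_lt_reg_l ((PI * x ^ (n + 3)) ^ 2)); [exact HP|].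
rewrite Rmult_0_r.
replace ((PI * x ^ (n + 3)) ^ 2 * (10 * u (n + 3)%nat ^ 2 + 6 * (u (n + 1)%nat * u (n + 5)%nat)
   - (15 * (u (n + 2)%nat * u (n + 4)%nat) + u n * u (n + 6)%nat))) with (exp (cosum B x 0) ^ 2 * S).
- exact (Rmult_lt_0_compat _ _ HZ HS).
- rewrite <- Hsplit.
  transitivity (PI ^ 2 * (10 * u (n + 3)%nat ^ 2 * (x ^ (n + 3) * x ^ (n + 3))
    + 6 * (u (n + 1)%nat * u (n + 5)%nat) * (x ^ (n + 1) * x ^ (n + 5))
    - 15 * (u (n + 2)%nat * u (n + 4)%nat) * (x ^ (n + 2) * x ^ (n + 4)) - u n * u (n + 6)%nat * (x ^ n * x ^ (n + 6)))); [ring|].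
  rewrite (Ex (n + 1)%nat (n + 5)%nat), (Ex (n + 2)%nat (n + 4)%nat), (Ex n (n + 6)%nat) by lia; ring.
Qed.

End LargeIndex.

(** * The recurrence and the table for [q] *)

Section Recurrence.
Local Open Scope R_scope.

(* The coefficient of [X^z] in [prod_(1 <= i <= N) (1 + X^i)]; integer indices
   make the recursion free of side conditions. *)
Fixpoint dcoeff (N : nat) (z : Z) : R :=
  match N with
  | O => if (z =? 0)%Z then 1 else 0
  | S p => dcoeff p z + dcoeff p (z - Z.of_nat (S p))
  end.

Lemma dcoeff_neg N z : (z < 0)%Z -> dcoeff N z = 0.
Proof.
revert z; induction N as [|N IH]; intros z Hz; cbn [dcoeff].
- destruct (Z.eqb_spec z 0); [lia|reflexivity].
- rewrite !IH by lia; ring.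
Qed.

Lemma dcoeff_stable N p z : (z <= Z.of_nat N)%Z -> dcoeff (p + N) z = dcoeff N z.
Proof.
intros Hz; induction p as [|p IH]; [reflexivity|].
simpl (S p + N)%nat; cbn [dcoeff]; rewrite IH, (dcoeff_neg _ (z - _)) by lia; ring.
Qed.

Lemma dcoeff_0 N : dcoeff N 0 = 1.
Proof.
induction N as [|N IH]; [reflexivity|].
cbn [dcoeff]; rewrite IH, dcoeff_neg by lia; ring.
Qed.

(* The logarithmic derivative of the product: [k X^k / (1 + X^k)] is expanded into
   an alternating geometric series. *)
Lemma dcoeff_alt N J z : (z <= Z.of_nat J)%Z ->
  IZR z * dcoeff N z
  = rsum N (fun i => rsum J (fun j => (-1) ^ j * (INR (S i) * dcoeff N (z - Z.of_nat (S j * S i))))).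
Proof.
revert z; induction N as [|N IH]; intros z Hz.
- simpl; destruct (Z.eqb_spec z 0) as [->|]; simpl; ring.
- cbn [rsum].
  assert (E : IZR z * dcoeff (S N) z = IZR z * dcoeff N z + IZR (z - Z.of_nat (S N)) * dcoeff N (z - Z.of_nat (S N))
    + INR (S N) * dcoeff N (z - Z.of_nat (S N))).
  { cbn [dcoeff]; rewrite minus_IZR, <- INR_IZR_INZ; ring. }
  rewrite E, !IH by lia; rewrite <- rsum_plus; f_equal.
  + apply rsum_ext; intros i _; rewrite <- rsum_plus; apply rsum_ext; intros j _; cbn [dcoeff].
    replace (z - Z.of_nat (S j * S i) - Z.of_nat (S N))%Z with (z - Z.of_nat (S N) - Z.of_nat (S j * S i))%Z by lia; ring.
  + assert (Htel : forall J', rsum J' (fun j => (-1) ^ j * (INR (S N) * dcoeff (S N) (z - Z.of_nat (S j * S N))))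
      = INR (S N) * (dcoeff N (z - Z.of_nat (S N)) - (-1) ^ J' * dcoeff N (z - Z.of_nat (S J' * S N)))).
    { induction J' as [|J' IHJ]; [simpl rsum; rewrite Nat.mul_1_l; simpl pow; ring|].
      cbn [rsum]; rewrite IHJ; cbn [dcoeff].
      replace (z - Z.of_nat (S J' * S N) - Z.of_nat (S N))%Z with (z - Z.of_nat (S (S J') * S N))%Z by lia.
      simpl pow; ring. }
    rewrite Htel, (dcoeff_neg N (z - Z.of_nat (S J * S N))) by nia; ring.
Qed.

Lemma rsum_double n f : rsum (2 * n) f = rsum n (fun i => f (2 * i)%nat + f (2 * i + 1)%nat).
Proof.
induction n as [|n IH]; [reflexivity|].
replace (2 * S n)%nat with (S (S (2 * n))) by lia; cbn [rsum]; rewrite IH.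
replace (S (2 * n)) with (2 * n + 1)%nat by lia; ring.
Qed.

Lemma rsum_truncate n p f : (n <= p)%nat -> (forall i, (n <= i)%nat -> f i = 0) -> rsum p f = rsum n f.
Proof.
induction 1 as [|p Hp IH]; intros Hf; [reflexivity|].
cbn [rsum]; rewrite IH, Hf by assumption; ring.
Qed.

(* [X / (1 + X) = X / (1 - X) - 2 X^2 / (1 - X^2)], so that only odd [k] survive. *)
Lemma rsum_alt_odd B (f : nat -> R) : (forall i, (B < i)%nat -> f i = 0) ->
  rsum (2 * B) (fun i => rsum (2 * B) (fun j => (-1) ^ j * (INR (S i) * f (S j * S i)%nat)))
  = box B (fun j k => INR k * f (j * k)%nat).
Proof.
intros Hf.
set (E := rsum B (fun i => rsum B (fun j => 2 * INR (S i) * f (2 * (S j * S i))%nat))).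
assert (H1 : rsum (2 * B) (fun i => rsum (2 * B) (fun j => (-1) ^ j * (INR (S i) * f (S j * S i)%nat)))
  = rsum (2 * B) (fun i => rsum (2 * B) (fun j => INR (S i) * f (S j * S i)%nat)) + -1 * E).
{ assert (HE : E = rsum (2 * B) (fun i => rsum B (fun j => 2 * INR (S i) * f (2 * (S j * S i))%nat))).
  { symmetry; apply rsum_truncate; [lia|]; intros i Hi; apply rsum_zero; intros j _; rewrite Hf by nia; ring. }
  rewrite HE, <- rsum_scal, <- rsum_plus; apply rsum_ext; intros i _.
  rewrite <- rsum_scal, !rsum_double, <- rsum_plus; apply rsum_ext; intros j _.
  rewrite pow_add, pow_mult; replace ((-1) ^ 2) with 1 by ring; rewrite pow1.
  replace (2 * (S j * S i))%nat with (S (2 * j + 1) * S i)%nat by lia; ring. }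
rewrite H1, rsum_double, rsum_plus.
assert (HE : E = rsum B (fun i => rsum (2 * B) (fun j => INR (S (2 * i + 1)) * f (S j * S (2 * i + 1))%nat))).
{ apply rsum_ext; intros i _; symmetry; rewrite (rsum_truncate B) by (lia || (intros j Hj; rewrite Hf by nia; ring)).
  apply rsum_ext; intros j _.
  replace (S j * S (2 * i + 1))%nat with (2 * (S j * S i))%nat by lia.
  replace (S (2 * i + 1)) with (2 * S i)%nat by lia; rewrite mult_INR; simpl INR at 1; ring. }
rewrite <- HE; unfold box; rewrite rsum_swap.
transitivity (rsum B (fun i => rsum (2 * B) (fun j => INR (S (2 * i)) * f (S j * S (2 * i))%nat))).
{ rewrite rsum_swap; ring. }
rewrite (rsum_swap B B); apply rsum_ext; intros i _.
rewrite (rsum_truncate B) by (lia || (intros j Hj; rewrite Hf by nia; ring)).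
apply rsum_ext; intros j _; replace (2 * i + 1)%nat with (S (2 * i)) by lia; reflexivity.
Qed.

(** The product is first extended to [2 B] factors, which leaves the coefficients up to [B]
    unchanged and lets [rsum_alt_odd] pair even and odd indices. *)
Lemma dcoeff_rec B n : (n <= B)%nat ->
  INR n * dcoeff B (Z.of_nat n)
  = box B (fun j k => if (j * k <=? n)%nat then INR k * dcoeff B (Z.of_nat (n - j * k)) else 0).
Proof.
intros Hn; rewrite <- (dcoeff_stable B B) by lia; rewrite INR_IZR_INZ.
rewrite (dcoeff_alt (B + B) (2 * B)) by lia.
replace (B + B)%nat with (2 * B)%nat by lia.
rewrite (rsum_alt_odd B (fun t => dcoeff (2 * B) (Z.of_nat n - Z.of_nat t))).
- apply box_ext; intros j k _ _; destruct (Nat.leb_spec (j * k) n) as [H|H].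
  + rewrite <- Nat2Z.inj_sub by exact H.
    replace (2 * B)%nat with (B + B)%nat by lia; rewrite dcoeff_stable by lia; reflexivity.
  + rewrite dcoeff_neg by lia; ring.
- intros t Ht; apply dcoeff_neg; lia.
Qed.

End Recurrence.

(** * Computing the table by counting parts *)

Section Horner.
Local Open Scope R_scope.

(* The same with the number [k] of parts recorded. *)
Fixpoint kcoeff (N k : nat) (z : Z) : R :=
  match N with
  | O => if ((k =? 0)%nat && (z =? 0)%Z)%bool then 1 else 0
  | S p => kcoeff p k z + match k with O => 0 | S l => kcoeff p l (z - Z.of_nat (S p)) end
  end.

(** Both sides count the sets of [k + 1] parts among [1, ..., N + 1] with sum [z]. On the left the
    largest admissible part is absent or present; on the right [1] is subtracted from every part,
    and the part [0] is then absent or present. *)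
Lemma kcoeff_shift N k z :
  kcoeff N (S k) z + kcoeff N k (z - Z.of_nat (S N))
  = kcoeff N (S k) (z - Z.of_nat (S k)) + kcoeff N k (z - Z.of_nat (S k)).
Proof.
revert k z; induction N as [|N IH]; intros k z.
- simpl; destruct k as [|k]; simpl; ring.
- assert (H := IH k z); cbn [kcoeff].
  destruct k as [|k].
  + replace (z - Z.of_nat 1 - Z.of_nat (S N))%Z with (z - Z.of_nat (S (S N)))%Z by lia; lra.
  + assert (H2 := IH k (z - Z.of_nat (S (S N)))%Z).
    replace (z - Z.of_nat (S (S k)) - Z.of_nat (S N))%Z with (z - Z.of_nat (S (S N)) - Z.of_nat (S k))%Z by lia.
    lra.
Qed.

Lemma kcoeff_neg N k z : (z < 0)%Z -> kcoeff N k z = 0.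
Proof.
revert k z; induction N as [|N IH]; intros k z Hz; cbn [kcoeff].
- destruct (Z.eqb_spec z 0); [lia|rewrite Bool.andb_false_r; reflexivity].
- rewrite IH by exact Hz; destruct k; [ring|rewrite IH by lia; ring].
Qed.

(** Up to degree [N] the bound on the parts is not felt, so the series for [k + 1] parts is
    [X^(k+1) / (1 - X^(k+1))] times the series for [k] parts. *)
Lemma kcoeff_rec N k z : (z <= Z.of_nat N)%Z ->
  kcoeff N (S k) z = kcoeff N (S k) (z - Z.of_nat (S k)) + kcoeff N k (z - Z.of_nat (S k)).
Proof.
intros Hz; rewrite <- kcoeff_shift, (kcoeff_neg N k (z - Z.of_nat (S N))) by lia; ring.
Qed.

Lemma kcoeff_0 N z : kcoeff N 0 z = if (z =? 0)%Z then 1 else 0.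
Proof. induction N as [|N IH]; simpl; [reflexivity|rewrite IH; ring]. Qed.

Lemma kcoeff_gt N k z : (N < k)%nat -> kcoeff N k z = 0.
Proof.
revert k z; induction N as [|N IH]; intros k z Hk; cbn [kcoeff].
- destruct (Nat.eqb_spec k 0); [lia|reflexivity].
- rewrite IH by lia; destruct k; [ring|rewrite IH by lia; ring].
Qed.

Lemma rsum_kcoeff N z : rsum (S N) (fun k => kcoeff N k z) = dcoeff N z.
Proof.
revert z; induction N as [|N IH]; intros z; [simpl; ring|].
cbn [dcoeff]; rewrite <- !IH.
cbn [kcoeff]; rewrite rsum_plus; f_equal.
- rewrite (rsum_truncate (S N)); [reflexivity|lia|intros; apply kcoeff_gt; lia].
- rewrite rsum_recl; ring.
Qed.

(** The least sum of [k] distinct positive parts. *)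
Fixpoint tri (k : nat) : nat := match k with O => O | S l => (tri l + S l)%nat end.

Lemma kcoeff_lt_tri N k n : (n <= N)%nat -> (n < tri k)%nat -> kcoeff N k (Z.of_nat n) = 0.
Proof.
revert n; induction k as [|k IHk]; intros n Hn Hk; [simpl in Hk; lia|].
induction n as [n IHn] using lt_wf_ind; simpl in Hk.
rewrite kcoeff_rec by lia.
destruct (le_lt_dec (S k) n) as [H|H].
- replace (Z.of_nat n - Z.of_nat (S k))%Z with (Z.of_nat (n - S k)) by lia.
  rewrite IHn, IHk by (simpl; lia); ring.
- rewrite !kcoeff_neg by lia; ring.
Qed.

Lemma rsum_skip p n f : rsum (p + n) f = rsum p f + rsum n (fun i => f (p + i)%nat).
Proof.
induction n as [|n IH]; [rewrite Nat.add_0_r; simpl; ring|].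
rewrite Nat.add_succ_r; cbn [rsum]; rewrite IH; ring.
Qed.

Definition conv (f g : nat -> R) (n : nat) : R := rsum (S n) (fun i => f i * g (n - i)%nat).

(* [r = X^K / (1 - X^K) * h] and [b = X^K / (1 - X^K) * a] have [a * r = b * h]; the
   relation for [r] is only needed where [a] does not kill the product. *)
Lemma conv_transfer (a b r h : nat -> R) (K M : nat) :
  (1 <= K)%nat ->
  (forall i, (i < K)%nat -> r i = 0) ->
  (forall i, (i < K)%nat -> b i = 0) ->
  (forall i, (K + i <= M)%nat -> b (K + i)%nat = b i + a i) ->
  (forall i p, (K + p <= M)%nat -> (i <= p)%nat ->
     a i * r (K + (p - i))%nat = a i * (r (p - i)%nat + h (p - i)%nat)) ->
  forall n, (n <= M)%nat -> conv a r n = conv b h n.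
Proof.
intros HK Hr Hb HbK HrK n; induction n as [n IH] using lt_wf_ind; intros Hn.
destruct (le_lt_dec K n) as [H|H].
- set (p := (n - K)%nat); unfold conv at 1.
  rewrite (rsum_truncate (S p)) by (unfold p; lia || (intros i Hi; rewrite Hr by (unfold p in Hi; lia); ring)).
  rewrite (rsum_ext (S p) _ (fun i => a i * r (p - i)%nat + a i * h (p - i)%nat)).
  2:{ intros i Hi; replace (n - i)%nat with (K + (p - i))%nat by (unfold p in *; lia).
      rewrite HrK by (unfold p in *; lia); ring. }
  rewrite rsum_plus; fold (conv a r p); rewrite IH by (unfold p; lia).
  unfold conv at 2; replace (S n) with (K + S p)%nat by (unfold p; lia).
  rewrite rsum_skip, (rsum_zero K) by (intros i Hi; rewrite Hb by exact Hi; ring).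
  rewrite Rplus_0_l; unfold conv; rewrite <- rsum_plus; apply rsum_ext; intros i Hi.
  rewrite HbK by (unfold p in *; lia).
  replace (n - (K + i))%nat with (p - i)%nat by (unfold p; lia); ring.
- unfold conv; rewrite !rsum_zero; [reflexivity| |].
  + intros i Hi; rewrite Hb by lia; ring.
  + intros i Hi; rewrite Hr by lia; ring.
Qed.

Fixpoint force {A : Type} (p : positive) (v : A) : A :=
  match p with xH => v | xO p' => force p' v | xI p' => force p' v end.

(* The identity on [v]; it makes lazy evaluation compute [n] before [v]. *)
Definition forceN {A : Type} (n : N) (v : A) : A :=
  match n with N0 => v | Npos p => force p v end.

Lemma forceN_eq A n (v : A) : forceN n v = v.
Proof. destruct n as [|p]; [reflexivity|]; simpl; induction p; simpl; auto. Qed.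

(* Adds to [h] the sequence delayed by the length of the queue [front ++ rev back]. *)
Fixpoint delayed_sum (front back h : list N) : list N :=
  match h with
  | nil => nil
  | a :: h' =>
    match front with
    | b :: front' => let s := (a + b)%N in forceN s (s :: delayed_sum front' (s :: back) h')
    | nil => match List.rev' back with
             | b :: front' => let s := (a + b)%N in forceN s (s :: delayed_sum front' (s :: nil) h')
             | nil => nil
             end
    end
  end.

(** The output is fed back into the queue, so with [K] zeros initially queued this is division by
    [1 - X^K]; the back list is reversed only when the front is exhausted. *)
Lemma delayed_sum_spec h : forall front back, front ++ List.rev back <> nil ->
  length (delayed_sum front back h) = length h /\
  forall i, (i < length h)%nat ->
    List.nth i (delayed_sum front back h) 0%N
    = (List.nth i h 0 + List.nth i ((front ++ List.rev back) ++ delayed_sum front back h) 0)%N.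
Proof.
induction h as [|a h IH]; intros front back Hne; [split; [reflexivity|simpl; lia]|].
destruct front as [|b front].
- cbn [delayed_sum]; unfold List.rev'; rewrite <- List.rev_alt.
  destruct (List.rev back) as [|b front] eqn:Eb; [contradiction Hne; simpl; reflexivity|]; simpl app; rewrite forceN_eq.
  destruct (IH front (a + b :: nil)%N) as [Hl Hn].
  { intro E; apply (f_equal (@length N)) in E; rewrite List.length_app in E; simpl in E; lia. }
  split; [simpl; rewrite Hl; reflexivity|].
  intros [|i] Hi; [reflexivity|]; simpl in Hi; cbn [List.nth app]; rewrite Hn by lia.
  simpl List.rev; rewrite <- List.app_assoc; reflexivity.
- cbn [delayed_sum]; rewrite forceN_eq.
  destruct (IH front (a + b :: back)%N) as [Hl Hn].
  { intro E; apply (f_equal (@length N)) in E; rewrite List.length_app in E; simpl in E; rewrite List.length_app in E; simpl in E; lia. }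
  split; [simpl; rewrite Hl; reflexivity|].
  intros [|i] Hi; [reflexivity|]; simpl in Hi; cbn [List.nth app]; rewrite Hn by lia.
  simpl List.rev; rewrite <- !List.app_assoc; reflexivity.
Qed.

Fixpoint zeros (k : nat) (l : list N) : list N :=
  match k with O => l | S p => 0%N :: zeros p l end.

Lemma zeros_app k l : zeros k l = zeros k nil ++ l.
Proof. induction k as [|k IH]; simpl; [reflexivity|rewrite IH; reflexivity]. Qed.

Lemma length_zeros k l : length (zeros k l) = (k + length l)%nat.
Proof. induction k as [|k IH]; simpl; auto. Qed.

Lemma nth_zeros_lt k l i : (i < k)%nat -> List.nth i (zeros k l) 0%N = 0%N.
Proof. revert i; induction k as [|k IH]; intros [|i] Hi; simpl; try lia; apply IH; lia. Qed.

Lemma nth_zeros_add k l i : List.nth (k + i) (zeros k l) 0%N = List.nth i l 0%N.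
Proof. induction k as [|k IH]; simpl; auto. Qed.

(** The [k] zeros put in front multiply by [X^k]; the first of them is then overwritten by the
    summand [1]. *)
Definition horner_step (k : nat) (h : list N) : list N :=
  match zeros k (delayed_sum (zeros k nil) nil h) with nil => nil | _ :: t => 1%N :: t end.

(** The identity on [v], with the purpose of [forceN]: the list is computed before [v]. *)
Fixpoint spine {A : Type} (l : list N) (v : A) : A :=
  match l with nil => v | _ :: l' => spine l' v end.

Lemma spine_eq A l (v : A) : spine l v = v.
Proof. induction l; simpl; auto. Qed.

(* The coefficient lists of [H_k], where [H_(k-1) = 1 + X^k / (1 - X^k) * H_k]. *)
Fixpoint horner (k : nat) (h : list N) : list N :=
  match k with
  | O => h
  | S p => let h' := horner_step k h in spine h' (horner p h')
  end.

Definition entry (l : list N) (n : nat) : R := IZR (Z.of_N (List.nth n l 0%N)).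

(** The series for exactly [k] parts times [H_k] counts partitions into at least [k] distinct parts.
    Only [M + 1 - tri k] entries of [H_k] are kept, since the first factor vanishes below degree
    [tri k]. *)
Definition horner_inv (M k : nat) (l : list N) : Prop :=
  (length l + tri k = S M)%nat /\
  forall n, (n <= M)%nat ->
    conv (fun i => kcoeff M k (Z.of_nat i)) (entry l) n
    = rsum (S M - k) (fun i => kcoeff M (k + i) (Z.of_nat n)).

Lemma tri_ge k : (k <= tri k)%nat.
Proof. induction k; simpl; lia. Qed.

Lemma horner_inv_step M k l : horner_inv M (S k) l -> horner_inv M k (horner_step (S k) l).
Proof.
intros [Hlen Hconv].
assert (Hk := tri_ge (S k)); simpl tri in *.
set (r := zeros (S k) (delayed_sum (zeros (S k) nil) nil l)).
destruct (delayed_sum_spec l (zeros (S k) nil) nil) as [Hdl Hdn]; [discriminate|].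
rewrite List.app_nil_r in Hdn; rewrite <- zeros_app in Hdn; fold r in Hdn.
assert (Hr0 : forall i, (i < S k)%nat -> entry r i = 0).
{ intros i Hi; unfold entry, r; rewrite nth_zeros_lt by exact Hi; reflexivity. }
assert (HrS : forall i, (i < length l)%nat -> entry r (S k + i) = entry r i + entry l i).
{ intros i Hi; unfold entry; unfold r at 1; rewrite nth_zeros_add, Hdn by exact Hi.
  rewrite N2Z.inj_add, plus_IZR; ring. }
assert (Hstep : forall n, entry (horner_step (S k) l) n = (if (n =? 0)%nat then 1 else 0) + entry r n).
{ intros n; unfold horner_step; fold r; unfold entry, r; destruct n as [|n]; simpl; ring. }
split.
- unfold horner_step; fold r.
  assert (Hrl : length r = (S k + length l)%nat) by (unfold r; rewrite length_zeros, Hdl; reflexivity).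
  destruct r as [|x r]; simpl in *; lia.
- intros n Hn.
  assert (E : conv (fun i => kcoeff M k (Z.of_nat i)) (entry (horner_step (S k) l)) n
    = kcoeff M k (Z.of_nat n) + conv (fun i => kcoeff M k (Z.of_nat i)) (entry r) n).
  { unfold conv; rewrite (rsum_ext (S n) _ (fun i => kcoeff M k (Z.of_nat i) * (if (n - i =? 0)%nat then 1 else 0)
      + kcoeff M k (Z.of_nat i) * entry r (n - i)%nat)) by (intros; rewrite Hstep; ring).
    rewrite rsum_plus; f_equal; cbn [rsum]; rewrite Nat.sub_diag, rsum_zero; [simpl; ring|].
    intros i Hi; destruct (Nat.eqb_spec (n - i) 0); [lia|ring]. }
  rewrite E, (conv_transfer _ (fun i => kcoeff M (S k) (Z.of_nat i)) _ (entry l) (S k) M); try assumption; try lia.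
  + rewrite Hconv by exact Hn.
    replace (S M - k)%nat with (S (S M - S k)) by lia; rewrite rsum_recl, Nat.add_0_r; f_equal.
    apply rsum_ext; intros i _; rewrite Nat.add_succ_r; reflexivity.
  + intros i Hi; apply kcoeff_lt_tri; simpl; lia.
  + intros i Hi; rewrite kcoeff_rec by lia.
    replace (Z.of_nat (S k + i) - Z.of_nat (S k))%Z with (Z.of_nat i) by lia; reflexivity.
  + intros i p Hp Hi; destruct (le_lt_dec (length l) (p - i)) as [H|H].
    (* Where [p - i] is past the end of [l], the length equation forces [i < tri k]. *)
    * rewrite (kcoeff_lt_tri M k i) by lia; ring.
    * rewrite HrS by exact H; ring.
Qed.

Lemma horner_correct M k l : horner_inv M k l -> horner_inv M 0 (horner k l).
Proof.
revert l; induction k as [|k IH]; intros l H; [exact H|].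
cbn [horner]; rewrite spine_eq; apply IH, horner_inv_step, H.
Qed.

(** For the largest [k] with [tri k <= M] no partition of a number up to [M] has more than [k]
    distinct parts, so the truncated [H_k] is the constant [1]. *)
Definition qlist (M k : nat) : list N := horner k (1%N :: zeros (M - tri k) nil).

Lemma qlist_correct M k : (tri k <= M < tri (S k))%nat ->
  length (qlist M k) = S M /\ forall n, (n <= M)%nat -> entry (qlist M k) n = dcoeff M (Z.of_nat n).
Proof.
intros Hk; assert (Hkt := tri_ge k).
assert (Hinit : horner_inv M k (1%N :: zeros (M - tri k) nil)).
{ split; [simpl; rewrite length_zeros; simpl; lia|].
  intros n Hn; unfold conv; cbn [rsum]; rewrite Nat.sub_diag, rsum_zero.
  - replace (S M - k)%nat with (S (M - k)) by lia; rewrite rsum_recl, Nat.add_0_r, rsum_zero.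
    + unfold entry; simpl; ring.
    + intros i Hi; apply kcoeff_lt_tri; [exact Hn|].
      apply Nat.lt_le_trans with (tri (S k)); [simpl in *; lia|].
      clear; rewrite Nat.add_succ_r, <- Nat.add_succ_l; induction i as [|i IH]; [rewrite Nat.add_0_r; lia|].
      rewrite Nat.add_succ_r; simpl tri in *; lia.
  - intros i Hi; unfold entry; destruct (n - i)%nat as [|p] eqn:E; [lia|]; simpl List.nth.
    destruct (le_lt_dec (M - tri k) p) as [H|H].
    + rewrite List.nth_overflow by (rewrite length_zeros; simpl; lia); simpl; ring.
    + rewrite nth_zeros_lt by exact H; simpl; ring. }
destruct (horner_correct M k _ Hinit) as [Hlen Hconv]; fold (qlist M k) in *; simpl tri in Hlen.
split; [lia|]; intros n Hn.
specialize (Hconv n Hn); rewrite Nat.sub_0_r in Hconv; simpl (0 + _)%nat in Hconv.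
rewrite rsum_kcoeff in Hconv; rewrite <- Hconv; unfold conv.
rewrite rsum_recl, kcoeff_0, rsum_zero, Nat.sub_0_r; [simpl; ring|].
intros i _; rewrite kcoeff_0; destruct (Z.eqb_spec (Z.of_nat (S i)) 0); [lia|ring].
Qed.

End Horner.

(** * Verification of the small cases *)

Section Computation.
Local Open Scope Z_scope.

(* The sextic invariant in terms of iterated differences, whose products are shorter. *)
Definition sextic (a0 a1 a2 a3 a4 a5 a6 : Z) : Z :=
  let b1 := a1 - a0 in let b2 := a2 - a1 in let b3 := a3 - a2 in
  let b4 := a4 - a3 in let b5 := a5 - a4 in let b6 := a6 - a5 in
  let c2 := b2 - b1 in let c3 := b3 - b2 in let c4 := b4 - b3 in
  let c5 := b5 - b4 in let c6 := b6 - b5 in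
  let d3 := c3 - c2 in let d4 := c4 - c3 in let d5 := c5 - c4 in let d6 := c6 - c5 in
  let e4 := d4 - d3 in let e5 := d5 - d4 in let e6 := d6 - d5 in
  let f5 := e5 - e4 in let f6 := e6 - e5 in let g6 := f6 - f5 in
  10 * (d3 * d3) + 6 * (f5 * b1) - 15 * (e4 * c2) - g6 * a0.

Lemma sexticE a0 a1 a2 a3 a4 a5 a6 :
  sextic a0 a1 a2 a3 a4 a5 a6 = 10 * (a3 * a3) + 6 * (a1 * a5) - 15 * (a2 * a4) - a0 * a6.
Proof. unfold sextic; cbv zeta; ring. Qed.

(* Long numbers are compared through their leading bits; 68 bits suffice because the
   relative gap is of order [n^(-9/2)]. *)
Definition check7 (a0 a1 a2 a3 a4 a5 a6 : N) : bool :=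
  let s := (N.size a0 - 68)%N in
  let c0 := Z.of_N (N.shiftr a0 s) in let c1 := Z.of_N (N.shiftr a1 s) in
  let c2 := Z.of_N (N.shiftr a2 s) in let c3 := Z.of_N (N.shiftr a3 s) in
  let c4 := Z.of_N (N.shiftr a4 s) in let c5 := Z.of_N (N.shiftr a5 s) in
  let c6 := Z.of_N (N.shiftr a6 s) in
  if (s =? 0)%N then 0 <? sextic c0 c1 c2 c3 c4 c5 c6
  else 15 * (c2 + c4 + 1) + (c0 + c6 + 1) <=? sextic c0 c1 c2 c3 c4 c5 c6.

(** With [p = 2^s] and quotients [c], a positive product is at least [p^2 c c'] and a negative one
    is less than [p^2 (c + 1) (c' + 1)]; the excess [c + c' + 1] explains the left side of the
    test. *)
Lemma check7_correct a0 a1 a2 a3 a4 a5 a6 :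
  check7 a0 a1 a2 a3 a4 a5 a6 = true ->
  0 < 10 * (Z.of_N a3 * Z.of_N a3) + 6 * (Z.of_N a1 * Z.of_N a5)
      - 15 * (Z.of_N a2 * Z.of_N a4) - Z.of_N a0 * Z.of_N a6.
Proof.
unfold check7; cbv zeta; rewrite sexticE; generalize (N.size a0 - 68)%N; intros s.
destruct (N.eqb_spec s 0) as [->|_]; [rewrite !N.shiftr_0_r; apply Z.ltb_lt|].
rewrite Z.leb_le, !N.shiftr_div_pow2, !N2Z.inj_div.
set (p := Z.of_N (2 ^ s)).
assert (Hp : 0 < p).
{ assert (2 ^ s <> 0)%N by (apply N.pow_nonzero; discriminate); unfold p; lia. }
assert (Hb : forall a, exists r, Z.of_N a = p * (Z.of_N a / p) + r /\ 0 <= r < p /\ 0 <= Z.of_N a / p).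
{ intros a; exists (Z.of_N a mod p); split; [apply Z.div_mod; lia|split; [apply Z.mod_pos_bound; exact Hp|]].
  apply Z.div_pos; [apply N2Z.is_nonneg|exact Hp]. }
assert (Hll : forall a b, p * p * (Z.of_N a / p * (Z.of_N b / p)) <= Z.of_N a * Z.of_N b).
{ intros a b; destruct (Hb a) as [r [Ea [Hr Ha]]], (Hb b) as [t [Eb [Ht Hb']]].
  rewrite Ea at 2; rewrite Eb at 2; nia. }
assert (Hhh : forall a b, Z.of_N a * Z.of_N b < p * p * ((Z.of_N a / p + 1) * (Z.of_N b / p + 1))).
{ intros a b; destruct (Hb a) as [r [Ea [Hr Ha]]], (Hb b) as [t [Eb [Ht Hb']]].
  replace (p * p * ((Z.of_N a / p + 1) * (Z.of_N b / p + 1)))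
    with ((p * (Z.of_N a / p) + p) * (p * (Z.of_N b / p) + p)) by ring.
  rewrite Ea at 1; rewrite Eb at 1.
  set (u := p * (Z.of_N a / p)) in *; set (v := p * (Z.of_N b / p)) in *.
  assert (0 <= u) by (apply Z.mul_nonneg_nonneg; lia); assert (0 <= v) by (apply Z.mul_nonneg_nonneg; lia).
  apply Z.mul_lt_mono_nonneg; lia. }
intros H; apply (Z.mul_le_mono_nonneg_l _ _ (p * p)) in H; [|nia].
assert (H24 := Hhh a2 a4); assert (H06 := Hhh a0 a6); assert (H33 := Hll a3 a3); assert (H15 := Hll a1 a5).
set (c0 := Z.of_N a0 / p) in *; set (c1 := Z.of_N a1 / p) in *; set (c2 := Z.of_N a2 / p) in *.
set (c3 := Z.of_N a3 / p) in *; set (c4 := Z.of_N a4 / p) in *; set (c5 := Z.of_N a5 / p) in *.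
set (c6 := Z.of_N a6 / p) in *.
lia.
Qed.

Fixpoint check_all (l : list N) : bool :=
  match l with
  | a0 :: ((a1 :: a2 :: a3 :: a4 :: a5 :: a6 :: _) as t) =>
    if check7 a0 a1 a2 a3 a4 a5 a6 then check_all t else false
  | _ => true
  end.

Lemma check_all_correct l : check_all l = true ->
  forall i, (i + 6 < length l)%nat ->
  let a k := Z.of_N (nth (i + k) l 0%N) in
  0 < 10 * (a 3%nat * a 3%nat) + 6 * (a 1%nat * a 5%nat) - 15 * (a 2%nat * a 4%nat) - a 0%nat * a 6%nat.
Proof.
induction l as [|a0 l IH]; intros H i Hi; [simpl in Hi; lia|].
destruct l as [|a1 [|a2 [|a3 [|a4 [|a5 [|a6 l]]]]]]; try (simpl in Hi; lia).
cbn [check_all] in H.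
destruct (check7 a0 a1 a2 a3 a4 a5 a6) eqn:E; [|discriminate].
destruct i as [|i].
- exact (check7_correct _ _ _ _ _ _ _ E).
- apply (IH H i); simpl in *; lia.
Qed.

(** The range leaves room for [n + 6] with [n] up to [12 * 1000]; [154] is the largest number of
    distinct parts there, as [tri 154 = 11935] and [tri 155 = 12090]. *)
Lemma check_qlist : check_all (skipn 651 (qlist (12 * 1000 + 10) 154)) = true.
Proof. vm_cast_no_check (eq_refl true). Qed.

(* The table is hidden behind an existential so that it is never evaluated again. *)
Lemma small_table : exists l : list N,
  (forall n, (n <= 12 * 1000 + 10)%nat -> entry l n = dcoeff (12 * 1000 + 10) (Z.of_nat n)) /\
  forall n, (651 <= n)%nat -> (n <= 12 * 1000)%nat ->
  let a k := Z.of_N (nth (n + k) l 0%N) in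
  0 < 10 * (a 3%nat * a 3%nat) + 6 * (a 1%nat * a 5%nat) - 15 * (a 2%nat * a 4%nat) - a 0%nat * a 6%nat.
Proof.
assert (H := check_qlist).
assert (Htri : (tri 154 <= 12 * 1000 + 10 < tri 155)%nat) by (split; apply Nat.leb_le; vm_compute; reflexivity).
destruct (qlist_correct _ _ Htri) as [Hlen Hval]; revert H Hlen Hval.
generalize (qlist (12 * 1000 + 10) 154); intros l H Hlen Hval.
exists l; split; [exact Hval|]; intros n Hlo Hhi a.
assert (Hc := check_all_correct (skipn 651 l) H (n - 651)).
rewrite length_skipn, Hlen in Hc.
assert (E : forall k, nth (n - 651 + k) (skipn 651 l) 0%N = nth (n + k) l 0%N).
{ intros k; rewrite nth_skipn; f_equal; lia. }
cbv beta zeta in Hc; rewrite !E in Hc; apply Hc; lia.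
Qed.

End Computation.

(** * Joining the table and the analytic estimate *)

Section Combine.
Local Open Scope nat_scope.

(** Agreement with [dcoeff N] is assumed for every [N >= n]: the table uses one fixed [N], while in
    the analytic part [N] is the variable cutoff of the box. *)
Lemma sextic_ineq_nat (u : nat -> nat) :
  (forall N n, n <= N -> INR (u n) = dcoeff N (Z.of_nat n)) ->
  forall n, 651 <= n ->
  15 * (u (n + 2) * u (n + 4)) + u n * u (n + 6) < 10 * (u (n + 3) * u (n + 3)) + 6 * (u (n + 1) * u (n + 5)).
Proof.
intros Hu n Hn; destruct (le_lt_dec n (12 * 1000)) as [H|H].
- destruct small_table as [l [Hval Hineq]].
  assert (Hq := Hineq n Hn H); cbv beta zeta in Hq.
  assert (E : forall k, k <= 6 -> Z.of_N (nth (n + k) l 0%N) = Z.of_nat (u (n + k))).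
  { intros k Hk; apply eq_IZR; rewrite <- INR_IZR_INZ, (Hu (12 * 1000 + 10) (n + k)) by lia.
    exact (Hval (n + k) ltac:(lia)). }
  rewrite !E in Hq by lia; rewrite Nat.add_0_r in Hq; lia.
- apply INR_lt.
  assert (HR := sextic_ineq_of_recurrence (fun n => INR (u n))).
  rewrite !plus_INR, !mult_INR; cbv beta in HR.
  replace (INR 15) with 15%R by (simpl; ring); replace (INR 10) with 10%R by (simpl; ring); replace (INR 6) with 6%R by (simpl; ring).
  replace (INR (u (n + 3)%nat) * INR (u (n + 3)%nat))%R with (INR (u (n + 3)%nat) ^ 2)%R by ring.
  apply HR; [| |lia].
  + rewrite (Hu 0 0) by lia; apply dcoeff_0.
  + intros B m Hm; rewrite (Hu B) by lia; rewrite dcoeff_rec by lia.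
    apply box_ext; intros j k _ _; destruct (Nat.leb_spec (j * k) m) as [Hjk|]; [|reflexivity].
    rewrite (Hu B) by lia; reflexivity.
Qed.

End Combine.

From mathcomp Require Import all_boot ssralg poly.
Require Import Defs.

(** * Identification of [q] with the coefficients of the product *)

Section GeneratingPolynomial.
Import GRing.Theory.
Local Open Scope ring_scope.

Definition dpoly (N : nat) : {poly nat} := \prod_(i < N) (1 + 'X^(i.+1)).

(** Distributivity expands the product into a sum over subsets of the index set, the same sets that
    [q] counts. The value [F ord0 = 0] adds a trivial factor [1] to the product and kills precisely
    the subsets containing [0]. *)
Lemma q_dpoly n : q n = (dpoly n)`_n.
Proof.
pose F (i : 'I_n.+1) : {poly nat} := if i == ord0 then 0 else 'X^i.
have -> : dpoly n = \prod_i (F i + 1).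
  rewrite big_ord_recl /F /= add0r mul1r; apply: eq_bigr => i _.
  by rewrite addrC.
rewrite bigA_distr coef_sum /q cardsE -sum1_card big_mkcond /=.
apply: eq_bigr => A _; rewrite -big_mkcond /= unfold_in /=.
have [A0 | A0] := boolP (ord0 \in A).
  have -> : \prod_(i in A) F i = 0 by rewrite (bigD1 ord0 A0) /= mul0r.
  by rewrite coef0.
rewrite (eq_bigr (fun i : 'I_n.+1 => 'X^i)) => [|i iA]; last first.
  by rewrite /F; case: eqP iA A0 => // -> ->.
rewrite -expr_sum coefXn eq_sym; by case: eqP.
Qed.

Lemma dpoly_dcoeff (N n : nat) : INR ((dpoly N)`_n)%R = dcoeff N (Z.of_nat n).
Proof.
elim: N n => [|N IH] n.
  rewrite /dpoly big_ord0 coef1 /=; by case: n.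
rewrite /dpoly big_ord_recr /= -/(dpoly N) mulrDr mulr1 coefD coefMXn.
(* Exposes the semiring addition on [nat] as [Nat.add], the form expected by [plus_INR]. *)
have -> : forall a b : nat, a + b = Nat.add a b by [].
rewrite plus_INR IH; congr Rplus.
case: ltnP => [lt_n|le_n].
  by rewrite dcoeff_neg //; move/ltP: lt_n => lt_n; lia.
rewrite IH; congr dcoeff; move/leP: le_n => le_n.
by rewrite Nat2Z.inj_sub.
Qed.

Lemma q_dcoeff N n : (n <= N)%coq_nat -> INR (q n) = dcoeff N (Z.of_nat n).
Proof.
move=> le_nN; rewrite q_dpoly dpoly_dcoeff -(dcoeff_stable n (N - n)%coq_nat); last exact: Z.le_refl.
by rewrite Nat.sub_add.
Qed.

End GeneratingPolynomial.

Local Open Scope nat_scope.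

Theorem theorem1p9 (n : nat) (hn : 651 <= n) :
  15 * (q (n + 2) * q (n + 4)) + q n * q (n + 6)
    < 10 * q (n + 3) ^ 2 + 6 * (q (n + 1) * q (n + 5)).
Proof.
rewrite -mulnn; apply/ltP.
exact: (sextic_ineq_nat q q_dcoeff n (leP hn)).
Qed.
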